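(* Let $P$ be a right LCM monoid, let $S=\{[p,q] : p,q\in P\}\cup\{0\}$ be its associated inverse semigroup, and let $\mathcal{G}_{\mathrm{tight}}(S)$ be the tight groupoid of $S$. Suppose that $S$ satisfies condition (H): for every $s\in S$ there is a finite set $F\subseteq \mathcal{J}_s:=\{e\in E(S) : se=e\}$ such that for every nonzero $e\in\mathcal{J}_s$ there exists $f\in F$ with $ef\neq 0$. Let $\mathcal{Q}_r(P)=C^*_r(\mathcal{G}_{\mathrm{tight}}(S))$ be the reduced boundary quotient C*-algebra of $P$, let $$P_c=\{p\in P : pP\cap qP\neq\emptyset \text{ for all } q\in P\}$$ be the core submonoid of $P$, and let $$\mathcal{Q}_{r,c}(P)=C^*(T_{[p,q]} : p,q\in P_c)\subseteq \mathcal{Q}_r(P)$$ be the C*-subalgebra generated by the elements $T_{[p,q]}$ with $p,q\in P_c$. Then, for every C*-algebra $B$, a $*$-homomorphism $\pi\colon \mathcal{Q}_r(P)\to B$ is injective if and only if its restriction to $\mathcal{Q}_{r,c}(P)$ is injective.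
   Context: **Right LCM monoids.** A monoid $P$ (with identity $1$) is right LCM if it is left cancellative and for all $p,q\in P$ the intersection $pP\cap qP$ is either empty or of the form $rP$ for some $r\in P$. **The inverse semigroup $S$.** Let $U(P)$ be the group of invertible elements of $P$. On $P\times P$ set $(p,q)\sim(pu,qu)$ for $u\in U(P)$, and write $[p,q]$ for the class of $(p,q)$. Let $S=\{[p,q] : p,q\in P\}\cup\{0\}$, where $0$ is an adjoined zero element. The product is as follows: $[a,b][c,d]=[ab',dc']$ if $bP\cap cP=rP$ with $r=bb'=cc'$, and $[a,b][c,d]=0$ if $bP\cap cP=\emptyset$; products with $0$ are $0$. This is an inverse semigroup with $[p,q]^*=[q,p]$ and $0^*=0$. (One thinks of $[p,q]$ as the partial bijection $qP\to pP$, $qx\mapsto px$.) Its idempotent semilattice is $E(S)=\{[p,p] : p\in P\}\cup\{0\}$. The idempotent $[p,p]$ is identified with the right ideal $pP$ and $0$ with $\emptyset$, the product being intersection. The order on $E(S)$ is $e\le f$ iff $ef=e$. **Tight spectrum.** Write $E=E(S)$. A filter in $E$ is a nonempty subset $\xi\subseteq E$ with $0\notin\xi$ that is closed under products and upward closed. An ultrafilter is a filter maximal under inclusion. The set of filters is given the topology inherited from the product topology on $\{0,1\}^E$, and $\widehat E_{\mathrm{tight}}$ denotes the closure in the set of filters of the set of ultrafilters. For $e\in E$ put $D_e=\{\xi\in\widehat E_{\mathrm{tight}} : e\in\xi\}$, and write $D_{qP}$ for $D_{[q,q]}$. **Tight groupoid.** $S$ acts on $\widehat E_{\mathrm{tight}}$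 by the partial homeomorphisms $\theta_s\colon D_{s^*s}\to D_{ss^*}$, $\theta_s(\xi)=\{e\in E : e\ge sfs^*\text{ for some } f\in\xi\}$. The tight groupoid $\mathcal{G}_{\mathrm{tight}}(S)$ is the groupoid of germs of this action. Its elements are the classes $[s,\xi]$ of pairs $(s,\xi)$ with $s\in S$, $\xi\in D_{s^*s}$, where $(s,\xi)\sim(t,\eta)$ iff $\xi=\eta$ and there is $e\in\xi$ with $se=te$. The source of $[s,\xi]$ is $\xi$ and its range is $\theta_s(\xi)$. The operations are $[s,\theta_t(\xi)][t,\xi]=[st,\xi]$ and $[s,\xi]^{-1}=[s^*,\theta_s(\xi)]$. A basis for the topology is given by the sets $\Theta(s,U)=\{[s,\xi] : \xi\in U\}$ for $s\in S$ and $U\subseteq D_{s^*s}$ open. This is an étale groupoid with unit space $\widehat E_{\mathrm{tight}}$, and $C^*_r(\mathcal{G}_{\mathrm{tight}}(S))$ denotes its reduced groupoid C*-algebra. **Generators.** For $p,q\in P$, $T_{[p,q]}\in C^*_r(\mathcal{G}_{\mathrm{tight}}(S))$ denotes the characteristic function of the compact open bisection $\Theta([p,q],D_{qP})$. One has $C_r^*(\mathcal{G}_{\mathrm{tight}}(S))=\overline{\mathrm{span}}\{T_{[p,q]} : p,q\in P\}$. **Conventions.** $*$-homomorphisms are not assumed unital. $C^*(X)$ denotes the C*-subalgebra generated by a set $X$. *)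

(* Defs.v *)
From HB Require Import structures.
From mathcomp Require Import all_boot all_order all_algebra.
From mathcomp Require Import all_classical all_reals all_analysis.
From mathcomp Require Import complex lra.
From mathcomp.analysis.showcase Require Import summability.

Set Implicit Arguments.
Unset Strict Implicit.
Unset Printing Implicit Defensive.

Import Order.TTheory GRing.Theory Num.Theory.
Import numFieldNormedType.Exports.

Local Open Scope classical_set_scope.

Section RightIdeal.
Local Open Scope group_scope.

Definition rideal (P : magmaType) (p : P) : set P := [set p * x | x in setT].

Definition munit (P : monoidType) : set P :=
  [set u | exists v, u * v = 1 /\ v * u = 1].

End RightIdeal.

HB.mixin Record isRightLCM P & Monoid P := {
  rlcm_mulgI : forall p : P, injective (fun q : P => (p * q)%g);
  rlcm_rideal : forall p q : P, rideal p `&` rideal q = set0 \/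
    exists r : P, rideal p `&` rideal q = rideal r
}.

#[short(type="rightLCMType")]
HB.structure Definition RightLCM := {P of isRightLCM P & Monoid P}.

Section Fractions.
Local Open Scope group_scope.
Local Open Scope quotient_scope.
Variable P : monoidType.

Definition frac_rel (x y : P * P) : bool :=
  `[< exists2 u, munit u & y = (x.1 * u, x.2 * u) >].

Lemma frac_rel_refl : reflexive frac_rel.
Proof.
move=> [p q]; apply/asboolP; exists 1; last by rewrite !mulg1.
by exists 1; rewrite mulg1.
Qed.

Lemma frac_rel_sym : symmetric frac_rel.
Proof.
suff H x y : frac_rel x y -> frac_rel y x by move=> x y; apply/idP/idP; exact: H.
case: x => p q /asboolP[u [v [uv vu]] ->]; apply/asboolP; exists v; first by exists u.
by rewrite /= -!mulgA uv !mulg1.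
Qed.

Lemma frac_rel_trans : transitive frac_rel.
Proof.
move=> [a b] [c d] [e f] /asboolP[u [v [uv vu]] [-> ->]].
move=> /asboolP[u' [v' [uv' vu']] [-> ->]]; apply/asboolP.
exists (u * u'); last by rewrite /= !mulgA.
exists (v' * v); split.
  by rewrite mulgA -(mulgA u) uv' mulg1.
by rewrite mulgA -(mulgA v') vu mulg1.
Qed.

Canonical frac_equiv :=
  EquivRel frac_rel frac_rel_refl frac_rel_sym frac_rel_trans.

Definition frac := {eq_quot frac_equiv}.

HB.instance Definition _ := Choice.on frac.

(* [None] is the adjoined zero. *)
Definition isg := option frac.

HB.instance Definition _ := Choice.on isg.

Definition br (p q : P) : isg := Some (\pi_frac (p, q)).

Lemma br_eq p q p' q' :
  br p q = br p' q' <-> exists2 u, munit u & p' = p * u /\ q' = q * u.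
Proof.
split=> [[/eqmodP/asboolP[u mu [-> ->]]]|[u mu [-> ->]]]; first by exists u.
by congr Some; apply/eqmodP/asboolP; exists u.
Qed.

Lemma br_repr (z : frac) : br (repr z).1 (repr z).2 = Some z.
Proof. by rewrite /br -surjective_pairing reprK. Qed.

Lemma brP (s : isg) : s = None \/ exists p q, s = br p q.
Proof.
by case: s => [z|]; [right; exists (repr z).1, (repr z).2; rewrite br_repr|left].
Qed.

Definition is_lcm (b c : P) (x : P * P) : Prop :=
  b * x.1 = c * x.2 /\ rideal b `&` rideal c = rideal (b * x.1).

(* The product [a,b][c,d], for chosen representatives of both factors and for
   chosen b', c'; imul_br states that it does not depend on the choices. *)
Definition imul (s t : isg) : isg :=
  match s, t with
  | Some x, Some y =>
    let: (a, b) := repr x in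
    let: (c, d) := repr y in
    match pselect (exists z, is_lcm b c z) with
    | left h => let: z := projT1 (cid h) in br (a * z.1) (d * z.2)
    | right _ => None
    end
  | _, _ => None
  end.

Definition istar (s : isg) : isg :=
  if s is Some x then br (repr x).2 (repr x).1 else None.

(* [p, q] acts as the partial bijection q x |-> p x. *)
Definition acts (s : isg) (x y : P) : Prop :=
  if s is Some z then exists w, x = (repr z).2 * w /\ y = (repr z).1 * w
  else False.

Lemma acts_br p q x y :
  acts (br p q) x y <-> exists w, x = q * w /\ y = p * w.
Proof.
rewrite /acts /br; set z := \pi_frac (p, q).
have /br_eq[u [v [uv vu]] [-> ->]] : br p q = br (repr z).1 (repr z).2.
  by rewrite br_repr.
split=> [[w [-> ->]]|[w [-> ->]]]; first by exists (u * w); rewrite !mulgA.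
by exists (v * w); rewrite !mulgA -(mulgA q) -(mulgA p) uv !mulg1.
Qed.

End Fractions.

Section InverseSemigroup.
Local Open Scope group_scope.
Variable P : rightLCMType.
Implicit Types (p q : P) (s t : isg P).

Lemma acts_inj s t : (forall x y, acts s x y <-> acts t x y) -> s = t.
Proof.
case: (brP s) => [->|[p [q ->]]]; case: (brP t) => [->|[p' [q' ->]]] // H.
- by have /H[] : acts (br p' q') q' p' by apply/acts_br; exists 1; rewrite !mulg1.
- by have /H[] : acts (br p q) q p by apply/acts_br; exists 1; rewrite !mulg1.
- have : acts (br p q) q p by apply/acts_br; exists 1; rewrite !mulg1.
  move=> /H/acts_br[w [qw pw]].
  have : acts (br p' q') q' p' by apply/acts_br; exists 1; rewrite !mulg1.
  move=> /H/acts_br[v [qv pv]].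
  apply/br_eq; exists v => //; exists w; split.
    apply: (@rlcm_mulgI P p); rewrite mulg1 {2}pw pv; exact: mulgA.
  apply: (@rlcm_mulgI P p'); rewrite mulg1 {2}pv pw; exact: mulgA.
Qed.

Lemma acts_mul s t x y :
  acts (imul s t) x y <-> exists2 z, acts t x z & acts s z y.
Proof.
case: s => [f|]; last by split=> [|[]] //; case: t.
case: t => [g|]; last by split=> [|[]].
rewrite /imul [acts (Some f)]/acts [acts (Some g)]/acts.
case: (repr f) => a b; case: (repr g) => c d /=.
case: pselect => [h|h].
  case: (cid h) => -[b' c'] [/= e I].
  rewrite -[X in X <-> _]/(acts (br (a * b') (d * c')) x y).
  rewrite acts_br; split=> [[w [-> ->]]|].
    exists (c * (c' * w)); first by exists (c' * w); rewrite mulgA.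
    by exists (b' * w); rewrite !mulgA -e.
  move=> [z [v [-> zc]] [w [zb ->]]].
  have : (rideal b `&` rideal c) z by split; [exists w|exists v].
  rewrite I => -[k _ kz]; exists k.
  split; rewrite -mulgA; congr (_ * _).
    by apply: (@rlcm_mulgI P c); rewrite mulgA -e kz.
  by apply: (@rlcm_mulgI P b); rewrite mulgA kz.
split=> // -[z [v [_ zc]] [w [zb _]]]; apply: h.
have zI : (rideal b `&` rideal c) z by split; [exists w|exists v].
case: (rlcm_rideal b c) => [I|[r I]]; first by rewrite I in zI.
have : rideal r r by exists 1 => //; rewrite mulg1.
rewrite -I => -[[b' _ rb] [c' _ rc]]; exists (b', c'); split; rewrite /= rb //.
Qed.

Lemma acts_star s x y : acts (istar s) x y <-> acts s y x.
Proof.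
case: s => [z|] //; rewrite /istar acts_br.
by split=> -[w [-> ->]]; exists w.
Qed.

Lemma acts_fun s x y y' : acts s x y -> acts s x y' -> y = y'.
Proof.
case: s => [z|] //= [w [-> ->]] [v [/rlcm_mulgI -> ->]] //.
Qed.

Lemma imulA : associative (@imul P).
Proof.
move=> s t r; apply: acts_inj => x y; rewrite !acts_mul; split.
  by move=> [z /acts_mul[v ? ?] ?]; exists v => //; apply/acts_mul; exists z.
by move=> [z ? /acts_mul[v ? ?]]; exists v => //; apply/acts_mul; exists z.
Qed.

HB.instance Definition _ := hasMul.Build (isg P) (@imul P).
HB.instance Definition _ := Magma_isSemigroup.Build (isg P) imulA.

Lemma imul_br a b c d b' c' : is_lcm b c (b', c') ->
  (br a b : isg P) * br c d = br (a * b') (d * c').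
Proof.
move=> [/= e I]; apply: acts_inj => x y; rewrite acts_mul acts_br; split.
  move=> [z /acts_br[v [-> zc]] /acts_br[w [zb ->]]].
  have : (rideal b `&` rideal c) z by split; [exists w|exists v].
  rewrite I => -[k _ kz]; exists k.
  split; rewrite -mulgA; congr (_ * _).
    by apply: (@rlcm_mulgI P c); rewrite mulgA -e kz.
  by apply: (@rlcm_mulgI P b); rewrite mulgA kz.
move=> [w [-> ->]]; exists (c * (c' * w)); apply/acts_br.
  by exists (c' * w); rewrite mulgA.
by exists (b' * w); rewrite !mulgA -e.
Qed.

Lemma imul_br0 a b c d : rideal b `&` rideal c = set0 ->
  (br a b : isg P) * br c d = None.
Proof.
move=> I; apply: acts_inj => x y; rewrite acts_mul; split=> //.
move=> [z /acts_br[v [-> zc]] /acts_br[w [zb ->]]].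
by suff : set0 z by []; rewrite -I; split; [exists w|exists v].
Qed.

Lemma imul0s s : (None : isg P) * s = None. Proof. by []. Qed.

Lemma imuls0 s : s * (None : isg P) = None. Proof. by case: s. Qed.

Lemma istar_br p q : istar (br p q) = br q p.
Proof.
apply: acts_inj => x y; rewrite acts_star !acts_br.
by split=> -[w [-> ->]]; exists w.
Qed.

Lemma istarM s t : istar (s * t) = (istar t : isg P) * istar s.
Proof.
apply: acts_inj => x y; rewrite acts_star !acts_mul.
split=> -[z]; first by move=> tz sz; exists z; apply/acts_star.
by move=> /acts_star ? /acts_star ?; exists z.
Qed.

Definition idem : set (isg P) := [set s | s = None \/ exists p, s = br p p].

Lemma idemP s : idem s <-> forall x y, acts s x y -> y = x.
Proof.
split=> [[->|[p ->]] x y //|H].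
  by move=> /acts_br[w [-> ->]].
case: (brP s) => [|[p [q sE]]]; first by left.
right; exists p; rewrite sE; congr br; symmetry.
by apply: H; rewrite sE; apply/acts_br; exists 1; rewrite !mulg1.
Qed.

Lemma idemM s t : idem s -> idem t -> idem (s * t).
Proof.
move=> /idemP hs /idemP ht; apply/idemP => x y /acts_mul[z] tz sz.
by rewrite (hs _ _ sz) (ht _ _ tz).
Qed.

Lemma idemC s t : idem s -> idem t -> s * t = t * s.
Proof.
move=> /idemP hs /idemP ht; apply: acts_inj => x y; rewrite !acts_mul.
split=> -[z].
  by move=> tz sz; exists x; move: tz sz; move=> /[dup] /ht -> tx /[dup] /hs -> sx.
by move=> sz tz; exists x; move: sz tz; move=> /[dup] /hs -> sx /[dup] /ht -> tx.
Qed.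

Lemma idem_star_mul s : idem (istar s * s).
Proof.
apply/idemP => x y /acts_mul[z xz /acts_star yz].
by case: s xz yz => [w|] //= [v [-> ->]] [v' [-> /rlcm_mulgI ->]].
Qed.

Lemma idem_id s : idem s -> s * s = s.
Proof.
move=> /idemP hs; apply: acts_inj => x y; rewrite acts_mul; split.
  by move=> [z /hs ->].
by move=> /[dup] /hs -> xx; exists x.
Qed.

Lemma idem_star s : idem s -> istar s = s.
Proof.
move=> /idemP hs; apply: acts_inj => x y; rewrite acts_star.
by split=> /[dup] /hs ->.
Qed.

Definition idemS := set_type idem.

HB.instance Definition _ := Choice.on idemS.

Definition mk_idem s (h : idem s) : idemS := SigSub (mem_set h).

Lemma idemSP (e : idemS) : idem (val e). Proof. exact: set_valP. Qed.

Definition emul (e f : idemS) : idemS := mk_idem (idemM (idemSP e) (idemSP f)).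

Lemma idem_br p : idem (br p p). Proof. by right; exists p. Qed.

Definition ebr p : idemS := mk_idem (idem_br p).

Definition isrc s : idemS := mk_idem (idem_star_mul s).

Lemma isrc_br p q : isrc (br p q) = ebr q.
Proof.
apply: val_inj; rewrite -[LHS]/(istar (br p q) * br p q) istar_br; apply: acts_inj => x y.
rewrite acts_mul acts_br; split=> [[z /acts_br[w [-> ->]]]|[w [-> ->]]].
  by move=> /acts_br[v [/rlcm_mulgI -> ->]]; exists v.
by exists (p * w); apply/acts_br; exists w.
Qed.

Definition ele s t := s * t = s.

Definition efilter (xi : {ptws idemS -> bool}) : Prop :=
  [/\ exists e, xi e,
      forall e, xi e -> val e <> None,
      forall e f, xi e -> xi f -> xi (emul e f) &
      forall e f, xi e -> ele (val e) (val f) -> xi f].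

Definition eultra : set {ptws idemS -> bool} :=
  [set xi | efilter xi /\ forall eta, efilter eta ->
    (forall e, xi e -> eta e) -> eta = xi].

Definition tight : set {ptws idemS -> bool} :=
  [set xi | efilter xi /\ closure eultra xi].

Definition tspec := set_type tight.

HB.instance Definition _ := Topological.on tspec.

Definition tspec_mem (xi : tspec) (e : idemS) : bool := (val xi : _ -> bool) e.

Lemma tspec_filter (xi : tspec) : efilter (val xi).
Proof. by have [] := set_valP xi. Qed.

Definition Dset (e : idemS) : set tspec := [set xi | tspec_mem xi e].

Definition theta s (xi : tspec) : {ptws idemS -> bool} := fun e =>
  `[< exists2 f, tspec_mem xi f & ele (s * val f * istar s) (val e) >].


Definition pregerm := {x : isg P * tspec | tspec_mem x.2 (isrc x.1)}.

HB.instance Definition _ := Choice.on pregerm.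

Definition germ_rel (x y : pregerm) : bool :=
  `[< (val x).2 = (val y).2 /\
      exists2 e, tspec_mem (val x).2 e &
        (val x).1 * val e = (val y).1 * val e >].

Lemma germ_rel_refl : reflexive germ_rel.
Proof.
move=> x; apply/asboolP; split=> //.
by have [[e xe] _ _ _] := tspec_filter (val x).2; exists e.
Qed.

Lemma germ_rel_sym : symmetric germ_rel.
Proof.
suff H x y : germ_rel x y -> germ_rel y x by move=> x y; apply/idP/idP; exact: H.
by move=> /asboolP[xy [e xe E]]; apply/asboolP; split=> //; exists e; rewrite -?xy.
Qed.

Lemma germ_rel_trans : transitive germ_rel.
Proof.
move=> y x z /asboolP[xy [e xe E]] /asboolP[yz [f yf F]]; apply/asboolP.
split; first by rewrite xy.
have [_ _ M _] := tspec_filter (val x).2.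
exists (emul e f); first by apply: M => //; rewrite xy in yf *.
rewrite /= mulgA E -mulgA (idemC (idemSP e) (idemSP f)).
by rewrite mulgA F mulgA.
Qed.

Canonical germ_equiv :=
  EquivRel germ_rel germ_rel_refl germ_rel_sym germ_rel_trans.

Definition germ := {eq_quot germ_equiv}%qT.

HB.instance Definition _ := Choice.on germ.

Definition mk_germ s (xi : tspec) (h : tspec_mem xi (isrc s)) : germ :=
  (\pi_germ (exist _ (s, xi) h))%qT.

Lemma mk_germ_eq s t xi eta h k :
  @mk_germ s xi h = @mk_germ t eta k <->
  xi = eta /\ exists2 e, tspec_mem xi e & s * val e = t * val e.
Proof.
by split=> [/eqmodP/asboolP|H]; last by apply/eqmodP/asboolP.
Qed.

Lemma germP (g : germ) : exists s xi h, g = @mk_germ s xi h.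
Proof.
elim/quotW: g => -[[s xi] h]; by exists s, xi, h.
Qed.

(* [is_germ g s xi]: xi is in D_{s^*s} and g = [s, xi]. *)
Definition is_germ (g : germ) s (xi : tspec) : Prop :=
  exists h, g = @mk_germ s xi h.

Definition Theta s (U : set tspec) : set germ :=
  [set g | exists2 xi, U xi & is_germ g s xi].

Lemma open_Dset e : open (Dset e).
Proof.
have -> : Dset e = [set xi : tspec | (val xi : {ptws idemS -> bool}) e = true] by [].
have cv : continuous (set_val : tspec -> {ptws idemS -> bool}).
  exact: initial_continuous.
have cp : continuous (fun xi : {ptws idemS -> bool} => xi e).
  exact: (@proj_continuous _ (fun=> bool) e).
have c : continuous (fun xi : tspec => (set_val xi : {ptws idemS -> bool}) e).
  by move=> x; exact: (continuous_comp (cv x) (cp (set_val x))).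
by move/continuousP: c => /(_ [set true]); apply; exact: discrete_open.
Qed.

Definition germ_base : set (set germ) :=
  [set A | exists s U, [/\ open U, U `<=` Dset (isrc s) & A = Theta s U]].

Lemma germ_base_cover : \bigcup_(A in germ_base) id A = setT.
Proof.
apply/seteqP; split=> // g _; have [s [xi [h ->]]] := germP g.
exists (Theta s (Dset (isrc s))); last by exists xi => //; exists h.
by exists s, (Dset (isrc s)); split=> //; exact: open_Dset.
Qed.

Lemma isrc_mul_mem s e (xi : tspec) :
  tspec_mem xi (isrc s) -> tspec_mem xi e -> tspec_mem xi (isrc (s * val e)).
Proof.
move=> xs xe; have [_ _ M _] := tspec_filter xi.
suff -> : isrc (s * val e) = emul (isrc s) e by exact: M.
apply: val_inj; rewrite /= istarM (idem_star (idemSP e)).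
rewrite mulgA -(mulgA (val e)) (idemC (idemSP e) (idem_star_mul s)).
by rewrite -mulgA (idem_id (idemSP e)).
Qed.

Lemma germ_base_join A B g : germ_base A -> germ_base B -> id A g -> id B g ->
  exists C, [/\ germ_base C, id C g & id C `<=` id A `&` id B].
Proof.
move=> [s [U [oU sU ->]]] [t [V [oV sV ->]]] [xi Uxi [h ->]] [eta Veta [k]].
move=> /mk_germ_eq[E [e xe se]]; subst eta.
have le (z : isg P) : z * val e * val e = z * val e.
  by rewrite -mulgA (idem_id (idemSP e)).
exists (Theta (s * val e) (U `&` V `&` Dset e)); split.
- exists (s * val e), (U `&` V `&` Dset e); split=> //.
    by apply: openI; [exact: openI|exact: open_Dset].
  by move=> z [[/sU zs _] ze]; exact: isrc_mul_mem.
- exists xi => //; exists (isrc_mul_mem h xe).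
  by apply/mk_germ_eq; split=> //; exists e.
- move=> _ [z [[Uz Vz] ze] [l ->]]; split; exists z => //.
    by exists (sU _ Uz); apply/mk_germ_eq; split=> //; exists e.
  by exists (sV _ Vz); apply/mk_germ_eq; split=> //; exists e; rewrite ?le.
Qed.

HB.instance Definition _ :=
  isBaseTopological.Build germ germ_base_cover germ_base_join.

(* [germ_comp k h g]: the product k h is defined and equal to g. *)
Definition germ_comp (k h g : germ) : Prop :=
  exists s t xi eta, [/\ is_germ h t xi, is_germ k s eta,
    val eta = theta t xi & is_germ g (s * t) xi].

Definition fixset s : set idemS := [set e | s * val e = val e].

Definition condH : Prop := forall s, exists F : set idemS,
  [/\ finite_set F, F `<=` fixset s &
      forall e, fixset s e -> val e <> None ->
        exists2 f, F f & val e * val f <> None].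

Definition core : set P := [set p | forall q, rideal p `&` rideal q !=set0].

End InverseSemigroup.

Local Open Scope ring_scope.

Definition cplx (R : realType) : numClosedFieldType := R[i].

Section SquareSummable.
Variables (R : realType) (X : choiceType).
Local Notation C := (cplx R).

Definition cabs (z : C) : R := complex.Re `|z|.

Lemma cabsE z : `|z| = (cabs z)%:C%C :> C.
Proof. by rewrite /cabs RRe_real // normr_real. Qed.

Lemma cabs_ge0 z : 0 <= cabs z.
Proof. by rewrite -lecR -cabsE normr_ge0. Qed.

Lemma cabsD z w : cabs (z + w) <= cabs z + cabs w.
Proof. by rewrite -lecR raddfD /= -!cabsE ler_normD. Qed.

Lemma cabsM z w : cabs (z * w) = cabs z * cabs w.
Proof. by apply: (@complexI R); rewrite rmorphM /= -!cabsE normrM. Qed.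

Definition l2sq (f : X -> C) : \bar R :=
  (\esum_(x in [set: X]) ((cabs (f x)) ^+ 2)%:E)%E.

Definition square_summable : {pred X -> C} := fun f => (l2sq f < +oo)%E.

Lemma square_summableE f : (f \in square_summable) = (l2sq f < +oo)%E.
Proof. by []. Qed.

Lemma esum_scale (k : R) (a : X -> \bar R) :
  0 <= k -> (forall x, 0 <= a x)%E ->
  (\esum_(x in [set: X]) (k%:E * a x) <= k%:E * \esum_(x in [set: X]) a x)%E.
Proof.
move=> k0 a0; apply: ge_ereal_sup => _ [F [fF sF] <-].
rewrite -ge0_mule_fsumr; last by move=> x; exact: a0.
apply: lee_wpmul2l; first by rewrite lee_fin.
by apply: ereal_sup_ubound; exists F.
Qed.

Lemma square_summable_submod : subsemimod_closed square_summable.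
Proof.
have p0 (f : X -> C) x : (0 <= ((cabs (f x)) ^+ 2)%:E)%E.
  by rewrite lee_fin sqr_ge0.
split; first split.
- rewrite square_summableE /l2sq esum1 // => x _.
  by rewrite /cabs normr0 expr0n.
- move=> f g; rewrite !square_summableE /l2sq => hf hg.
  apply: (@le_lt_trans _ _ (\esum_(x in [set: X])
     (2%:E * ((cabs (f x)) ^+ 2)%:E + 2%:E * ((cabs (g x)) ^+ 2)%:E))%E).
    apply: le_esum => x _; rewrite -!EFinM -EFinD lee_fin.
    have := cabsD (f x) (g x); have := cabs_ge0 (f x + g x).
    rewrite /= => h0 h1; rewrite -[(f + g) x]/(f x + g x).
    apply: (@le_trans _ _ ((cabs (f x) + cabs (g x)) ^+ 2)).
      by rewrite lerXn2r // nnegrE ?addr_ge0 ?cabs_ge0.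
    have := sqr_ge0 (cabs (f x) - cabs (g x)).
    by rewrite sqrrB sqrrD => ?; lra.
  rewrite esumD; [|by move=> x _; rewrite mule_ge0|by move=> x _; rewrite mule_ge0].
  by rewrite lte_add_pinfty //; apply: (le_lt_trans (esum_scale _ _)) => //;
    rewrite lte_mul_pinfty.
- move=> c f; rewrite !square_summableE /l2sq => hf.
  rewrite (eq_esum (b := fun x => ((cabs c ^+ 2)%:E * ((cabs (f x)) ^+ 2)%:E)%E)).
    apply: (le_lt_trans (esum_scale _ _)); rewrite ?sqr_ge0 //.
    by rewrite lte_mul_pinfty ?lee_fin ?sqr_ge0.
  by move=> x _; rewrite -EFinM -exprMn -cabsM.
Qed.

HB.instance Definition _ :=
  GRing.isSubmodClosed.Build C (X -> C) square_summable square_summable_submod.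

Record ell2 := Ell2 { ell2_fun :> X -> C; _ : ell2_fun \in square_summable }.

HB.instance Definition _ := [isSub for ell2_fun].
HB.instance Definition _ := [Choice of ell2 by <:].
HB.instance Definition _ := [SubChoice_isSubLmodule of ell2 by <:].

Definition l2norm (f : ell2) : R := Num.sqrt (fine (l2sq f)).

(* summability.sum is the limit of the sums over finite subsets, ordered by inclusion. *)
Definition inner (f g : ell2) : C := summability.sum (fun x => f x * (g x)^*).

Definition bounded_op : set (ell2 -> ell2) :=
  [set T | linear T /\ exists M : R, forall f, l2norm (T f) <= M * l2norm f].

Definition adjoint_op (S T : ell2 -> ell2) : Prop :=
  forall f g, inner (S f) g = inner f (T g).

Definition op_closure (A : set (ell2 -> ell2)) : set (ell2 -> ell2) :=
  [set T | bounded_op T /\ forall eps : R, 0 < eps ->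
    exists2 T', A T' & forall f, l2norm (T f - T' f) <= eps * l2norm f].

(* The identity operator is not required to belong to A. *)
Definition cstar_subalgebra (A : set (ell2 -> ell2)) : Prop :=
  [/\ A `<=` bounded_op,
      A (fun=> 0),
      forall (c : C) S T, A S -> A T -> A (fun f => c *: S f + T f),
      forall S T, A S -> A T -> A (S \o T) &
      (forall S T, A S -> bounded_op T -> adjoint_op S T -> A T) /\
      op_closure A `<=` A].

Definition cstar_generated (Y : set (ell2 -> ell2)) : set (ell2 -> ell2) :=
  smallest cstar_subalgebra Y.

End SquareSummable.

Record cstarAlgebra (R : realType) := CStarAlgebra {
  cstar_sort :> completeNormedModType (cplx R);
  cmul : cstar_sort -> cstar_sort -> cstar_sort;
  cadj : cstar_sort -> cstar_sort;
  cmulA : associative cmul;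
  cmul_linearl : forall (a : cplx R) x y z,
    cmul (a *: x + y) z = a *: cmul x z + cmul y z;
  cmul_linearr : forall (a : cplx R) x y z,
    cmul z (a *: x + y) = a *: cmul z x + cmul z y;
  cadjK : involutive cadj;
  cadjM : forall x y, cadj (cmul x y) = cmul (cadj y) (cadj x);
  cadj_antilinear : forall (a : cplx R) x y,
    cadj (a *: x + y) = a^* *: cadj x + cadj y;
  cnormM : forall x y, `|cmul x y| <= `|x| * `|y|;
  cnorm_cstar : forall x, `|cmul (cadj x) x| = `|x| ^+ 2
}.

(* *-homomorphisms from the concrete C*-algebra [A] to [B]; the values of [pi]
   outside [A] are irrelevant. *)
Definition star_hom (R : realType) (X : choiceType)
    (A : set (ell2 R X -> ell2 R X)) (B : cstarAlgebra R)
    (pi : (ell2 R X -> ell2 R X) -> B) : Prop :=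
  [/\ forall (c : cplx R) S T, A S -> A T ->
        pi (fun f => c *: S f + T f) = c *: pi S + pi T,
      forall S T, A S -> A T -> pi (S \o T) = cmul (pi S) (pi T) &
      forall S T, A S -> A T -> adjoint_op S T -> pi T = cadj (pi S)].

Section Reduced.
Variables (R : realType) (G : topologicalType) (comp : G -> G -> G -> Prop).
Local Notation C := (cplx R).

(* This is the right space of functions only for Hausdorff groupoids; the tight
   groupoid is Hausdorff when condition (H) holds. *)
Definition Cc : set (G -> C) :=
  [set f | continuous f /\ compact (closure [set g | f g != 0])].

(* (f * xi)(g) is the sum of f(k) xi(h) over all k, h with k h = g. Only finitely
   many terms are nonzero when f is in C_c(G) and G is etale. *)
Definition convolution (f xi : G -> C) : G -> C := fun g =>
  \sum_(x \in [set x : G * G | comp x.1 x.2 g]) (f x.1 * xi x.2).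

(* The direct sum over all units x of the regular representations on l^2(G_x).
   The default value of insubd is never used for f in C_c(G). *)
Definition lambda (f : G -> C) : ell2 R G -> ell2 R G :=
  fun xi => insubd 0 (convolution f xi).

Definition reduced_cstar : set (ell2 R G -> ell2 R G) :=
  op_closure (lambda @` Cc).

End Reduced.

Section BoundaryQuotient.
Variables (R : realType) (P : rightLCMType).
Local Notation op := (ell2 R (germ P) -> ell2 R (germ P)).

Definition Qr : set op := @reduced_cstar R (germ P) (@germ_comp P).

Definition Tgen (p q : P) : op :=
  lambda (@germ_comp P)
    (fun g => (g \in Theta (br p q) (Dset (ebr q)))%:R).

Definition Qrc : set op :=
  cstar_generated [set T | exists p q, [/\ core p, core q & T = Tgen p q]].

End BoundaryQuotient.

(* Main.v *)
Require Import Defs.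
From HB Require Import structures.
From mathcomp Require Import all_boot all_order all_algebra.
From mathcomp Require Import all_classical all_reals all_analysis.
From mathcomp Require Import complex lra ring finmap.
From mathcomp.analysis.showcase Require Import summability.

(* Write T_s for the operator of an element s of S; under (H) the T_s span a dense subalgebra
   of Q_r(P).  Suppose pi is injective on the core algebra and kills a <> 0, let g be a germ
   with eta = |a delta_g|^2 > 0, and let f be a combination of finitely many T_s with
   |a^* a - f| <= eta / 3.
   For small w every compression [1,w] s [w,1] of an s occurring in f is 0 or has both entries in
   the core: either some multiple w' of w satisfies [w',w'] s [w',w'] = 0, or all these products
   are nonzero, which is the defining property of the core.  Condition (H) makes the germs fixed
   by s clopen, so w can also be chosen so that the diagonal coefficient of
   c = T_[1,w] f T_[w,1] at some germ equals that of f at g, hence |c| >= 2 eta / 3.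
   But c is in the core algebra, where the injective *-homomorphism pi is isometric, and pi kills
   T_[1,w] a^* a T_[w,1], so |c| = |pi c| <= eta / 3.

   The two facts on *-homomorphisms are obtained without spectral theory: 1 - v has a square root
   for |v| <= 1 by iterating w := (v + w^2) / 2, so a selfadjoint contraction y is the real part of
   the unitary y + i sqrt(1 - y^2), which gives contractivity. *)

Set Implicit Arguments.
Unset Strict Implicit.
Unset Printing Implicit Defensive.

Import Order.TTheory GRing.Theory Num.Theory.
Import numFieldNormedType.Exports.

Local Open Scope classical_set_scope.
Local Open Scope ring_scope.

(** * Square roots and *-homomorphisms of C*-algebras *)

(** The diagonal coefficient at a germ stands in for a conditional expectation: for [T_s] it is 1 if
    left translation by [s] fixes the germ and 0 otherwise, so comparing coefficients at two germs
    only asks which of finitely many [s] fix them. Neither [B] nor [pi] is assumed unital, so each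
    unital argument takes place in a subalgebra with a unit of its own; the image of 1 under [pi] is
    merely a projection, and its corner serves as the target. Elements of [Qr] are bare functions
    that carry boundedness but no adjoint. They are realised as adjointable operators, a class
    closed under norm limits, before any C*-theory applies to them. The reduced norm is controlled
    by the supremum norm only up to the number of bisections that cover the support. Density of the
    span therefore needs uniform approximations whose supports stay in one finite family of
    bisections. The tolerance eta / 3 is paid twice, once for the coefficient and once for the norm;
    anything below eta / 2 would serve. *)

Section Cabs.
Variable R : realType.
Local Notation C := (cplx R).

Lemma cabsr (r : R) : cabs (r%:C%C : C) = `|r|.
Proof. by apply: (@complexI R); rewrite -cabsE normc_def /= expr0n addr0 sqrtr_sqr. Qed.

Lemma cabs_nat n : cabs (n%:R : C) = n%:R.
Proof.
by apply: (@complexI R); rewrite -cabsE normr_nat rmorph_nat.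
Qed.

Lemma cabsV (z : C) : cabs z^-1 = (cabs z)^-1.
Proof. by apply: (@complexI R); rewrite -cabsE normfV cabsE fmorphV. Qed.

Lemma cabsN (z : C) : cabs (- z) = cabs z.
Proof. by apply: (@complexI R); rewrite -!cabsE normrN. Qed.

Lemma cabsi : cabs ('i : C) = 1.
Proof. by apply: (@complexI R); rewrite -cabsE normCi. Qed.

Lemma cabs0 : cabs (0 : C) = 0.
Proof. by apply: (@complexI R); rewrite -cabsE normr0. Qed.

Lemma cabs1 : cabs (1 : C) = 1.
Proof. by apply: (@complexI R); rewrite -cabsE normr1. Qed.

Lemma cabs0_eq0 (z : C) : cabs z = 0 -> z = 0.
Proof. by move=> z0; apply/eqP; rewrite -normr_eq0 cabsE z0. Qed.

End Cabs.

(** One interface for the operators on l^2 and for the target algebra, since square roots are needed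
    on both sides of a homomorphism. Completeness comes with a prescribed rate [w] that the limit
    inherits, so estimates pass to limits without loss. *)
Record cstarSpace (R : realType) := CStarSpace {
  csort :> lmodType (cplx R);
  nrm : csort -> R;
  mul : csort -> csort -> csort;
  adj : csort -> csort;
  nrm0_eq0 : forall x, nrm x = 0 -> x = 0;
  nrmD : forall x y, nrm (x + y) <= nrm x + nrm y;
  nrmZ : forall a x, nrm (a *: x) = cabs a * nrm x;
  mulA : associative mul;
  mulPl : forall a x y z, mul (a *: x + y) z = a *: mul x z + mul y z;
  mulPr : forall a x y z, mul z (a *: x + y) = a *: mul z x + mul z y;
  adjK : involutive adj;
  adjM : forall x y, adj (mul x y) = mul (adj y) (adj x);
  adjP : forall a x y, adj (a *: x + y) = a^* *: adj x + adj y;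
  nrmM : forall x y, nrm (mul x y) <= nrm x * nrm y;
  nrm_cstar : forall x, nrm (mul (adj x) x) = nrm x ^+ 2;
  nrm_complete : forall (u : nat -> csort) (w : nat -> R),
    (forall e, 0 < e -> exists n, w n <= e) ->
    (forall n m, (n <= m)%N -> nrm (u m - u n) <= w n) ->
    exists l, forall n, nrm (u n - l) <= w n
}.

Section CStarTheory.
Variables (R : realType) (V : cstarSpace R).
Local Notation C := (cplx R).
Implicit Types (x y z : V) (a : C) (A : set V).
Local Notation "x ** y" := (mul x y) (at level 40, left associativity).

Lemma nrm0 : nrm (0 : V) = 0.
Proof. by rewrite -(scale0r (0 : V)) nrmZ cabs0 mul0r. Qed.

Lemma nrmN x : nrm (- x) = nrm x.
Proof. by rewrite -scaleN1r nrmZ cabsN cabs1 mul1r. Qed.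

Lemma nrm_ge0 x : 0 <= nrm x.
Proof.
by have := nrmD x (- x); rewrite subrr nrm0 nrmN => ?; lra.
Qed.

Lemma nrmB x y : nrm (x - y) <= nrm x + nrm y.
Proof. by rewrite -(nrmN y) nrmD. Qed.

Lemma nrmBC x y : nrm (x - y) = nrm (y - x).
Proof. by rewrite -nrmN opprB. Qed.

Lemma nrm_half x : nrm ((2^-1 : C) *: x) = 2^-1 * nrm x.
Proof. by rewrite nrmZ cabsV cabs_nat. Qed.

Lemma eq_of_nrm x y : (forall e, 0 < e -> nrm (x - y) <= e) -> x = y.
Proof.
move=> h; apply/eqP; rewrite -subr_eq0; apply/eqP/nrm0_eq0/eqP.
rewrite eq_le nrm_ge0 andbT; apply/ler_addgt0Pl => e e0.
by rewrite addr0 h.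
Qed.

Lemma mul0x x : 0 ** x = 0.
Proof.
have := mulPl (-1) 0 0 x; rewrite scaler0 addr0 => ->.
by rewrite scaleN1r addNr.
Qed.

Lemma mulx0 x : x ** 0 = 0.
Proof.
have := mulPr (-1) 0 0 x; rewrite scaler0 addr0 => ->.
by rewrite scaleN1r addNr.
Qed.

Lemma mulDx x y z : (x + y) ** z = x ** z + y ** z.
Proof. by have := mulPl 1 x y z; rewrite !scale1r. Qed.

Lemma mulxD x y z : z ** (x + y) = z ** x + z ** y.
Proof. by have := mulPr 1 x y z; rewrite !scale1r. Qed.

Lemma mulZx a x z : (a *: x) ** z = a *: (x ** z).
Proof. by have := mulPl a x 0 z; rewrite mul0x !addr0. Qed.

Lemma mulxZ a x z : z ** (a *: x) = a *: (z ** x).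
Proof. by have := mulPr a x 0 z; rewrite mulx0 !addr0. Qed.

Lemma mulNx x z : (- x) ** z = - (x ** z).
Proof. by rewrite -scaleN1r mulZx scaleN1r. Qed.

Lemma mulxN x z : z ** (- x) = - (z ** x).
Proof. by rewrite -scaleN1r mulxZ scaleN1r. Qed.

Lemma mulBx x y z : (x - y) ** z = x ** z - y ** z.
Proof. by rewrite mulDx mulNx. Qed.

Lemma mulxB x y z : z ** (x - y) = z ** x - z ** y.
Proof. by rewrite mulxD mulxN. Qed.

Lemma adj0 : adj (0 : V) = 0.
Proof.
have := adjP (-1) 0 (0 : V); rewrite scaler0 addr0 => ->.
by rewrite rmorphN rmorph1 scaleN1r addNr.
Qed.

Lemma adjD x y : adj (x + y) = adj x + adj y.
Proof. by have := adjP 1 x y; rewrite rmorph1 !scale1r. Qed.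

Lemma adjZ a x : adj (a *: x) = a^* *: adj x.
Proof. by have := adjP a x 0; rewrite adj0 !addr0. Qed.

Lemma adjN x : adj (- x) = - adj x.
Proof. by rewrite -scaleN1r adjZ rmorphN rmorph1 scaleN1r. Qed.

Lemma adjB x y : adj (x - y) = adj x - adj y.
Proof. by rewrite adjD adjN. Qed.

Lemma nrm_adj x : nrm (adj x) = nrm x.
Proof.
suff H y : nrm y <= nrm (adj y).
  by apply/eqP; rewrite eq_le H andbT -{2}[x]adjK H.
have := nrm_ge0 y; rewrite le_eqVlt => /predU1P[<-|y0]; first exact: nrm_ge0.
by rewrite -(ler_pM2r y0) -expr2 -nrm_cstar nrmM.
Qed.

Lemma proj_nrm x : adj x ** x = x -> nrm x <= 1.
Proof.
move=> h; have := nrm_cstar x; rewrite h => E.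
have := nrm_ge0 x; rewrite le_eqVlt => /predU1P[<-|x0]; first exact: ler01.
by rewrite -(ler_pM2l x0) -expr2 -E mulr1.
Qed.

Lemma cstar_eq0 x : adj x ** x = 0 -> x = 0.
Proof.
move=> h; apply: nrm0_eq0; apply/eqP.
by rewrite -sqrf_eq0 -nrm_cstar h nrm0.
Qed.

Record subcstar A : Prop := SubCStar {
  subcstar0 : A 0;
  subcstarP : forall a x y, A x -> A y -> A (a *: x + y);
  subcstarM : forall x y, A x -> A y -> A (x ** y);
  subcstar_adj : forall x, A x -> A (adj x);
  subcstar_closed : forall x, (forall e, 0 < e -> exists2 y, A y & nrm (x - y) <= e) ->
    A x
}.

Section Sub.
Variables (A : set V) (hA : subcstar A).

Lemma subcstarZ a x : A x -> A (a *: x).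
Proof. by move=> Ax; rewrite -[_ *: _]addr0; apply: subcstarP => //; exact: subcstar0. Qed.

Lemma subcstarD x y : A x -> A y -> A (x + y).
Proof. by move=> Ax Ay; rewrite -[x]scale1r; apply: subcstarP. Qed.

Lemma subcstarN x : A x -> A (- x).
Proof. by move=> Ax; rewrite -scaleN1r; apply: subcstarZ. Qed.

Lemma subcstarB x y : A x -> A y -> A (x - y).
Proof. by move=> Ax Ay; apply: subcstarD => //; apply: subcstarN. Qed.

End Sub.

Lemma closure_subcstar (L : set V) :
  L 0 -> (forall a x y, L x -> L y -> L (a *: x + y)) ->
  (forall x y, L x -> L y -> L (x ** y)) -> (forall x, L x -> L (adj x)) ->
  subcstar [set x | forall e, 0 < e -> exists2 y, L y & nrm (x - y) <= e].
Proof.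
move=> L0 LP LM LA; split.
- by move=> e e0; exists 0 => //; rewrite subr0 nrm0 ltW.
- move=> a x y hx hy e e0; have ha : 0 < cabs a + 1 by have := cabs_ge0 a; lra.
  have [x' Lx' xx'] := hx _ (divr_gt0 e0 ha).
  have [y' Ly' yy'] := hy _ (divr_gt0 e0 ha).
  exists (a *: x' + y'); first exact: LP.
  have -> : a *: x + y - (a *: x' + y') = a *: (x - x') + (y - y').
    by rewrite opprD addrACA scalerBr.
  apply: le_trans (nrmD _ _) _; rewrite nrmZ.
  move: xx' yy'; rewrite !ler_pdivlMr // => xx' yy'; have := cabs_ge0 a.
  have := nrm_ge0 (x - x'); have := nrm_ge0 (y - y'); nra.
- move=> x y hx hy e e0.
  (* The summand [e] makes the tolerance [e / (nrm x + nrm y + 1 + e)] at most 1, which bounds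
     [nrm y'] by [nrm y + 1]. *)
  have hk : 0 < nrm x + nrm y + 1 + e by have := nrm_ge0 x; have := nrm_ge0 y; lra.
  have [x' Lx' xx'] := hx _ (divr_gt0 e0 hk).
  have [y' Ly' yy'] := hy _ (divr_gt0 e0 hk).
  exists (x' ** y'); first exact: LM.
  have -> : x ** y - x' ** y' = x ** (y - y') + (x - x') ** y'.
    by rewrite mulxB mulBx addrA subrK.
  apply: le_trans (nrmD _ _) _.
  have h1 : nrm (x ** (y - y')) <= nrm x * (e / (nrm x + nrm y + 1 + e)).
    by apply: le_trans (nrmM _ _) _; rewrite ler_wpM2l ?nrm_ge0.
  have k1 : e / (nrm x + nrm y + 1 + e) <= 1.
    by rewrite ler_pdivrMr // mul1r; have := nrm_ge0 x; have := nrm_ge0 y; lra.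
  have h2 : nrm y' <= nrm y + 1.
    have := nrmD (y' - y) y; rewrite subrK (nrmBC y') => /le_trans; apply.
    by rewrite addrC lerD2l; exact: le_trans yy' k1.
  have h3 : nrm ((x - x') ** y') <= e / (nrm x + nrm y + 1 + e) * (nrm y + 1).
    by apply: le_trans (nrmM _ _) _; apply: ler_pM; rewrite ?nrm_ge0.
  apply: le_trans (lerD h1 h3) _; rewrite [nrm x * _]mulrC -mulrDr.
  by rewrite mulrAC ler_pdivrMr // ler_wpM2l ?ltW //; lra.
- move=> x hx e /hx[y Ly xy]; exists (adj y); first exact: LA.
  by rewrite -adjB nrm_adj.
- move=> x h e e0; have [|y hy xy] := h (e / 2); first lra.
  have [|z Lz yz] := hy (e / 2); first lra.
  exists z => //; have := nrmD (x - y) (y - z); rewrite addrA subrK; lra.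
Qed.

Definition comm x y := x ** y = y ** x.

Definition selfadj x := adj x = x.

Lemma comm_sym x y : comm x y -> comm y x.
Proof. by []. Qed.

Lemma commM x y z : comm x y -> comm x z -> comm x (y ** z).
Proof. by move=> xy xz; rewrite /comm mulA xy -mulA xz mulA. Qed.

Lemma commB x y z : comm x y -> comm x z -> comm x (y - z).
Proof. by move=> xy xz; rewrite /comm mulxB mulBx xy xz. Qed.

(* A fixed point of w := (v + w^2) / 2 satisfies (1 - w)^2 = 1 - v.  The scalar iteration for v = 1
   majorises the increments, so it converges also when |v| = 1. *)
Fixpoint sq_iter (v : V) n : V :=
  if n is m.+1 then (2^-1 : C) *: (v + sq_iter v m ** sq_iter v m) else 0.

Fixpoint sq_major n : R :=
  if n is m.+1 then 2^-1 * (1 + sq_major m ^+ 2) else 0.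

Lemma sq_major_bound n : 0 <= sq_major n <= 1.
Proof.
elim: n => [|n IH] /=; first by rewrite lexx ler01.
have : sq_major n ^+ 2 <= 1 by rewrite expr_le1 //; case/andP: IH.
have := sqr_ge0 (sq_major n); lra.
Qed.

Lemma sq_major_step n : sq_major n <= sq_major n.+1.
Proof.
have := sqr_ge0 (1 - sq_major n); rewrite /= sqrrB expr1n mul1r mulr2n; lra.
Qed.

Lemma sq_majorB n :
  2^-1 * ((sq_major n.+1 - sq_major n) * (sq_major n.+1 + sq_major n)) =
  sq_major n.+2 - sq_major n.+1.
Proof.
have S m : sq_major m.+1 = 2^-1 * (1 + sq_major m ^+ 2) by [].
by rewrite (S n.+1) [X in _ = _ - X]S; ring.
Qed.

Lemma sq_major_sup :
  exists2 l : R, (forall n, sq_major n <= l) &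
    forall e, 0 < e -> exists n, l - sq_major n <= e.
Proof.
pose S := range sq_major.
have hS : has_sup S.
  split; first by exists (sq_major 0), 0%N.
  by exists 1 => _ [n _ <-]; case/andP: (sq_major_bound n).
exists (sup S) => [n|e e0]; first by apply: ub_le_sup; [case: hS|exists n].
have [_ [n _ <-] h] := sup_adherent e0 hS.
by exists n; lra.
Qed.

Section SqIter.
Variable v : V.
Hypothesis v1 : nrm v <= 1.
Local Notation w := (sq_iter v).

Lemma sq_iter_comm z n : comm z v -> comm z (w n).
Proof.
move=> zv; elim: n => [|n IH] /=; rewrite /comm ?mul0x ?mulx0 //.
rewrite mulxZ mulZx mulxD mulDx zv; congr (_ *: (_ + _)).
by rewrite mulA IH -mulA IH mulA.
Qed.

Lemma sq_iter_commn m n : comm (w m) (w n).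
Proof. by apply: sq_iter_comm; rewrite /comm [RHS]sq_iter_comm. Qed.

Lemma sq_iter_nrm n : nrm (w n) <= sq_major n.
Proof.
elim: n => [|n IH] /=; first by rewrite nrm0.
rewrite nrm_half ler_pM2l ?invr_gt0 ?ltr0n //.
apply: le_trans (nrmD _ _) _; apply: lerD => //.
apply: le_trans (nrmM _ _) _; rewrite expr2.
by apply: ler_pM => //; apply: nrm_ge0.
Qed.

(** The iterates commute, so an increment is half the product of the previous increment with the sum
    of the two iterates. The scalar iteration satisfies the same identity, [sq_majorB]. *)
Lemma sq_iter_step n : nrm (w n.+1 - w n) <= sq_major n.+1 - sq_major n.
Proof.
elim: n => [|n IH].
  by rewrite /= !subr0 mulx0 addr0 nrm_half expr0n /= addr0 ler_pM2l ?invr_gt0 ?ltr0n.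
rewrite -sq_majorB.
have -> : w n.+2 - w n.+1 = (2^-1 : C) *: ((w n.+1 - w n) ** (w n.+1 + w n)).
  have E m : w m.+1 = (2^-1 : C) *: (v + w m ** w m) by [].
  rewrite mulBx !mulxD (sq_iter_commn n n.+1) opprD addrA addrK.
  by rewrite (E n.+1) [X in _ - X = _]E -scalerBr opprD addrACA subrr add0r.
rewrite nrm_half ler_pM2l ?invr_gt0 ?ltr0n //.
apply: le_trans (nrmM _ _) _; apply: ler_pM => //; try exact: nrm_ge0.
by apply: le_trans (nrmD _ _) _; apply: lerD; apply: sq_iter_nrm.
Qed.

Lemma sq_iter_cauchy n m : (n <= m)%N -> nrm (w m - w n) <= sq_major m - sq_major n.
Proof.
move=> /subnK <-; elim: (m - n)%N => [|k IH]; first by rewrite add0n !subrr nrm0.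
rewrite addSn; have := sq_iter_step (k + n).
have := nrmD (w (k + n).+1 - w (k + n)) (w (k + n) - w n).
by rewrite addrA subrK => h1 h2; lra.
Qed.

End SqIter.

(** The last clause takes the place of functional calculus: the iterates are polynomials in [v], so
    their limit commutes with everything that commutes with [v]. *)
Lemma sq_fix A v : subcstar A -> A v -> nrm v <= 1 -> selfadj v ->
  exists w, [/\ A w, nrm w <= 1, selfadj w, v + w ** w = w + w &
    forall z, comm z v -> comm z w].
Proof.
move=> hA Av v1 sv.
have [l lub lsup] := sq_major_sup.
have [w hw] : exists w, forall n, nrm (sq_iter v n - w) <= l - sq_major n.
  apply: nrm_complete => // n m nm; apply: le_trans (sq_iter_cauchy v1 nm) _.
  by rewrite lerD2r.
have apx e : 0 < e ->
    exists n, nrm (sq_iter v n - w) <= e /\ nrm (sq_iter v n.+1 - w) <= e.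
  move=> /lsup[n h]; exists n; have := hw n; have := hw n.+1.
  by have := sq_major_step n; split; lra.
have Aw n : A (sq_iter v n).
  elim: n => [|n IH] /=; first exact: subcstar0 hA.
  by apply: subcstarZ => //; apply: subcstarD => //; apply: subcstarM.
have sw n : adj (sq_iter v n) = sq_iter v n.
  elim: n => [|n IH] /=; rewrite ?adj0 //.
  by rewrite adjZ adjD adjM IH sv fmorphV rmorph_nat.
have nw n : nrm (sq_iter v n) <= 1.
  by apply: le_trans (sq_iter_nrm v1 n) _; case/andP: (sq_major_bound n).
have w1 : nrm w <= 1.
  apply/ler_addgt0Pl => e /apx[n [h _]].
  have := nrmB (sq_iter v n) (sq_iter v n - w); rewrite opprB addrC subrK.
  by have := nw n; lra.
exists w; split=> //.
- apply: subcstar_closed hA _ _ => e /apx[n [h _]]; exists (sq_iter v n) => //.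
  by rewrite nrmBC.
- apply: eq_of_nrm => e e0; have [|n [h _]] := apx (e / 2); first lra.
  have := nrmD (adj w - sq_iter v n) (sq_iter v n - w).
  have -> : nrm (adj w - sq_iter v n) = nrm (sq_iter v n - w).
    by rewrite -{1}(sw n) -adjB nrm_adj nrmBC.
  by rewrite addrA subrK; lra.
(* The defect splits into two products with the error at [n] and twice the error at [n.+1]: four
   parts of size [e / 4], and the reason why [apx] controls two consecutive indices. *)
- apply: eq_of_nrm => e e0; have [|n [h h']] := apx (e / 4); first lra.
  have -> : v + w ** w - (w + w) =
      (w ** (w - sq_iter v n) + (w - sq_iter v n) ** sq_iter v n)
      + (2%:R : C) *: (sq_iter v n.+1 - w).
    rewrite mulxB mulBx addrA subrK scalerBr [sq_iter v n.+1]/= scalerA.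
    rewrite mulfV ?pnatr_eq0 // scale1r scaler_nat mulr2n.
    rewrite [RHS]addrA; congr (_ - _).
    by rewrite [v + sq_iter v n ** _]addrC [RHS]addrA subrK addrC.
  apply: le_trans (nrmD _ _) _; rewrite nrmZ cabs_nat.
  have := nrmD (w ** (w - sq_iter v n)) ((w - sq_iter v n) ** sq_iter v n).
  have := nrmM w (w - sq_iter v n); have := nrmM (w - sq_iter v n) (sq_iter v n).
  rewrite (nrmBC w); set d := nrm (_ - w) in h *; set d' := nrm (_ - w) in h' *.
  have d0 : 0 <= d by exact: nrm_ge0.
  have : d * nrm (sq_iter v n) <= d by rewrite ler_piMr.
  have : nrm w * d <= d by rewrite ler_piMl.
  lra.
- move=> z zv; apply: eq_of_nrm => e e0.
  have z1 : 0 < 2 * (nrm z + 1) by have := nrm_ge0 z; lra.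
  have [|n [h _]] := apx (e / (2 * (nrm z + 1))); first by rewrite divr_gt0.
  have -> : z ** w - w ** z = (sq_iter v n - w) ** z - z ** (sq_iter v n - w).
    by rewrite mulBx mulxB (sq_iter_comm n zv) opprB [RHS]addrC addrA subrK.
  apply: le_trans (nrmB _ _) _.
  have := nrmM (sq_iter v n - w) z; have := nrmM z (sq_iter v n - w).
  move: h; rewrite ler_pdivlMr //; set d := nrm (_ - w) => h.
  have d0 : 0 <= d by exact: nrm_ge0.
  by have := nrm_ge0 z; nra.
Qed.

Section Unital.
Variables (A : set V) (e : V).
Hypothesis hA : subcstar A.
Hypothesis Ae : A e.
Hypothesis mulex : forall x, A x -> e ** x = x.
Hypothesis mulxe : forall x, A x -> x ** e = x.

Lemma unit_selfadj : adj e = e.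
Proof.
have h := mulex (subcstar_adj hA Ae).
by rewrite -[RHS]adjK -[in RHS]h adjM adjK h. Qed.

Lemma unit_nrm : nrm e <= 1.
Proof. by apply: proj_nrm; rewrite unit_selfadj mulex. Qed.

(** For the fixed point [w] belonging to [v = e - x] one has (e - w)^2 = e - 2 w + w^2 = x. The unit
    is one of [A] and not of [V], because the lemma is also applied in a corner of the target. *)
Lemma sqrt_near_unit x : A x -> selfadj x -> nrm (e - x) <= 1 ->
  exists q, [/\ A q, selfadj q, nrm (e - q) <= 1, q ** q = x &
    forall z, A z -> comm z x -> comm z q].
Proof.
move=> Ax sx h.
have Aex : A (e - x) by exact: subcstarB.
have sex : selfadj (e - x) by rewrite /selfadj adjB sx unit_selfadj.
have [w [Aw w1 sw E cw]] := sq_fix hA Aex h sex.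
exists (e - w); split=> //.
- exact: subcstarB.
- by rewrite /selfadj adjB sw unit_selfadj.
- by rewrite opprB addrC subrK.
- rewrite mulBx !mulxB mulex // mulex // mulxe //.
  by rewrite opprB addrA addrAC -[e - w - w]addrA -opprD -E opprD addrA subrK subKr.
- move=> z Az zx; rewrite /comm mulBx mulxB mulxe // mulex //; congr (_ - _).
  by apply: cw; rewrite /comm mulBx mulxB mulxe // mulex // zx.
Qed.

End Unital.

Local Notation I := ('i : C).

Lemma conjI_scale x : I^* *: x = - (I *: x).
Proof. by rewrite conjCi scaleNr. Qed.

Lemma scaleII x : I *: (I *: x) = - x.
Proof. by rewrite scalerA -expr2 sqrCi scaleN1r. Qed.

Lemma cart_star_mul x y : selfadj x -> selfadj y -> comm x y ->
  adj (x + I *: y) ** (x + I *: y) = x ** x + y ** y.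
Proof.
move=> sx sy xy; rewrite adjD adjZ sx sy conjI_scale mulBx !mulxD.
rewrite !mulxZ !mulZx -xy scaleII opprD opprK addrA.
by rewrite addrK.
Qed.

Lemma cart_re x y : selfadj x -> selfadj y ->
  x = (2^-1 : C) *: ((x + I *: y) + adj (x + I *: y)).
Proof.
move=> sx sy; rewrite adjD adjZ sx sy conjI_scale addrACA subrr addr0.
by rewrite -mulr2n -(scaler_nat 2 x) scalerA mulVf ?scale1r // pnatr_eq0.
Qed.

(** [x] is the real part of [x + i y], and the C*-identity computes the norm of the latter from x^2
    + y^2. This replaces the order on positive elements: a sum of two commuting squares dominates
    each of them in norm. *)
Lemma cart_nrm_le x y r : selfadj x -> selfadj y -> comm x y -> 0 <= r ->
  nrm (x ** x + y ** y) <= r ^+ 2 -> nrm x <= r.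
Proof.
move=> sx sy xy r0; rewrite -cart_star_mul // nrm_cstar ler_sqr ?nnegrE ?nrm_ge0 //.
move=> h; rewrite (cart_re sx sy) nrm_half.
have := nrmD (x + I *: y) (adj (x + I *: y)); rewrite nrm_adj; lra.
Qed.

Lemma cart_sq0 x y : selfadj x -> selfadj y -> comm x y ->
  x ** x + y ** y = 0 -> x = 0 /\ y = 0.
Proof.
move=> sx sy xy h.
have x0 : x = 0.
  apply: nrm0_eq0; apply/eqP; rewrite eq_le nrm_ge0 andbT.
  by apply: cart_nrm_le xy _ _ => //; rewrite h nrm0 expr0n.
split=> //; apply: cstar_eq0; rewrite sy.
by rewrite x0 mul0x add0r in h.
Qed.

Section UnitalNorm.
Variables (A : set V) (e : V).
Hypothesis hA : subcstar A.
Hypothesis Ae : A e.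
Hypothesis mulex : forall x, A x -> e ** x = x.
Hypothesis mulxe : forall x, A x -> x ** e = x.

Lemma unitary_part y : A y -> selfadj y -> nrm y <= 1 ->
  exists2 q, A q & [/\ selfadj q, comm y q & y ** y + q ** q = e].
Proof.
move=> Ay sy y1.
have Ayy : A (y ** y) by exact: subcstarM.
have Az : A (e - y ** y) by exact: subcstarB.
have sz : selfadj (e - y ** y).
  by rewrite /selfadj adjB adjM sy (unit_selfadj hA Ae mulex).
have [|q [Aq sq _ qq cq]] := sqrt_near_unit hA Ae mulex mulxe Az sz.
  rewrite opprB addrC subrK; apply: le_trans (nrmM _ _) _.
  by rewrite mulr_ile1 // nrm_ge0.
exists q => //; split=> //; last by rewrite qq addrC subrK.
by apply: cq => //; rewrite /comm mulBx mulxB mulex // mulxe // mulA.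
Qed.

(** The element is q^2 for the [q] of [unitary_part], and [q] is in turn the real part of the
    unitary [q + i y]. The triangle inequality would only give 2. *)
Lemma nrm_unit_sub_sq y : A y -> selfadj y -> nrm y <= 1 -> nrm (e - y ** y) <= 1.
Proof.
move=> Ay sy y1; have [q Aq [sq yq yyqq]] := unitary_part Ay sy y1.
have -> : e - y ** y = q ** q by rewrite -yyqq addrC addKr.
apply: le_trans (nrmM _ _) _; suff q1 : nrm q <= 1 by rewrite mulr_ile1 // nrm_ge0.
apply: (cart_nrm_le sq sy) => //; rewrite addrC yyqq expr1n.
exact: unit_nrm hA Ae mulex.
Qed.

End UnitalNorm.
End CStarTheory.

(** The projection is the unit of its corner. At the image of a unit, this is where square roots in
    the target are taken. *)
Lemma corner_subcstar (R : realType) (V : cstarSpace R) (e : V) :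
  selfadj e -> mul e e = e -> subcstar [set z : V | mul e z = z /\ mul z e = z].
Proof.
move=> se ee; split.
- by split; rewrite ?mulx0 ?mul0x.
- by move=> a x y [ex xe] [ey ye]; split; rewrite ?mulPl ?mulPr ?ex ?xe ?ey ?ye.
- by move=> x y [ex _] [_ ye]; split; rewrite ?mulA ?ex // -mulA ye.
- by move=> x [ex xe]; split; rewrite -{1}se -adjM ?ex ?xe.
- have e1 : nrm e <= 1 by apply: proj_nrm; rewrite se.
  move=> x h; split; apply: eq_of_nrm => d d0;
    have [|y [ey ye] xy] := h (d / 2); try lra;
    have d1 : 0 <= nrm (x - y) by exact: nrm_ge0.
  + have -> : mul e x - x = mul e (x - y) - (x - y).
      by rewrite mulxB ey opprB addrA addrNK.
    have := nrmB (mul e (x - y)) (x - y); have := nrmM e (x - y).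
    have : nrm e * nrm (x - y) <= nrm (x - y) by rewrite ler_piMl.
    lra.
  + have -> : mul x e - x = mul (x - y) e - (x - y).
      by rewrite mulBx ye opprB addrA addrNK.
    have := nrmB (mul (x - y) e) (x - y); have := nrmM (x - y) e.
    have : nrm (x - y) * nrm e <= nrm (x - y) by rewrite ler_piMr.
    lra.
Qed.

(** * Contractivity and isometry of star homomorphisms *)

Section Homs.
Variables (R : realType) (V1 V2 : cstarSpace R).
Local Notation C := (cplx R).
Local Notation "x ** y" := (mul x y) (at level 40, left associativity).
Variables (A : set V1) (e : V1).
Hypothesis hA : subcstar A.
Hypothesis Ae : A e.
Hypothesis mulex : forall x, A x -> e ** x = x.
Hypothesis mulxe : forall x, A x -> x ** e = x.
Variable phi : V1 -> V2.
Hypothesis phiP : forall (c : C) x y, A x -> A y -> phi (c *: x + y) = c *: phi x + phi y.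
Hypothesis phiM : forall x y, A x -> A y -> phi (x ** y) = phi x ** phi y.
Hypothesis phiA : forall x, A x -> phi (adj x) = adj (phi x).

Lemma hom0 : phi 0 = 0.
Proof.
have A0 := subcstar0 hA; have := phiP (-1) A0 A0.
by rewrite scaler0 addr0 => ->; rewrite scaleN1r addNr.
Qed.

Lemma homD x y : A x -> A y -> phi (x + y) = phi x + phi y.
Proof. by move=> Ax Ay; have := phiP 1 Ax Ay; rewrite !scale1r. Qed.

Lemma homZ (c : C) x : A x -> phi (c *: x) = c *: phi x.
Proof. by move=> Ax; have := phiP c Ax (subcstar0 hA); rewrite hom0 !addr0. Qed.

Lemma homB x y : A x -> A y -> phi (x - y) = phi x - phi y.
Proof.
move=> Ax Ay; rewrite homD //; last exact: subcstarN.
by rewrite -scaleN1r homZ // scaleN1r.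
Qed.

Lemma hom_unit_nrm : nrm (phi e) <= 1.
Proof.
apply: proj_nrm.
by rewrite -phiA // -phiM ?(unit_selfadj hA Ae mulex) // mulex.
Qed.

Lemma hom_selfadj x : A x -> selfadj x -> selfadj (phi x).
Proof. by move=> Ax sx; rewrite /selfadj -phiA ?sx. Qed.

Lemma hom_comm x y : A x -> A y -> comm x y -> comm (phi x) (phi y).
Proof. by move=> Ax Ay xy; rewrite /comm -!phiM // xy. Qed.

Lemma hom_contr x : A x -> nrm (phi x) <= nrm x.
Proof.
have H y : A y -> selfadj y -> nrm y <= 1 -> nrm (phi y) <= 1.
  move=> Ay sy y1; have [q Aq [sq yq yyqq]] := unitary_part hA Ae mulex mulxe Ay sy y1.
  apply: (@cart_nrm_le _ _ (phi y) (phi q)) => //; try exact: hom_selfadj.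
    exact: hom_comm.
  rewrite -!phiM // -homD; try exact: subcstarM.
  by rewrite yyqq expr1n hom_unit_nrm.
have H' y : A y -> selfadj y -> nrm (phi y) <= nrm y.
  move=> Ay sy; have := nrm_ge0 y; rewrite le_eqVlt => /predU1P[y0|y0].
    by rewrite -y0 (nrm0_eq0 (esym y0)) hom0 nrm0.
  have ky : cabs (((nrm y)^-1)%:C%C : C) = (nrm y)^-1.
    by rewrite cabsr ger0_norm // invr_ge0 ltW.
  have : nrm (phi (((nrm y)^-1)%:C%C *: y)) <= 1.
    apply: H; first exact: subcstarZ.
    - by rewrite /selfadj adjZ sy; congr (_ *: _); exact: conjc_real.
    - by rewrite nrmZ ky mulVf ?gt_eqF.
  by rewrite homZ // nrmZ ky mulrC ler_pdivrMr // mul1r.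
move=> Ax; rewrite -ler_sqr ?nnegrE ?nrm_ge0 // -!nrm_cstar -phiA // -phiM //.
  by apply: H'; [apply: subcstarM => //; exact: subcstar_adj|rewrite /selfadj adjM adjK].
exact: subcstar_adj.
Qed.

Hypothesis phi_inj : forall x, A x -> phi x = 0 -> x = 0.

(* Let r = |phi c|, 4 y = r^2 - c^2 and s = |y| = sqrt(y^2).  As |phi (c^2)| <= r^2, phi y has a
   square root, so phi s = phi y and by injectivity y = s = t^2; then c^2 + (2 t)^2 = r^2 bounds
   the norm of c by r < 1. *)
Lemma hom_isometry_contra c : A c -> selfadj c -> nrm c = 1 -> nrm (phi c) < 1 -> False.
Proof.
move=> Ac sc c1; set r := nrm (phi c) => r1.
have r0 : 0 <= r by exact: nrm_ge0.
(* The difference r^2 e - c^2 is only bounded by 2, so [nrm y <= 1] needs a factor of at most 1/2;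
   the square 1/4 is later absorbed into (2 t)^2. *)
pose y := (4%:R^-1 : C) *: ((r ^+ 2)%:C%C *: e - c ** c).
have se := unit_selfadj hA Ae mulex.
have n4 : cabs (4%:R^-1 : C) = 4%:R^-1 by rewrite cabsV cabs_nat.
have cr2 : cabs ((r ^+ 2)%:C%C : C) = r ^+ 2 by rewrite cabsr ger0_norm // sqr_ge0.
have r21 : r ^+ 2 <= 1 by rewrite expr_le1 // ltW.
have Acc : A (c ** c) by exact: subcstarM.
have Ay : A y by apply: subcstarZ => //; apply: subcstarB => //; apply: subcstarZ.
have sy : selfadj y.
  rewrite /selfadj adjZ adjB adjZ adjM sc se fmorphV rmorph_nat.
  by congr (_ *: (_ *: _ - _)); exact: conjc_real.
have y1 : nrm y <= 1.
  rewrite nrmZ n4; have := nrmB ((r ^+ 2)%:C%C *: e) (c ** c).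
  have := nrmM c c; rewrite c1 nrmZ cr2 => h1 h2.
  have : r ^+ 2 * nrm e <= 1.
    by rewrite mulr_ile1 ?sqr_ge0 ?nrm_ge0 // (unit_nrm hA Ae mulex).
  lra.
have cy : comm c y.
  rewrite /comm mulxZ mulZx mulxB mulBx mulxZ mulZx mulex // mulxe //.
  by rewrite mulA.
have Ayy : A (y ** y) by exact: subcstarM.
have syy : selfadj (y ** y) by rewrite /selfadj adjM sy.
have [|s [As ss s1 s2 cs]] := sqrt_near_unit hA Ae mulex mulxe Ayy syy.
  exact: nrm_unit_sub_sq mulex mulxe _ _ _ _.
have [t [At st _ t2 ct]] := sqrt_near_unit hA Ae mulex mulxe As ss s1.
have ys : comm y s by apply: cs => //; rewrite /comm mulA.
have yt : comm y t by apply: ct.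
have sct : comm s t by apply: ct.
have c_t : comm c t.
  by apply: ct => //; apply: cs => //; rewrite /comm mulA cy -mulA cy mulA.
have hom_y : phi y = (4%:R^-1 : C) *: ((r ^+ 2)%:C%C *: phi e - phi c ** phi c).
  rewrite homZ ?homB ?homZ ?phiM //; first exact: subcstarZ.
  by apply: subcstarB => //; apply: subcstarZ.
pose A2 := [set z : V2 | phi e ** z = z /\ z ** phi e = z].
have see : selfadj (phi e) by exact: hom_selfadj.
have hA2 : subcstar A2 by apply: corner_subcstar => //; rewrite -phiM // mulex.
have A2phi x : A x -> A2 (phi x).
  by move=> Ax; split; rewrite -phiM // ?mulex ?mulxe.
have m2l x : A2 x -> phi e ** x = x by case.
have m2r x : A2 x -> x ** phi e = x by case.
(* This difference is (1 - r^2 / 4) phi e + (phi c)^2 / 4, and the second term has norm at most r^2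
   / 4 by the choice of [r]. *)
have near : nrm (phi e - phi y) <= 1.
  have -> : phi e - phi y =
      ((1 - 4%:R^-1 * r ^+ 2)%:C%C : C) *: phi e + (4%:R^-1 : C) *: (phi c ** phi c).
    rewrite hom_y scalerBr opprB addrCA scalerA addrC; congr (_ + _).
    rewrite -[X in X - _]scale1r -scalerBl; congr (_ *: _).
    by rewrite [RHS]rmorphB [X in _ = _ - X]rmorphM rmorph1 fmorphV rmorph_nat.
  apply: le_trans (nrmD _ _) _; rewrite !nrmZ n4 cabsr ger0_norm; last lra.
  have := nrmM (phi c) (phi c); rewrite -/r -expr2 => h1.
  have : (1 - 4%:R^-1 * r ^+ 2) * nrm (phi e) <= 1 - 4%:R^-1 * r ^+ 2.
    by rewrite ler_piMr ?hom_unit_nrm //; lra.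
  lra.
have [q [A2q sq _ q2 cq]] := sqrt_near_unit hA2 (A2phi _ Ae) m2l m2r (A2phi _ Ay)
  (hom_selfadj Ay sy) near.
(* From s^2 = y^2 follows W (phi s + phi y) = 0. As phi s = (phi t)^2 and phi y = q^2, the squares
   of the commuting selfadjoint elements W phi t and W q add up to 0, so both vanish. Hence W
   annihilates phi s and phi y, and W^2 = 0. *)
pose W := phi s - phi y.
have A2W : A2 W by apply: subcstarB => //; exact: A2phi.
have sW : selfadj W by rewrite /selfadj adjB !hom_selfadj.
have pst : comm (phi s) (phi t) by exact: hom_comm.
have pyt : comm (phi y) (phi t) by exact: hom_comm.
have pys : comm (phi y) (phi s) by exact: hom_comm.
have qs : comm q (phi s) by apply/comm_sym/cq => //; exact: A2phi.
have qy : comm q (phi y) by apply/comm_sym/cq => //; exact: A2phi.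
have qt : comm q (phi t) by apply/comm_sym/cq => //; exact: A2phi.
have tW : comm (phi t) W by apply: commB.
have qW : comm q W by apply: commB.
have ss0 : W ** (phi s + phi y) = 0.
  rewrite mulBx !mulxD -pys opprD addrA addrK -!phiM // s2 subrr //.
have [X0 Y0] : W ** phi t = 0 /\ W ** q = 0.
  apply: cart_sq0.
  - by rewrite /selfadj adjM sW hom_selfadj.
  - by rewrite /selfadj adjM sW sq.
  - have qWt : comm q (W ** phi t) by exact: commM.
    have WWt : comm W (W ** phi t) by apply: commM => //; exact: comm_sym.
    by apply: commM; exact: comm_sym.
  - rewrite -[W ** phi t ** _]mulA -[W ** q ** _]mulA.
    rewrite [phi t ** _]mulA tW -mulA -[phi t ** _]phiM // t2.
    rewrite [q ** _]mulA qW -mulA q2 -!mulxD ss0 mulx0 //.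
have Ws : W ** phi s = 0 by rewrite -t2 phiM // mulA X0 mul0x.
have Wy : W ** phi y = 0 by rewrite -q2 mulA Y0 mul0x.
have W0 : W = 0 by apply: cstar_eq0; rewrite sW {2}/W mulxB Ws Wy subrr.
have E : s = y.
  apply/eqP; rewrite -subr_eq0; apply/eqP/phi_inj; first exact: subcstarB.
  by rewrite homB.
have : nrm c <= r.
  apply: (@cart_nrm_le _ _ c ((2%:R : C) *: t)) => //.
  - by rewrite /selfadj adjZ st rmorph_nat.
  - by rewrite /comm mulxZ mulZx c_t.
  - rewrite mulxZ mulZx scalerA t2 E /y scalerA -natrM mulfV ?pnatr_eq0 //.
    rewrite scale1r addrC subrK nrmZ cr2 ler_piMr ?sqr_ge0 //.
    exact: unit_nrm hA Ae mulex.
by rewrite c1; lra.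
Qed.

Lemma inj_hom_isometry x : A x -> nrm (phi x) = nrm x.
Proof.
move=> Ax; apply/eqP; rewrite eq_le hom_contr //= leNgt; apply/negP => lt.
have x0 : 0 < nrm x by apply: le_lt_trans lt; exact: nrm_ge0.
have Axx : A (adj x ** x) by apply: subcstarM => //; exact: subcstar_adj.
pose k := (((nrm x ^+ 2)^-1)%:C%C : C).
have kE : cabs k = (nrm x ^+ 2)^-1 by rewrite cabsr ger0_norm // invr_ge0 sqr_ge0.
have xx0 : 0 < nrm x ^+ 2 by rewrite exprn_gt0.
apply: (@hom_isometry_contra (k *: (adj x ** x))).
- exact: subcstarZ.
- by rewrite /selfadj adjZ adjM adjK; congr (_ *: _); exact: conjc_real.
- by rewrite nrmZ kE nrm_cstar mulVf // gt_eqF.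
- rewrite homZ // phiM //; last exact: subcstar_adj.
  rewrite phiA // nrmZ kE nrm_cstar mulrC ltr_pdivrMr // mul1r.
  by rewrite ltrXn2r ?nrm_ge0 // ltW.
Qed.

End Homs.

(** * The Hilbert space of square-summable functions *)

#[local] Existing Instance totally_filter.

Section Ell2.
Variables (R : realType) (X : choiceType).
Local Notation C := (cplx R).
Local Notation ell2 := (ell2 R X).
Implicit Types (f g h : ell2) (a : C).

Lemma l2sq_ge0 (f : X -> C) : (0 <= l2sq f)%E.
Proof. by apply: esum_ge0 => x _; rewrite lee_fin sqr_ge0. Qed.

Lemma l2sq_fin f : l2sq f \is a fin_num.
Proof.
rewrite ge0_fin_numE; last exact: l2sq_ge0.
by case: f => f /=; rewrite square_summableE.
Qed.

Lemma l2norm_ge0 f : 0 <= l2norm f. Proof. exact: sqrtr_ge0. Qed.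

Lemma l2sqE f : l2sq f = ((l2norm f) ^+ 2)%:E.
Proof. by rewrite /l2norm sqr_sqrtr ?fineK ?l2sq_fin // fine_ge0 // l2sq_ge0. Qed.

Lemma psumE (V : zmodType) (u : X -> V) (F : {fset X}) :
  partial_sum u F = \sum_(x <- F) u x.
Proof. by rewrite /partial_sum big_seq_fsetE. Qed.

Lemma l2sq_psum (f : X -> C) (F : {fset X}) :
  ((\sum_(x <- F) (cabs (f x)) ^+ 2)%:E <= l2sq f)%E.
Proof.
apply: ereal_sup_ubound; exists [set` F]; first by split=> //; exact: finite_fset.
by rewrite -sumEFin [RHS]fsbig_seq ?fset_uniq.
Qed.

Lemma psum_le f (F : {fset X}) : \sum_(x <- F) (cabs (f x)) ^+ 2 <= (l2norm f) ^+ 2.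
Proof. by rewrite -lee_fin -l2sqE l2sq_psum. Qed.

Lemma l2sq_le (f : X -> C) (r : R) :
  (forall F : {fset X}, \sum_(x <- F) (cabs (f x)) ^+ 2 <= r) -> (l2sq f <= r%:E)%E.
Proof.
move=> h; apply: ge_ereal_sup => _ [A [fA _] <-].
rewrite fsbig_finite //= sumEFin lee_fin; exact: h.
Qed.

Lemma psum_l2norm f e : 0 < e ->
  exists F : {fset X}, (l2norm f) ^+ 2 - e < \sum_(x <- F) (cabs (f x)) ^+ 2.
Proof.
move=> e0; apply: contrapT => /forallNP h.
have : (l2sq f <= ((l2norm f) ^+ 2 - e)%:E)%E.
  by apply: l2sq_le => F; rewrite leNgt; apply/negP.
by rewrite l2sqE lee_fin; lra.
Qed.

Lemma psum_mono (u : X -> R) (F G : {fset X}) : (forall x, 0 <= u x) ->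
  (F `<=` G)%fset -> \sum_(x <- F) u x <= \sum_(x <- G) u x.
Proof.
move=> u0 FG; rewrite (big_fsetID _ (fun x => x \in F) G) /=.
have -> : [fset x | x in G & x \in F]%fset = F.
  by apply/fsetP => x; rewrite !inE andbC; case: (boolP (x \in F)) => //= /(fsubsetP FG).
by rewrite lerDl sumr_ge0.
Qed.

Lemma cvg_l2norm f :
  partial_sum (fun x => ((cabs (f x)) ^+ 2)%:C%C : C) @ totally -->
    (((l2norm f) ^+ 2)%:C%C : C).
Proof.
apply/cvgrPdist_le => e e0.
have [F hF] : exists F : {fset X},
    (l2norm f) ^+ 2 - complex.Re e < \sum_(x <- F) (cabs (f x)) ^+ 2.
  by apply: psum_l2norm; move: e0; rewrite ltcE => /andP[].
exists F => // G FG /=; rewrite psumE -rmorph_sum -rmorphB /=.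
have -> : e = (complex.Re e)%:C%C by rewrite RRe_real // gtr0_real.
rewrite cabsE lecR cabsr ger0_norm; last by rewrite subr_ge0 psum_le.
have := psum_mono (fun x => sqr_ge0 (cabs (f x))) FG; lra.
Qed.

Lemma cabs_sq (z : C) : ((cabs z) ^+ 2)%:C%C = z * z^*.
Proof. by rewrite -normCK cabsE -rmorphXn. Qed.

Definition polar f g : C :=
  4%:R^-1 * (((l2norm (f + g)) ^+ 2)%:C%C - ((l2norm (f - g)) ^+ 2)%:C%C
   + 'i * ((l2norm (f + 'i *: g)) ^+ 2)%:C%C - 'i * ((l2norm (f - 'i *: g)) ^+ 2)%:C%C).

Lemma polarE (z w : C) : z * w^* = 4%:R^-1 *
  (((cabs (z + w)) ^+ 2)%:C%C - ((cabs (z - w)) ^+ 2)%:C%C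
   + 'i * ((cabs (z + 'i * w)) ^+ 2)%:C%C - 'i * ((cabs (z - 'i * w)) ^+ 2)%:C%C).
Proof.
rewrite !cabs_sq !rmorphD !rmorphN !rmorphM /= conjCi.
have i2 : 'i * 'i = -1 :> C by rewrite -expr2 sqrCi.
move: i2; set j := 'i; move: (z^*) (w^*) => z' w' i2.
apply: (@mulfI _ (4%:R : C)); first by rewrite pnatr_eq0.
rewrite [RHS]mulrA mulfV ?pnatr_eq0 // mul1r.
have -> : j * ((z + j * w) * (z' + - j * w')) = j * z * z' - (j * j) * (z * w') + (j * j) * (w * z')
   - (j * j) * j * w * w' by ring.
have -> : j * ((z - j * w) * (z' - (- j * w'))) =
   j * z * z' + (j * j) * (z * w') - (j * j) * (w * z')
   - (j * j) * j * w * w' by ring.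
by rewrite i2; ring.
Qed.

(** By polarisation the unordered sum is a combination of four sums of squared absolute values, each
    convergent by [cvg_l2norm]. *)
Lemma cvg_inner f g : partial_sum (fun x => f x * (g x)^*) @ totally --> (polar f g : C).
Proof.
have -> : partial_sum (fun x => f x * (g x)^*) = (fun F => 4%:R^-1 * (
     partial_sum (fun x => ((cabs ((f + g) x)) ^+ 2)%:C%C : C) F
   - partial_sum (fun x => ((cabs ((f - g) x)) ^+ 2)%:C%C : C) F
   + 'i * partial_sum (fun x => ((cabs ((f + 'i *: g) x)) ^+ 2)%:C%C : C) F
   - 'i * partial_sum (fun x => ((cabs ((f - 'i *: g) x)) ^+ 2)%:C%C : C) F)).
  apply/funext => F; rewrite !psumE !mulr_sumr -!sumrB -big_split /= -sumrB mulr_sumr.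
  by apply: eq_bigr => x _; rewrite polarE.
apply: cvgMr; apply: cvgB; first apply: cvgD; first apply: cvgB;
  first exact: cvg_l2norm; first exact: cvg_l2norm.
  by apply: cvgMr; exact: cvg_l2norm.
by apply: cvgMr; exact: cvg_l2norm.
Qed.

Lemma inner_cvgE f g (l : C) :
  partial_sum (fun x => f x * (g x)^*) @ totally --> l -> inner f g = l.
Proof. by move=> h; apply: cvg_lim h; exact: norm_hausdorff. Qed.

Lemma cvg_inner' f g : partial_sum (fun x => f x * (g x)^*) @ totally --> inner f g.
Proof. by rewrite (inner_cvgE (@cvg_inner f g)); exact: cvg_inner. Qed.

Lemma innerP a f g h : inner (a *: f + g) h = a * inner f h + inner g h.
Proof.
apply: inner_cvgE.
have -> : partial_sum (fun x => (a *: f + g) x * (h x)^*) =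
    (fun F => a * partial_sum (fun x => f x * (h x)^*) F +
       partial_sum (fun x => g x * (h x)^*) F).
  apply/funext => F; rewrite !psumE mulr_sumr -big_split; apply: eq_bigr => x _.
  by rewrite -[(a *: f + g) x]/(a * f x + g x) mulrDl mulrA.
by apply: cvgD; [apply: cvgMr|]; exact: cvg_inner'.
Qed.

Lemma innerC f g : inner g f = (inner f g)^*.
Proof.
apply: inner_cvgE.
have -> : partial_sum (fun x => g x * (f x)^*) =
    (fun F => (partial_sum (fun x => f x * (g x)^*) F)^*).
  apply/funext => F; rewrite !psumE rmorph_sum; apply: eq_bigr => x _.
  by rewrite rmorphM /= conjCK mulrC.
apply/cvgrPdist_le => e e0; move/cvgrPdist_le: (@cvg_inner' f g) => /(_ e e0).
by apply: filterS => F; rewrite -rmorphB norm_conjC.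
Qed.

Lemma inner_ff f : inner f f = ((l2norm f) ^+ 2)%:C%C.
Proof.
apply: inner_cvgE.
have -> : (fun x => f x * (f x)^*) = (fun x => ((cabs (f x)) ^+ 2)%:C%C).
  by apply/funext => x; rewrite cabs_sq.
exact: cvg_l2norm.
Qed.

Lemma inner0l g : inner 0 g = 0.
Proof. by have := innerP (-1) 0 0 g; rewrite scaler0 addr0 mulN1r addNr. Qed.

Lemma innerDl f g h : inner (f + g) h = inner f h + inner g h.
Proof. by have := innerP 1 f g h; rewrite scale1r mul1r. Qed.

Lemma innerZl a f h : inner (a *: f) h = a * inner f h.
Proof. by have := innerP a f 0 h; rewrite inner0l !addr0. Qed.

Lemma innerNl f h : inner (- f) h = - inner f h.
Proof. by rewrite -scaleN1r innerZl mulN1r. Qed.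

Lemma innerBl f g h : inner (f - g) h = inner f h - inner g h.
Proof. by rewrite innerDl innerNl. Qed.

Lemma innerDr f g h : inner h (f + g) = inner h f + inner h g.
Proof. by rewrite innerC innerDl rmorphD /= -!innerC. Qed.

Lemma innerZr a f h : inner h (a *: f) = a^* * inner h f.
Proof. by rewrite innerC innerZl rmorphM /= -innerC. Qed.

Lemma innerNr f h : inner h (- f) = - inner h f.
Proof. by rewrite innerC innerNl rmorphN /= -innerC. Qed.

Lemma innerBr f g h : inner h (f - g) = inner h f - inner h g.
Proof. by rewrite innerDr innerNr. Qed.

Lemma le_cabs_l2norm f x : cabs (f x) <= l2norm f.
Proof.
rewrite -ler_sqr ?nnegrE ?cabs_ge0 ?l2norm_ge0 //.
by have := psum_le f [fset x]%fset; rewrite big_seq_fset1.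
Qed.

Lemma l2norm0_eq0 f : l2norm f = 0 -> f = 0.
Proof.
move=> f0; apply/val_inj/funext => x; apply: cabs0_eq0; apply/eqP.
by rewrite eq_le cabs_ge0 andbT -f0 le_cabs_l2norm.
Qed.

Lemma l2norm_le f r : 0 <= r ->
  (forall F : {fset X}, \sum_(x <- F) (cabs (f x)) ^+ 2 <= r ^+ 2) -> l2norm f <= r.
Proof.
move=> r0 /l2sq_le; rewrite l2sqE lee_fin ler_sqr // nnegrE l2norm_ge0 //.
Qed.

Lemma l2normZ a f : l2norm (a *: f) = cabs a * l2norm f.
Proof.
apply/eqP; rewrite -(@eqrXn2 _ 2) ?l2norm_ge0 ?mulr_ge0 ?cabs_ge0 ?l2norm_ge0 //.
apply/eqP; apply: (@complexI R); rewrite -inner_ff innerZl innerZr inner_ff.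
by rewrite mulrA -cabs_sq -rmorphM exprMn.
Qed.

Lemma l2norm0 : l2norm (0 : ell2) = 0.
Proof. by rewrite -(scale0r (0 : ell2)) l2normZ cabs0 mul0r. Qed.

Lemma l2normN f : l2norm (- f) = l2norm f.
Proof. by rewrite -scaleN1r l2normZ cabsN cabs1 mul1r. Qed.

Lemma cabs_inner f g : cabs (inner f g) <= l2norm f * l2norm g.
Proof.
have := l2norm_ge0 g; rewrite le_eqVlt => /predU1P[g0|g0].
  rewrite (l2norm0_eq0 (esym g0)) innerC inner0l rmorph0 cabs0.
  by rewrite mulr_ge0 ?l2norm_ge0.
rewrite -ler_sqr ?nnegrE ?mulr_ge0 ?cabs_ge0 ?l2norm_ge0 //.
pose b := (l2norm g) ^+ 2; have b0 : 0 < b by rewrite exprn_gt0.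
(* This is [b] times the component of [f] orthogonal to [g], which avoids a division by [b]. *)
pose h := b%:C%C *: f - inner f g *: g.
have : (l2norm h) ^+ 2 = b * (b * (l2norm f) ^+ 2 - cabs (inner f g) ^+ 2).
  apply: (@complexI R); rewrite -inner_ff /h !innerBl !innerBr !innerZl !innerZr.
  rewrite !inner_ff (innerC f g) -/b [RHS]rmorphM [X in _ = _ * X]rmorphB.
  rewrite [X in _ = _ * (X - _)]rmorphM [X in _ = _ * (_ - X)]cabs_sq.
  have -> : (b%:C%C : C)^* = b%:C%C by exact: conjc_real.
  by set c := inner f g; ring.
move=> E; have : 0 <= b * (b * (l2norm f) ^+ 2 - cabs (inner f g) ^+ 2).
  by rewrite -E sqr_ge0.
by rewrite pmulr_rge0 // subr_ge0 exprMn mulrC.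
Qed.

Lemma Re_le_cabs (z : C) : complex.Re z <= cabs z.
Proof.
case: z => x y; rewrite /cabs normc_def /=; apply: le_trans (ler_norm _) _.
by rewrite -sqrtr_sqr ler_wsqrtr // lerDl sqr_ge0.
Qed.

Lemma l2normD f g : l2norm (f + g) <= l2norm f + l2norm g.
Proof.
rewrite -ler_sqr ?nnegrE ?addr_ge0 ?l2norm_ge0 //.
have -> : (l2norm (f + g)) ^+ 2 =
    (l2norm f) ^+ 2 + complex.Re (inner f g) *+ 2 + (l2norm g) ^+ 2.
  have : inner (f + g) (f + g) = ((l2norm (f + g)) ^+ 2)%:C%C by rewrite inner_ff.
  rewrite innerDl !innerDr (innerC f g) !inner_ff => /(congr1 (@complex.Re R)).
  by case: (inner f g) => x y /= <-; rewrite mulr2n !addrA.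
have := le_trans (Re_le_cabs (inner f g)) (cabs_inner f g).
by rewrite sqrrD => ?; lra.
Qed.

Lemma l2normB f g : l2norm (f - g) <= l2norm f + l2norm g.
Proof. by rewrite -(l2normN g) l2normD. Qed.

Lemma l2normBC f g : l2norm (f - g) = l2norm (g - f).
Proof. by rewrite -l2normN opprB. Qed.

Lemma inner_ext f g : (forall h, inner f h = inner g h) -> f = g.
Proof.
move=> H; apply/eqP; rewrite -subr_eq0; apply/eqP/l2norm0_eq0/eqP.
rewrite -sqrf_eq0; apply/eqP/(@complexI R).
by rewrite -inner_ff innerBl H subrr.
Qed.

Section Finitary.
Variables (u : X -> C) (F : {fset X}).

Definition fcut : X -> C := fun x => if x \in F then u x else 0.

Lemma fcut_psum (G : {fset X}) :
  \sum_(x <- G) (cabs (fcut x)) ^+ 2 <= \sum_(x <- F) (cabs (u x)) ^+ 2.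
Proof.
have -> : \sum_(x <- F) (cabs (u x)) ^+ 2 = \sum_(x <- F) (cabs (fcut x)) ^+ 2.
  by rewrite !big_seq; apply: eq_bigr => x xF; rewrite /fcut xF.
rewrite (big_fsetID _ (fun x => x \in F) G) /= [X in _ + X]big1_seq ?addr0.
  apply: psum_mono => [x|]; first exact: sqr_ge0.
  by apply/fsubsetP => x; rewrite !inE => /andP[].
move=> x; rewrite !inE => /andP[_ /andP[_ xF]].
by rewrite /fcut (negbTE xF) cabs0 expr0n.
Qed.

Lemma fcut_summable : fcut \in @square_summable R X.
Proof.
rewrite square_summableE; apply: le_lt_trans (ltry _).
exact: (l2sq_le fcut_psum).
Qed.

Definition cut : ell2 := Ell2 fcut_summable.

Lemma cut_norm r : 0 <= r -> (forall x, cabs (u x) <= r) ->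
  l2norm cut <= #|` F|%:R * r.
Proof.
move=> r0 ur; apply: l2norm_le => [|G]; first by rewrite mulr_ge0.
apply: le_trans (fcut_psum G) _.
have [->|F0] := eqVneq F fset0; first by rewrite big_seq_fset0 sqr_ge0.
have k1 : 1 <= #|` F|%:R :> R by rewrite ler1n cardfs_gt0.
apply: (@le_trans _ _ (\sum_(x <- F) r ^+ 2)).
  by apply: ler_sum => x _; rewrite ler_sqr ?nnegrE ?cabs_ge0.
rewrite big_const_seq count_predT -Monoid.iteropE /= -/(_ *+ _).
rewrite -[_ *+ _]mulr_natl exprMn ler_wpM2r ?sqr_ge0 //.
by rewrite expr2 ler_peMl // ler0n.
Qed.

End Finitary.

Lemma cut_norm_le f F : l2norm (cut f F) <= l2norm f.
Proof.
apply: l2norm_le => [|G]; first exact: l2norm_ge0.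
exact: le_trans (fcut_psum f F G) (psum_le f F).
Qed.

Definition delta (x : X) : ell2 := cut (fun=> 1) [fset x]%fset.

Lemma deltaE x y : delta x y = (y == x)%:R.
Proof. by rewrite /= /fcut inE; case: eqP. Qed.

Lemma inner_delta f x : inner f (delta x) = f x.
Proof.
have := deltaE x; move: (delta x) => d dE.
apply: inner_cvgE; apply/cvgrPdist_le => e e0.
exists [fset x]%fset => // G; rewrite /= fsub1set => xG.
rewrite psumE (big_fsetD1 x) //= big1_seq ?addr0.
  by rewrite dE eqxx rmorph1 mulr1 subrr normr0 ltW.
move=> y; rewrite !inE => /andP[_ /andP[yx _]].
by rewrite dE (negbTE yx) rmorph0 mulr0.
Qed.

Lemma l2norm_delta x : l2norm (delta x) = 1.
Proof.
apply/eqP; rewrite -(@eqrXn2 _ 2) ?l2norm_ge0 ?ler01 //; apply/eqP/(@complexI R).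
by rewrite -inner_ff inner_delta deltaE eqxx expr1n.
Qed.

End Ell2.

(** * Completeness of the Hilbert space *)

Section Completeness.
Variable R : realType.
Local Notation C := (cplx R).

(** Taking [m] with [w m] small in [b n <= a n m + b m] removes the factor [K] from a crude bound.
    Here [K] is 2 when real and imaginary parts converge separately, and the number of coordinates
    for a finite cut of a vector. The tolerance [e / (K + 1)] covers [m < n], where [a n m] is
    itself at most [w m]. *)
Lemma rate_limit (a : nat -> nat -> R) (b w : nat -> R) (K : R) :
  0 <= K -> (forall n, 0 <= w n) -> (forall e, 0 < e -> exists n, w n <= e) ->
  (forall n m, (n <= m)%N -> a n m <= w n /\ a m n <= w n) ->
  (forall n m, b n <= a n m + b m) -> (forall n, b n <= K * w n) ->
  forall n, b n <= w n.
Proof.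
move=> K0 w0 wlim ha hb hK n; apply/ler_addgt0Pl => e e0.
have K1 : 0 < K + 1 by lra.
have [m hm] := wlim (e / (K + 1)) (divr_gt0 e0 K1).
have : w m * (K + 1) <= e by rewrite -ler_pdivlMr.
have := hb n m; have := hK m; have := w0 m; have := w0 n.
case: (leqP n m) => [/ha[h _]|/ltnW/ha[_ h]]; first by have := w0 m; lra.
lra.
Qed.

(** The intervals [u n - w n, u n + w n] meet pairwise, so the supremum of their left ends lies in
    all of them; [w] need not tend to 0. *)
Lemma real_complete (u w : nat -> R) :
  (forall n m, (n <= m)%N -> `|u m - u n| <= w n) ->
  exists l, forall n, `|u n - l| <= w n.
Proof.
move=> h.
have le n m : u n - w n <= u m + w m.
  have := h n (maxn n m) (leq_maxl _ _); have := h m (maxn n m) (leq_maxr _ _).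
  by rewrite !ler_norml => /andP[? ?] /andP[? ?]; lra.
pose S := range (fun n => u n - w n).
have hS : has_sup S.
  by split; [exists (u 0%N - w 0%N), 0%N|exists (u 0%N + w 0%N) => _ [n _ <-]].
exists (sup S) => n; rewrite ler_distlC; apply/andP; split.
  by apply: ub_le_sup; [case: hS|exists n].
by apply: ge_sup; [case: hS|move=> _ [m _ <-]].
Qed.

Lemma cabs_Re_Im (z : C) : cabs z <= `|complex.Re z| + `|complex.Im z|.
Proof.
rewrite {1}(complexE z) complexiE; apply: le_trans (cabsD _ _) _.
by rewrite cabsM cabsi mul1r !cabsr.
Qed.

Lemma cplx_complete (u : nat -> C) (w : nat -> R) :
  (forall e, 0 < e -> exists n, w n <= e) ->
  (forall n m, (n <= m)%N -> cabs (u m - u n) <= w n) ->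
  exists l, forall n, cabs (u n - l) <= w n.
Proof.
move=> w0 h.
have le_Im z : `|complex.Im z| <= cabs z.
  case: z => x y; rewrite /cabs normc_def /= -sqrtr_sqr.
  by rewrite ler_wsqrtr // lerDr sqr_ge0.
have le_Re z : `|complex.Re z| <= cabs z.
  case: z => x y; rewrite /cabs normc_def /= -sqrtr_sqr.
  by rewrite ler_wsqrtr // lerDl sqr_ge0.
have [n m nm|x hx] := @real_complete (fun n => complex.Re (u n)) w.
  by apply: le_trans (h _ _ nm); rewrite -raddfB; apply: le_Re.
have [n m nm|y hy] := @real_complete (fun n => complex.Im (u n)) w.
  by apply: le_trans (h _ _ nm); rewrite -raddfB; apply: le_Im.
exists (Complex x y).
apply: (@rate_limit (fun n m => cabs (u n - u m)) _ w 2) => //.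
- by move=> n; apply: le_trans (h _ _ (leqnn n)); exact: cabs_ge0.
- move=> n m nm; split; last exact: h.
  by rewrite -cabsN opprB h.
- by move=> n m; rewrite -{1}(subrK (u m) (u n)) -addrA cabsD.
- move=> n; apply: le_trans (cabs_Re_Im _) _; rewrite !raddfB /=.
  by have := hx n; have := hy n; lra.
Qed.

Variable X : choiceType.
Local Notation ell2 := (ell2 R X).

Lemma psum_cut (f : X -> C) (F : {fset X}) :
  \sum_(x <- F) (cabs (f x)) ^+ 2 <= (l2norm (cut f F)) ^+ 2.
Proof.
apply: le_trans (psum_le (cut f F) F); rewrite !big_seq le_eqVlt; apply/orP; left.
by apply/eqP/eq_bigr => x xF; rewrite /= /fcut xF.
Qed.

Lemma ell2_complete (u : nat -> ell2) (w : nat -> R) :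
  (forall e, 0 < e -> exists n, w n <= e) ->
  (forall n m, (n <= m)%N -> l2norm (u m - u n) <= w n) ->
  exists l, forall n, l2norm (u n - l) <= w n.
Proof.
move=> wlim h.
have w0 n : 0 <= w n by apply: le_trans (h _ _ (leqnn n)); exact: l2norm_ge0.
have /choice[l hl] : forall x, exists l, forall n, cabs (u n x - l) <= w n.
  move=> x; apply: cplx_complete => // n m nm.
  exact: le_trans (le_cabs_l2norm (u m - u n) x) (h _ _ nm).
have hF n (F : {fset X}) :
    \sum_(x <- F) (cabs (u n x - l x)) ^+ 2 <= (w n) ^+ 2.
  apply: le_trans (psum_cut _ _) _; rewrite ler_sqr ?nnegrE ?l2norm_ge0 //.
  pose b n := l2norm (cut (fun x => u n x - l x) F).
  apply: (@rate_limit (fun n m => l2norm (u n - u m)) b w #|` F|%:R) => //.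
  - by move=> k m km; split; last exact: h; rewrite l2normBC h.
  - move=> k m; apply: le_trans (lerD (cut_norm_le (u k - u m) F) (lexx (b m))).
    apply: le_trans (l2normD _ _); rewrite le_eqVlt; apply/orP; left.
    apply/eqP; congr l2norm.
    apply/val_inj/funext => x; rewrite /= /fcut -[LHS]/(if _ then _ else _).
    rewrite -[RHS]/((if x \in F then (u k - u m) x else 0) +
      (if x \in F then u m x - l x else 0)).
    by case: ifP; rewrite ?addr0 // addrA subrK.
  - by move=> k; apply: cut_norm.
have dl n : (fun x => u n x - l x) \in @square_summable R X.
  rewrite square_summableE; apply: le_lt_trans (ltry _); exact: l2sq_le (hF n).
(* Only the differences [u n - l] have been shown square-summable, so [l] is recovered from one of
   them. *)
exists (u 0%N - Ell2 (dl 0%N)) => n.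
have -> : u n - (u 0%N - Ell2 (dl 0%N)) = Ell2 (dl n).
  apply/val_inj/funext => x.
  rewrite -[LHS]/(u n x - (u 0%N x - (u 0%N x - l x))) -[RHS]/(u n x - l x).
  by rewrite subKr.
apply: l2norm_le; [exact: w0|exact: (hF n)].
Qed.

End Completeness.

(** * Adjointable operators on the Hilbert space *)

Section Ops.
Variables (R : realType) (X : choiceType).
Local Notation C := (cplx R).
Local Notation ell2 := (ell2 R X).
Implicit Types (f g : ell2) (a : C) (S T : ell2 -> ell2).

Lemma linop0 T : linear T -> T 0 = 0.
Proof. by move=> lT; have := lT (-1) 0 0; rewrite scaler0 addr0 scaleN1r addNr. Qed.

Lemma linopB T f g : linear T -> T (f - g) = T f - T g.
Proof.
by move=> lT; rewrite addrC -scaleN1r lT scaleN1r addrC.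
Qed.

Lemma bounded_nneg T : bounded_op T ->
  exists2 M : R, 0 <= M & forall f, l2norm (T f) <= M * l2norm f.
Proof.
move=> [_ [M hM]]; exists `|M| => // f; apply: le_trans (hM f) _.
by rewrite ler_wpM2r ?l2norm_ge0 // ler_norm.
Qed.

Definition op_bounds T := [set M : R | 0 <= M /\ forall f, l2norm (T f) <= M * l2norm f].

Definition opnorm T : R := inf (op_bounds T).

Lemma op_bounds_has_inf T : bounded_op T -> has_inf (op_bounds T).
Proof.
move=> /bounded_nneg[M M0 hM]; split; first by exists M.
by exists 0 => y [].
Qed.

Lemma opnorm_ge0 T : bounded_op T -> 0 <= opnorm T.
Proof. by move=> /op_bounds_has_inf[h _]; apply: lb_le_inf => // y []. Qed.

Lemma opnormP T f : bounded_op T -> l2norm (T f) <= opnorm T * l2norm f.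
Proof.
move=> bT; have := l2norm_ge0 f; rewrite le_eqVlt => /predU1P[f0|f0].
  by rewrite (l2norm0_eq0 (esym f0)) linop0 ?l2norm0 ?mulr0 //; case: bT.
rewrite -ler_pdivrMr //; apply: lb_le_inf; first by case: (op_bounds_has_inf bT).
by move=> M [_ hM]; rewrite ler_pdivrMr.
Qed.

Lemma opnorm_le T M : 0 <= M -> (forall f, l2norm (T f) <= M * l2norm f) -> opnorm T <= M.
Proof. by move=> M0 hM; apply: ge_inf => //; exists 0 => y []. Qed.

Lemma bounded_lin a S T : bounded_op S -> bounded_op T -> bounded_op (a *: S + T).
Proof.
move=> [lS [M hM]] [lT [N hN]]; split=> [c f g|].
  rewrite -[LHS]/(a *: S (c *: f + g) + T (c *: f + g)) lS lT.
  rewrite -[RHS]/(c *: (a *: S f + T f) + (a *: S g + T g)).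
  by rewrite !scalerDr !scalerA [a * c]mulrC addrACA.
exists (cabs a * M + N) => f; apply: le_trans (l2normD _ _) _.
rewrite l2normZ mulrDl -mulrA; apply: lerD => //.
by rewrite ler_wpM2l // cabs_ge0.
Qed.

Lemma bounded0 : bounded_op (0 : ell2 -> ell2).
Proof.
split=> [c f g|]; first by rewrite scaler0 addr0.
by exists 0 => f; rewrite mul0r [l2norm _]l2norm0.
Qed.

Lemma bounded_comp S T : bounded_op S -> bounded_op T -> bounded_op (S \o T).
Proof.
move=> bS bT; have [M M0 hM] := bounded_nneg bS; have [N N0 hN] := bounded_nneg bT.
case: bS bT => lS _ [lT _]; split=> [c f g|]; first by rewrite /= lT lS.
exists (M * N) => f; apply: le_trans (hM _) _.
by rewrite -mulrA ler_wpM2l.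
Qed.

Lemma adjoint_sym S T : adjoint_op S T -> adjoint_op T S.
Proof. by move=> h f g; rewrite innerC -h -innerC. Qed.

Lemma adjoint_lin a S T S' T' : adjoint_op S S' -> adjoint_op T T' ->
  adjoint_op (a *: S + T) (a^* *: S' + T').
Proof.
move=> hS hT f g; rewrite -[(a *: S + T) f]/(a *: S f + T f).
rewrite -[(a^* *: S' + T') g]/(a^* *: S' g + T' g).
by rewrite innerDl innerZl innerDr innerZr conjCK hS hT.
Qed.

Lemma adjoint_comp S T S' T' : adjoint_op S S' -> adjoint_op T T' ->
  adjoint_op (S \o T) (T' \o S').
Proof. by move=> hS hT f g; rewrite /= hS hT. Qed.

Lemma adjoint_uniq S T T' : adjoint_op S T -> adjoint_op S T' -> T = T'.
Proof.
move=> h h'; apply/funext => g; apply: inner_ext => f.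
by rewrite innerC -h h' -innerC.
Qed.

Lemma adjoint_bounded S T : linear T -> bounded_op S -> adjoint_op S T ->
  forall f, l2norm (T f) <= opnorm S * l2norm f.
Proof.
move=> lT bS h f; have := l2norm_ge0 (T f); rewrite le_eqVlt => /predU1P[<-|Tf0].
  by rewrite mulr_ge0 ?opnorm_ge0 ?l2norm_ge0.
rewrite -(ler_pM2l Tf0) -expr2.
have -> : l2norm (T f) ^+ 2 = cabs (inner (S (T f)) f).
  by rewrite h inner_ff cabsr ger0_norm // sqr_ge0.
apply: le_trans (cabs_inner _ _) _; rewrite mulrA ler_wpM2r ?l2norm_ge0 //.
by rewrite mulrC opnormP.
Qed.

Lemma adjoint_linear S T : adjoint_op S T -> linear T.
Proof.
move=> /adjoint_sym h c f g; apply: inner_ext => k.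
by rewrite innerP !h innerP.
Qed.

Lemma adjoint_bounded_op S T : bounded_op S -> adjoint_op S T -> bounded_op T.
Proof.
move=> bS h; have lT := adjoint_linear h; split=> //.
by exists (opnorm S) => f; exact: adjoint_bounded h f.
Qed.

(** The adjoint is required instead of being derived from boundedness by Riesz representation. The
    requirement survives norm limits by [bop_complete]. *)
Definition adjointable : {pred ell2 -> ell2} :=
  fun T => `[< bounded_op T /\ exists S, adjoint_op T S >].

Lemma adjointableP T : reflect (bounded_op T /\ exists S, adjoint_op T S) (T \in adjointable).
Proof. exact: asboolP. Qed.

Lemma adjointable_submod : subsemimod_closed adjointable.
Proof.
have A0 : (0 : ell2 -> ell2) \in adjointable.
  apply/adjointableP; split; first exact: bounded0.
  by exists 0 => f g; rewrite [LHS]inner0l innerC [inner _ _]inner0l rmorph0.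
have AL a S T : S \in adjointable -> T \in adjointable -> a *: S + T \in adjointable.
  move=> /adjointableP[bS [S' hS]] /adjointableP[bT [T' hT]]; apply/adjointableP.
  split; first exact: bounded_lin.
  by exists (a^* *: S' + T'); exact: adjoint_lin.
split; first split=> //.
- by move=> S T hS hT; rewrite -[S]scale1r AL.
- by move=> a S hS; rewrite -[a *: S]addr0 AL.
Qed.

HB.instance Definition _ :=
  GRing.isSubmodClosed.Build C (ell2 -> ell2) adjointable adjointable_submod.

Record bop := Bop { bop_fun :> ell2 -> ell2; bop_adjointable : bop_fun \in adjointable }.

HB.instance Definition _ := [isSub for bop_fun].
HB.instance Definition _ := [Choice of bop by <:].
HB.instance Definition _ := [SubChoice_isSubLmodule of bop by <:].

Implicit Types x y z : bop.

Lemma bop_bounded x : bounded_op x.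
Proof. by case: x => T /= /adjointableP[]. Qed.

Lemma bop_linear x : linear x. Proof. by have [] := bop_bounded x. Qed.

Lemma bop_adj_ex x : exists S, adjoint_op x S.
Proof. by case: x => T /= /adjointableP[]. Qed.

Lemma bmul_adjointable x y : (x \o y : ell2 -> ell2) \in adjointable.
Proof.
apply/adjointableP; split; first exact: bounded_comp (bop_bounded x) (bop_bounded y).
have [S hS] := bop_adj_ex x; have [T hT] := bop_adj_ex y.
by exists (T \o S); exact: adjoint_comp.
Qed.

Definition bmul x y : bop := Bop (bmul_adjointable x y).

Lemma badj_adjointable x : projT1 (cid (bop_adj_ex x)) \in adjointable.
Proof.
case: cid => S hS /=; apply/adjointableP.
split; first exact: adjoint_bounded_op (bop_bounded x) hS.
by exists x; exact: adjoint_sym.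
Qed.

Definition badj x : bop := Bop (badj_adjointable x).

Lemma badjP x : adjoint_op x (badj x).
Proof. by rewrite /=; case: cid. Qed.

Lemma bop_ext x y : (forall f, x f = y f) -> x = y.
Proof. by move=> h; apply/val_inj/funext. Qed.

Lemma badj_eq x y : adjoint_op x y -> badj x = y.
Proof. by move=> h; apply/val_inj; exact: adjoint_uniq (badjP x) h. Qed.

Definition bnorm x := opnorm x.

Lemma bop_nrmP x f : l2norm (x f) <= bnorm x * l2norm f.
Proof. exact: opnormP (bop_bounded x). Qed.

Lemma bop_nrm0 x : bnorm x = 0 -> x = 0.
Proof.
move=> x0; apply: bop_ext => f; apply: l2norm0_eq0; apply/eqP.
by rewrite eq_le l2norm_ge0 andbT; have := bop_nrmP x f; rewrite x0 mul0r.
Qed.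

Lemma bop_nrm_ge0 x : 0 <= bnorm x. Proof. exact: opnorm_ge0 (bop_bounded x). Qed.

Lemma bop_nrmD x y : bnorm (x + y) <= bnorm x + bnorm y.
Proof.
apply: opnorm_le; first by rewrite addr_ge0 ?bop_nrm_ge0.
move=> f; apply: le_trans (l2normD (x f) (y f)) _.
by rewrite mulrDl lerD ?bop_nrmP.
Qed.

Lemma bop_nrmZ a x : bnorm (a *: x) = cabs a * bnorm x.
Proof.
have le b y : bnorm (b *: y) <= cabs b * bnorm y.
  apply: opnorm_le; first by rewrite mulr_ge0 ?cabs_ge0 ?bop_nrm_ge0.
  move=> f; rewrite -[(b *: y : bop) f]/(b *: y f) l2normZ -mulrA ler_wpM2l ?cabs_ge0 //.
  exact: bop_nrmP.
apply/eqP; rewrite eq_le le /=; have [->|a0] := eqVneq a 0.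
  by rewrite cabs0 mul0r bop_nrm_ge0.
have c0 : 0 < cabs a.
  rewrite lt_neqAle cabs_ge0 andbT eq_sym; apply: contra_neq a0.
  exact: cabs0_eq0.
have := le a^-1 (a *: x); rewrite scalerA mulVf // scale1r cabsV mulrC.
by rewrite ler_pdivlMr // mulrC.
Qed.

Lemma bop_nrmM x y : bnorm (bmul x y) <= bnorm x * bnorm y.
Proof.
apply: opnorm_le; first by rewrite mulr_ge0 ?bop_nrm_ge0.
move=> f; apply: le_trans (bop_nrmP x (y f)) _.
by rewrite -mulrA ler_wpM2l ?bop_nrm_ge0 ?bop_nrmP.
Qed.

Lemma badjK : involutive badj.
Proof. by move=> x; apply: badj_eq; apply: adjoint_sym; exact: badjP. Qed.

Lemma badj_nrm x : bnorm (badj x) = bnorm x.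
Proof.
suff le y : bnorm (badj y) <= bnorm y.
  by apply/eqP; rewrite eq_le le -{1}[x]badjK le.
apply: opnorm_le (bop_nrm_ge0 y) _ => f.
exact: adjoint_bounded (@bop_linear (badj y)) (bop_bounded y) (badjP y) f.
Qed.

Lemma bop_cstar x : bnorm (bmul (badj x) x) = bnorm x ^+ 2.
Proof.
apply/eqP; rewrite eq_le; apply/andP; split.
  by apply: le_trans (bop_nrmM _ _) _; rewrite badj_nrm expr2.
set k := bnorm (bmul _ _); have k0 : 0 <= k by exact: bop_nrm_ge0.
rewrite -[leRHS]sqr_sqrtr // ler_sqr ?nnegrE ?sqrtr_ge0 ?bop_nrm_ge0 //.
apply: opnorm_le; first exact: sqrtr_ge0.
move=> f; rewrite -ler_sqr ?nnegrE ?mulr_ge0 ?sqrtr_ge0 ?l2norm_ge0 //.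
rewrite exprMn [X in _ <= X * _]sqr_sqrtr //.
have -> : l2norm (x f) ^+ 2 = cabs (inner f (badj x (x f))).
  by rewrite -badjP inner_ff cabsr ger0_norm // sqr_ge0.
apply: le_trans (cabs_inner _ _) _; rewrite mulrC expr2 mulrA.
by rewrite ler_wpM2r ?l2norm_ge0 //; exact: (bop_nrmP (bmul (badj x) x)).
Qed.

(** The adjoints converge pointwise at the same rate, and the adjoint relation passes to the two
    limits. Linearity of the limit then comes for free, since any map with an adjoint is linear. *)
Lemma bop_complete (u : nat -> bop) (w : nat -> R) :
  (forall e, 0 < e -> exists n, w n <= e) ->
  (forall n m, (n <= m)%N -> bnorm (u m - u n) <= w n) ->
  exists l : bop, forall n, bnorm (u n - l) <= w n.
Proof.
move=> wlim h.
have w0 n : 0 <= w n by apply: le_trans (h _ _ (leqnn n)); exact: bop_nrm_ge0.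
have ex (v : nat -> bop) : (forall n m, (n <= m)%N -> bnorm (v m - v n) <= w n) ->
    exists l : ell2 -> ell2, forall n f, l2norm (v n f - l f) <= w n * l2norm f.
  move=> hv; suff /choice[l hl] : forall f, exists l, forall n,
      l2norm (v n f - l) <= w n * l2norm f by exists l.
  move=> f; apply: ell2_complete => [e e0|n m nm].
    have f1 : 0 < l2norm f + 1 by have := l2norm_ge0 f; lra.
    have [n hn] := wlim _ (divr_gt0 e0 f1); exists n.
    move: hn; rewrite ler_pdivlMr // => hn; apply: le_trans hn.
    by rewrite ler_wpM2l // lerDl.
  apply: le_trans (bop_nrmP (v m - v n) f) _.
  by rewrite ler_wpM2r ?l2norm_ge0 // hv.
have [l hl] := ex u h.
have [k hk] : exists k : ell2 -> ell2, forall n f,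
    l2norm (badj (u n) f - k f) <= w n * l2norm f.
  apply: ex => n m nm; apply: le_trans (h _ _ nm); rewrite -[leRHS]badj_nrm.
  have -> : badj (u m - u n) = badj (u m) - badj (u n); last by [].
  apply: badj_eq => f g; rewrite -[(u m - u n : bop) f]/(u m f - u n f).
  rewrite -[(badj (u m) - badj (u n) : bop) g]/(badj (u m) g - badj (u n) g).
  by rewrite innerBl innerBr !badjP.
have lk : adjoint_op l k.
  move=> f g; apply/eqP; rewrite -subr_eq0; apply/eqP/cabs0_eq0/eqP.
  rewrite eq_le cabs_ge0 andbT; apply/ler_addgt0Pl => e e0; rewrite addr0.
  pose c := l2norm f * l2norm g; have c0 : 0 <= c by rewrite mulr_ge0 ?l2norm_ge0.
  have [n hn] : exists n, w n <= e / (2 * (c + 1)) by apply: wlim; apply: divr_gt0; lra.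
  have hn' : w n * (2 * (c + 1)) <= e by rewrite -ler_pdivlMr //; lra.
  have -> : inner (l f) g - inner f (k g) =
      inner f (badj (u n) g - k g) - inner (u n f - l f) g.
    by rewrite innerBr innerBl badjP opprB [RHS]addrC addrA addrNK.
  apply: le_trans (cabsD _ _) _; rewrite cabsN.
  have := cabs_inner f (badj (u n) g - k g); have := cabs_inner (u n f - l f) g.
  have : l2norm f * l2norm (badj (u n) g - k g) <= l2norm f * (w n * l2norm g).
    by rewrite ler_wpM2l ?l2norm_ge0.
  have : l2norm (u n f - l f) * l2norm g <= w n * l2norm f * l2norm g.
    by rewrite ler_wpM2r ?l2norm_ge0.
  rewrite [l2norm f * (_ * _)]mulrCA -mulrA -/c; have := w0 n; nra.
have bl : bounded_op l.
  split; first by apply: adjoint_linear (adjoint_sym lk).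
  exists (bnorm (u 0%N) + w 0%N) => f; rewrite -[l f](subKr (u 0%N f)).
  apply: le_trans (l2normB _ _) _; rewrite mulrDl.
  by apply: lerD; [exact: bop_nrmP|exact: hl].
have Al : l \in adjointable by apply/adjointableP; split=> //; exists k.
by exists (Bop Al) => n; apply: opnorm_le => // f; exact: hl.
Qed.

Lemma bop_mulPl a x y z : bmul (a *: x + y) z = a *: bmul x z + bmul y z.
Proof. exact: bop_ext. Qed.

Lemma bop_mulPr a x y z : bmul z (a *: x + y) = a *: bmul z x + bmul z y.
Proof. by apply: bop_ext => f; have [lz _] := bop_bounded z; rewrite [LHS]lz. Qed.

Lemma bop_mulA : associative bmul. Proof. by move=> x y z; exact: bop_ext. Qed.

Lemma bop_adjM x y : badj (bmul x y) = bmul (badj y) (badj x).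
Proof. by apply: badj_eq; apply: adjoint_comp; exact: badjP. Qed.

Lemma bop_adjP a x y : badj (a *: x + y) = a^* *: badj x + badj y.
Proof. by apply: badj_eq; apply: adjoint_lin; exact: badjP. Qed.

Definition bop_cstarSpace : cstarSpace R :=
  CStarSpace bop_nrm0 bop_nrmD bop_nrmZ bop_mulA bop_mulPl bop_mulPr badjK
    bop_adjM bop_adjP bop_nrmM bop_cstar bop_complete.

Lemma subcstar_of_subalgebra (A : set (ell2 -> ell2)) : cstar_subalgebra A ->
  subcstar [set x : bop_cstarSpace | A (bop_fun x)].
Proof.
move=> [_ A0 AP AM [AA Acl]]; split.
- exact: A0.
- by move=> a x y; exact: AP.
- by move=> x y; exact: AM.
- by move=> x Ax; apply: AA Ax _ _; [exact: bop_bounded (badj x)|exact: badjP].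
- move=> x h; apply: Acl; split=> [|e e0]; first exact: bop_bounded.
  have [y Ay xy] := h e e0; exists (bop_fun y) => // f.
  apply: le_trans (bop_nrmP (x - y : bop) f) _.
  by rewrite ler_wpM2r ?l2norm_ge0.
Qed.

Section SubalgebraOps.
Variables (A : set (ell2 -> ell2)) (hA : cstar_subalgebra A).

Lemma subalgebraM x y : A x -> A y -> A (bmul x y).
Proof. exact: (subcstarM (subcstar_of_subalgebra hA)). Qed.

Lemma subalgebra_adj x : A x -> A (badj x).
Proof. exact: (subcstar_adj (subcstar_of_subalgebra hA)). Qed.

Lemma subalgebraB x y : A x -> A y -> A (x - y : bop).
Proof. exact: (subcstarB (subcstar_of_subalgebra hA)). Qed.

End SubalgebraOps.

(** * Norm closures of star-algebras of operators *)

Section Closure.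
Variable L : set (ell2 -> ell2).
Hypothesis Lb : L `<=` @bounded_op R X.
Hypothesis L0 : L (fun=> 0).
Hypothesis LP : forall a S T, L S -> L T -> L (fun f => a *: S f + T f).
Hypothesis LM : forall S T, L S -> L T -> L (S \o T).
Hypothesis LA : forall T, L T -> exists2 S, L S & adjoint_op T S.

Lemma alg_bop T : L T -> exists x : bop, bop_fun x = T.
Proof.
move=> LT; have [S LS h] := LA LT.
have AT : T \in adjointable by apply/adjointableP; split; [exact: Lb|exists S].
by exists (Bop AT).
Qed.

(** [T] is only known to be bounded. Its approximants in [L] have adjoints and form a Cauchy
    sequence, so they have an adjointable limit, which must be [T]. *)
Lemma op_closure_bop T : op_closure L T -> exists x : bop, bop_fun x = T.
Proof.
move=> [bT h].
have /choice[u hu] : forall n : nat, exists x : bop,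
    L x /\ forall f, l2norm (T f - x f) <= n.+1%:R^-1 * l2norm f.
  move=> n; have [|T' LT' hT'] := h (n.+1%:R^-1); first by rewrite invr_gt0.
  by have [x xE] := alg_bop LT'; exists x; rewrite xE.
have wlim (e : R) : 0 < e -> exists n, 2 * n.+1%:R^-1 <= e.
  move=> e0; have e2 : 0 < e / 2 by lra.
  have [n hn] := ltr_add_invr e2; exists n.
  by move: hn; rewrite add0r ltr_pdivlMr // mulrC => /ltW.
have [l hl] : exists l : bop, forall n, bnorm (u n - l) <= 2 * n.+1%:R^-1.
  apply: bop_complete => // n m nm; apply: opnorm_le; first by rewrite mulr_ge0.
  move=> f; rewrite -[(_ : bop) f]/(u m f - u n f).
  have -> : u m f - u n f = (T f - u n f) - (T f - u m f).
    by rewrite opprB [RHS]addrC addrA addrNK.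
  apply: le_trans (l2normB _ _) _; rewrite -mulrA mulr_natl mulr2n.
  apply: lerD; first by case: (hu n).
  case: (hu m) => _ /(_ f) /le_trans; apply; rewrite ler_wpM2r ?l2norm_ge0 //.
  by rewrite lef_pV2 ?posrE // ler_nat.
exists l; apply/funext => f; apply/eqP; rewrite eq_sym -subr_eq0.
apply/eqP/l2norm0_eq0/eqP; rewrite eq_le l2norm_ge0 andbT.
apply/ler_addgt0Pl => /= e e0; rewrite addr0.
have f1 : 0 < 2 * (l2norm f + 1) by have := l2norm_ge0 f; lra.
have [n hn] := wlim _ (divr_gt0 e0 f1).
have h1 := (hu n).2 f.
have h2 : l2norm (u n f - l f) <= 2 * n.+1%:R^-1 * l2norm f.
  apply: le_trans (bop_nrmP (u n - l : bop) f) _.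
  by rewrite ler_wpM2r ?l2norm_ge0.
have h3 := l2normD (T f - u n f) (u n f - l f); rewrite addrA subrK in h3.
apply: le_trans h3 _; apply: le_trans (lerD h1 h2) _.
move: hn; rewrite ler_pdivlMr //; apply: le_trans.
have k0 : 0 <= n.+1%:R^-1 :> R by rewrite invr_ge0.
by move: k0 (l2norm_ge0 f); move: n.+1%:R^-1 (l2norm f) => k F k0 /(mulr_ge0 k0); lra.
Qed.

Lemma op_closure_approx T e : op_closure L T -> 0 < e ->
  exists x y : bop, [/\ bop_fun x = T, L y & bnorm (x - y) <= e].
Proof.
move=> hT e0; have [x xE] := op_closure_bop hT.
have [T' LT' h] := hT.2 e e0; have [y yE] := alg_bop LT'.
exists x, y; split; rewrite ?yE //; apply: opnorm_le; first exact: ltW.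
by move=> f; rewrite -[(_ : bop) f]/(x f - y f) xE yE.
Qed.

Lemma op_closureP (x : bop) : op_closure L x <->
  forall e, 0 < e -> exists2 y : bop, L y & bnorm (x - y) <= e.
Proof.
split=> [hx e e0|h].
  have [x' [y [x'E Ly h]]] := op_closure_approx hx e0.
  have E : x' = x by apply: bop_ext => f; rewrite x'E.
  by rewrite -E; exists y; [exact: Ly|exact: h].
split=> [|e e0]; first exact: bop_bounded.
have [y Ly xy] := h e e0; exists (bop_fun y) => // f.
apply: le_trans (bop_nrmP (x - y : bop) f) _.
by rewrite ler_wpM2r ?l2norm_ge0.
Qed.

Lemma sub_op_closure : L `<=` op_closure L.
Proof.
move=> T LT; split=> [|e e0]; first exact: Lb.
by exists T => // f; rewrite subrr l2norm0 mulr_ge0 ?l2norm_ge0 // ltW.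
Qed.

Lemma op_closure_cstar : cstar_subalgebra (op_closure L).
Proof.
pose LB := [set x : bop_cstarSpace | L (bop_fun x)].
have hcl : subcstar [set x : bop_cstarSpace |
    forall e, 0 < e -> exists2 y, LB y & nrm (x - y) <= e].
  apply: closure_subcstar => [|a x y|x y|x /LA[S LS xS]]; rewrite ?/LB /=.
  - exact: L0.
  - exact: LP.
  - exact: LM.
  - have [y yE] := alg_bop LS; have E : badj x = y by apply: badj_eq; rewrite yE.
    by suff : L (badj x) by []; rewrite E yE.
split.
- by move=> T [].
- exact: sub_op_closure.
- move=> c S T hS hT; have [x xE] := op_closure_bop hS; have [y yE] := op_closure_bop hT.
  rewrite -xE -yE in hS hT *; apply/(op_closureP (c *: x + y)).
  by apply: (subcstarP hcl); apply/op_closureP.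
- move=> S T hS hT; have [x xE] := op_closure_bop hS; have [y yE] := op_closure_bop hT.
  rewrite -xE -yE in hS hT *; apply/(op_closureP (bmul x y)).
  by apply: (subcstarM hcl); apply/op_closureP.
split.
- move=> S T hS _ ST; have [x xE] := op_closure_bop hS.
  rewrite -xE in hS ST; have -> : T = badj x by exact: adjoint_uniq ST (badjP x).
  by apply/op_closureP; apply: (subcstar_adj hcl); apply/op_closureP.
- move=> T [bT hT]; split=> // e e0; have [|T' hT' TT'] := hT (e / 2); first lra.
  have [|T'' LT'' T'T''] := hT'.2 (e / 2); first lra.
  exists T'' => // f; have := l2normD (T f - T' f) (T' f - T'' f).
  rewrite addrA subrK => /le_trans; apply.
  by apply: le_trans (lerD (TT' f) (T'T'' f)) _; rewrite -mulrDl -splitr.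
Qed.

End Closure.
End Ops.

(** * *-homomorphisms into an abstract C*-algebra *)

Section CstarAlgebra.
Variables (R : realType) (B : cstarAlgebra R).
Local Notation C := (cplx R).
Implicit Types (x y : B) (a : C).

Definition bnrm x : R := complex.Re `|x|.

Lemma bnrmE x : `|x| = (bnrm x)%:C%C.
Proof. by rewrite /bnrm RRe_real // normr_real. Qed.

Lemma bnrm0_eq0 x : bnrm x = 0 -> x = 0.
Proof. by move=> x0; apply/eqP; rewrite -normr_eq0 bnrmE x0. Qed.

Lemma bnrmD x y : bnrm (x + y) <= bnrm x + bnrm y.
Proof. by rewrite -lecR rmorphD /= -!bnrmE ler_normD. Qed.

Lemma bnrmZ a x : bnrm (a *: x) = cabs a * bnrm x.
Proof. by apply: (@complexI R); rewrite rmorphM /= -!bnrmE -cabsE normrZ. Qed.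

Lemma bnrmM x y : bnrm (cmul x y) <= bnrm x * bnrm y.
Proof. by rewrite -lecR rmorphM /= -!bnrmE cnormM. Qed.

Lemma bnrm_cstar x : bnrm (cmul (cadj x) x) = bnrm x ^+ 2.
Proof. by apply: (@complexI R); rewrite rmorphXn /= -!bnrmE cnorm_cstar. Qed.

Lemma bnrm_complete (u : nat -> B) (w : nat -> R) :
  (forall e, 0 < e -> exists n, w n <= e) ->
  (forall n m, (n <= m)%N -> bnrm (u m - u n) <= w n) ->
  exists l, forall n, bnrm (u n - l) <= w n.
Proof.
move=> wlim h.
have ReC (e : C) : 0 < e -> 0 < complex.Re e /\ e = (complex.Re e)%:C%C.
  move=> e0; rewrite RRe_real ?gtr0_real //; split=> //.
  by move: e0; rewrite ltcE => /andP[].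
have cv : cvg (u @ \oo).
  apply: cauchy_cvg; apply/cauchyP => e /ReC[e0 ->].
  have [n hn] : exists n, w n <= complex.Re e / 2 by apply: wlim; lra.
  exists (u n); exists n => // m /= nm.
  rewrite -ball_normE /ball_ /= bnrmE ltcR.
  by rewrite -opprB /bnrm normrN -/(bnrm _); have := h n m nm; lra.
exists (lim (u @ \oo)) => n; apply/ler_addgt0Pl => e e0.
have /cvgrPdist_le /(_ (e%:C%C : C)) := cv; rewrite ltcR => /(_ e0)[N _ hN].
have := hN (maxn n N) (leq_maxr _ _); rewrite /= bnrmE lecR => h1.
have := h n (maxn n N) (leq_maxl _ _) => h2.
set k := maxn n N in h1 h2 *.
have -> : u n - lim (u @ \oo) = - ((lim (u @ \oo) - u k) + (u k - u n)).
  by rewrite addrA subrK opprB.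
rewrite /bnrm normrN -/(bnrm _); apply: le_trans (bnrmD _ _) _.
by rewrite lerD.
Qed.

Definition cstarAlgebra_cstarSpace : cstarSpace R :=
  CStarSpace bnrm0_eq0 bnrmD bnrmZ (@cmulA _ B) (@cmul_linearl _ B)
    (@cmul_linearr _ B) (@cadjK _ B) (@cadjM _ B) (@cadj_antilinear _ B)
    bnrmM bnrm_cstar bnrm_complete.

Variables (X : choiceType) (A D : set (ell2 R X -> ell2 R X)).
Variable pi : (ell2 R X -> ell2 R X) -> B.
Hypothesis hA : cstar_subalgebra A.
Hypothesis A1 : A id.
Hypothesis hpi : star_hom A pi.

Lemma star_homP (c : C) (x y : bop R X) : A x -> A y ->
  pi (c *: x + y : bop R X) = c *: pi x + pi y.
Proof. by case: hpi => h _ _; exact: h. Qed.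

Lemma star_homM (x y : bop R X) : A x -> A y -> pi (bmul x y) = cmul (pi x) (pi y).
Proof. by case: hpi => _ h _; exact: h. Qed.

Lemma star_homA (x : bop R X) : A x -> pi (badj x) = cadj (pi x).
Proof.
case: hpi => _ _ h Ax; apply: h => //; last exact: badjP.
exact: (subcstar_adj (subcstar_of_subalgebra hA) Ax).
Qed.

Lemma id_adjointable : id \in @adjointable R X.
Proof.
apply/adjointableP; split; last by exists id.
by split=> //; exists 1 => f; rewrite mul1r.
Qed.

Definition bop_id : bop R X := Bop id_adjointable.

Lemma star_hom_contr (x : bop R X) : A x -> bnrm (pi x) <= bnorm x.
Proof.
move=> Ax.
apply: (@hom_contr R (bop_cstarSpace R X) cstarAlgebra_cstarSpace
  [set x : bop R X | A x] bop_id (subcstar_of_subalgebra hA) A1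
  _ _ (fun x : bop R X => pi x) _ _ _ x Ax).
- by move=> z _; exact: bop_ext.
- by move=> z _; exact: bop_ext.
- by move=> c z t; exact: star_homP.
- by move=> z t; exact: star_homM.
- by move=> z; exact: star_homA.
Qed.

Hypothesis hD : cstar_subalgebra D.
Hypothesis D1 : D id.
Hypothesis DA : D `<=` A.
Hypothesis pi_inj : set_inj D pi.

Lemma star_hom_isometry (x : bop R X) : D x -> bnrm (pi x) = bnorm x.
Proof.
move=> Dx.
apply: (@inj_hom_isometry R (bop_cstarSpace R X) cstarAlgebra_cstarSpace
  [set x : bop R X | D x] bop_id (subcstar_of_subalgebra hD) D1
  _ _ (fun x : bop R X => pi x) _ _ _ _ x Dx).
- by move=> z _; exact: bop_ext.
- by move=> z _; exact: bop_ext.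
- by move=> c z t /DA Az /DA At; exact: star_homP.
- by move=> z t /DA Az /DA At; exact: star_homM.
- by move=> z /DA; exact: star_homA.
- move=> z Dz z0; apply: bop_ext => f.
  have D0 : D (fun=> 0) by case: hD.
  have pi0 : pi (fun=> 0) = 0.
    have := @star_homP (-1) 0 0 (DA D0) (DA D0).
    by rewrite scaler0 addr0 scaleN1r addNr.
  have -> // : bop_fun z = (fun=> 0).
  apply: pi_inj; [exact/mem_set|exact/mem_set|].
  by rewrite -[RHS]/(pi (fun=> 0)) [RHS]pi0.
Qed.

End CstarAlgebra.

(** * Filters and the tight spectrum *)

Section Spectrum.
Local Open Scope group_scope.
Variable P : rightLCMType.
Implicit Types (p q x y z : P) (s t : isg P) (e f : idemS P).
Implicit Types (xi eta : {ptws idemS P -> bool}).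

Lemma acts_cancel s x x' y : acts s x y -> acts s x' y -> x = x'.
Proof. by move=> /acts_star h /acts_star h'; exact: acts_fun h h'. Qed.

(** Membership in the right ideal identified with [e]. Computations with idempotents are reduced to
    it through [emem_ext] and [eleP]. *)
Definition emem e x := acts (val e) x x.

Lemma emem_acts e x y : acts (val e) x y <-> x = y /\ emem e x.
Proof.
have /idemP he := idemSP e; split=> [h|[<-]//].
by have yx := he _ _ h; subst y.
Qed.

Lemma emem_ext e f : (forall x, emem e x <-> emem f x) -> e = f.
Proof.
move=> h; apply/val_inj/acts_inj => x y.
by rewrite !emem_acts; split=> -[-> /h].
Qed.

Lemma emem_emul e f x : emem (emul e f) x <-> emem e x /\ emem f x.
Proof.
rewrite /emem /= acts_mul; split=> [[z /emem_acts[<- ?]]|[? ?]] //.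
by exists x.
Qed.

Lemma eleP e f : ele (val e) (val f) <-> forall x, emem e x -> emem f x.
Proof.
split=> [h x|h].
  by rewrite /emem -{1}h => /acts_mul[z /emem_acts[<-]].
apply: acts_inj => x y; rewrite acts_mul; split.
  by move=> [z /emem_acts[<- _]].
by move=> /emem_acts[<- ex]; exists x => //; exact: h.
Qed.

Lemma emem_None e : val e = None <-> forall x, ~ emem e x.
Proof.
split=> [h x|h]; first by rewrite /emem h.
have [//|[p pE]] := idemSP e; exfalso; apply: (h p).
by rewrite /emem pE; apply/acts_br; exists 1; rewrite mulg1.
Qed.

Lemma emem_notNone e : val e <> None -> exists x, emem e x.
Proof. by move=> h; apply: contrapT => /forallNP /emem_None. Qed.

Lemma emem_isrc s x : emem (isrc s) x <-> exists y, acts s x y.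
Proof.
rewrite /emem /= acts_mul; split=> [[y]|[y xy]]; first by exists y.
by exists y => //; exact/acts_star.
Qed.

Lemma emem_ebr p x : emem (ebr p) x <-> exists w, x = p * w.
Proof. by rewrite /emem -[val _]/(br p p) acts_br; split=> [[w [-> _]]|[w ->]]; exists w. Qed.

Lemma emem_ebr1 x : emem (ebr 1) x.
Proof. by apply/emem_ebr; exists x; rewrite mul1g. Qed.

Lemma idem_pull s e : idem (istar s * val e * s).
Proof.
apply/idemP => x y; rewrite -mulgA acts_mul => -[z + /acts_star yz].
rewrite acts_mul => -[z' xz' /emem_acts[z'z _]]; subst z'.
exact: acts_cancel yz xz'.
Qed.

(** The preimage of the ideal [e] under the partial bijection [s]. By [theta_pull] the action on
    filters is membership of the preimage, which is easier to handle than the upward closure in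
    [theta]. *)
Definition epull s e : idemS P := mk_idem (idem_pull s e).

Lemma emem_epull s e x : emem (epull s e) x <-> exists2 y, acts s x y & emem e y.
Proof.
rewrite /emem /= -mulgA acts_mul; split=> [[z /acts_mul[y xy /emem_acts[yz ey]] _]|[y xy ey]].
  by exists y.
by exists y; [apply/acts_mul; exists y|exact/acts_star].
Qed.

Lemma epull1 s : epull s (ebr 1) = isrc s.
Proof.
apply: emem_ext => x; rewrite emem_epull emem_isrc.
by split=> [[y]|[y]]; exists y => //; exact: emem_ebr1.
Qed.

Lemma epullM s e f : epull s (emul e f) = emul (epull s e) (epull s f).
Proof.
apply: emem_ext => x; rewrite emem_emul !emem_epull; split.
  by move=> [y xy /emem_emul[? ?]]; split; exists y.
move=> [[y xy ey] [y' xy' fy]]; rewrite -(acts_fun xy xy') in fy.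
by exists y => //; exact/emem_emul.
Qed.

Lemma epullK s e : epull (istar s) (epull s e) = emul e (isrc (istar s)).
Proof.
apply: emem_ext => y; rewrite emem_emul emem_isrc emem_epull; split.
  by move=> [x yx /emem_epull[z xz ez]]; move/acts_star: (yx) => /(acts_fun xz) <-; split=> //;
     exists x; apply/acts_star.
by move=> [ey [x yx]]; exists x => //; apply/emem_epull; exists y => //; exact/acts_star.
Qed.

Lemma istarK s : istar (istar s) = s.
Proof. by apply: acts_inj => x y; rewrite !acts_star. Qed.

Section Filter.
Variable xi : {ptws idemS P -> bool}.
Hypothesis fxi : efilter xi.

Lemma filter_up e f : xi e -> (forall x, emem e x -> emem f x) -> xi f.
Proof. by case: fxi => _ _ _ up xe /eleP; exact: up xe. Qed.

Lemma filter_mul e f : xi e -> xi f -> xi (emul e f).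
Proof. by case: fxi => _ _ h _; exact: h. Qed.

Lemma filter_mulE e f : xi (emul e f) = xi e && xi f.
Proof.
apply/idP/andP => [h|[]]; last exact: filter_mul.
by split; apply: (filter_up h) => x /emem_emul[].
Qed.

Lemma filter1 : xi (ebr 1).
Proof. by case: fxi => -[e xe] _ _ _; apply: (filter_up xe) => x _; exact: emem_ebr1. Qed.

Lemma filter_mem e : xi e -> exists x, emem e x.
Proof. by case: fxi => _ nz _ _ /nz; exact: emem_notNone. Qed.

Lemma filter_pull s : xi (isrc s) -> efilter (fun e => xi (epull s e)).
Proof.
move=> xs; split.
- by exists (ebr 1); rewrite epull1.
- by move=> e /filter_mem[x /emem_epull[y _ ey]] /emem_None /(_ y).
- by move=> e f xe xf; rewrite epullM; exact: filter_mul.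
- move=> e f xe /eleP ef; apply: (filter_up xe) => x /emem_epull[y xy /ef ey].
  by apply/emem_epull; exists y.
Qed.

Definition efold (F : seq (idemS P)) : idemS P := foldr (@emul P) (ebr 1) F.

Lemma emem_efold F x : emem (efold F) x <-> forall f, f \in F -> emem f x.
Proof.
elim: F => [|f F IH] /=; first by split=> // _; exact: emem_ebr1.
rewrite emem_emul IH; split=> [[fx h] g|h].
  by rewrite inE => /predU1P[->//|/h].
by split=> [|g gF]; apply: h; rewrite inE ?eqxx ?gF ?orbT.
Qed.

Lemma filter_efold F : (forall f, f \in F -> xi f) -> xi (efold F).
Proof.
elim: F => [|f F IH] h /=; first exact: filter1.
apply: filter_mul; first by apply: h; rewrite inE eqxx.
by apply: IH => g gF; apply: h; rewrite inE gF orbT.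
Qed.

End Filter.

(** Otherwise every member of [xi] meets [f], and [xi] together with [f] generates a strictly larger
    filter. *)
Lemma ultra_notin xi f : eultra xi -> ~~ xi f ->
  exists2 e, xi e & forall x, emem e x -> ~ emem f x.
Proof.
move=> [fxi mxi] xf; apply: contrapT => /forall2NP h.
have h' e : xi e -> exists x, emem e x /\ emem f x.
  move=> xe; have [//|/existsNP[x /not_implyP[ex /contrapT fx]]] := h e.
  by exists x.
pose eta : {ptws idemS P -> bool} :=
  fun g => `[< exists2 e, xi e & forall x, emem e x -> emem f x -> emem g x >].
have feta : efilter eta.
  split.
  - by exists (ebr 1); apply/asboolP; exists (ebr 1); [exact: filter1|move=> *; exact: emem_ebr1].
  - move=> g /asboolP[e /h'[x [ex fx]] eg] /emem_None /(_ x); apply; exact: eg.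
  - move=> g k /asboolP[e xe eg] /asboolP[e' xe' ek]; apply/asboolP.
    exists (emul e e'); first exact: filter_mul.
    by move=> x /emem_emul[ex e'x] fx; apply/emem_emul; split; [exact: eg|exact: ek].
  - move=> g k /asboolP[e xe eg] /eleP gk; apply/asboolP; exists e => // x ex fx.
    by apply: gk; exact: eg.
move: xf; rewrite -(mxi eta feta) => [|e xe]; last by apply/asboolP; exists e.
by move/asboolP; apply; exists (ebr 1); [exact: filter1|].
Qed.

(** A filter above the transported one is carried back by [istar s] to a filter above [xi], hence to
    [xi] itself; transporting once more gives equality. *)
Lemma ultra_pull xi s : eultra xi -> xi (isrc s) -> eultra (fun e => xi (epull s e)).
Proof.
move=> [fxi mxi] xs; split; first exact: filter_pull.
move=> eta feta sub.
have es : eta (isrc (istar s)).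
  apply: sub; apply: (filter_up fxi xs) => x /emem_isrc[y xy].
  apply/emem_epull; exists y => //; apply/emem_isrc; exists x; exact/acts_star.
have E : (fun e => eta (epull (istar s) e)) = xi.
  apply: mxi; first exact: filter_pull.
  move=> e xe; apply: sub; rewrite -{1}(istarK s) epullK istarK.
  exact: filter_mul.
apply/funext => e; rewrite -E epullK filter_mulE //.
by rewrite es andbT.
Qed.

Lemma nbhs_agree xi (F : seq (idemS P)) :
  nbhs xi [set eta : {ptws idemS P -> bool} | forall f, f \in F -> eta f = xi f].
Proof.
elim: F => [|f F IH]; first by apply: filterS filterT => eta _ g; rewrite in_nil.
have : nbhs xi [set eta : {ptws idemS P -> bool} | eta f = xi f].
  have c : continuous (fun eta : {ptws idemS P -> bool} => eta f).
    exact: (@proj_continuous _ (fun=> bool) f).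
  apply: (c xi [set b | b = xi f]); apply: open_nbhs_nbhs; split=> //.
  exact: discrete_open.
move=> /filterI /(_ IH); apply: filterS => eta [ef eF] g.
by rewrite inE => /predU1P[->|/eF].
Qed.

(** The product topology is a supremum of coordinate topologies, and the filter generated by the
    sets of finite agreement with [xi] converges to [xi] in each of them. *)
Lemma nbhs_ptws xi (A : set {ptws idemS P -> bool}) : nbhs xi A ->
  exists F : seq (idemS P), forall eta : {ptws idemS P -> bool},
    (forall f, f \in F -> eta f = xi f) -> A eta.
Proof.
pose B (F : seq (idemS P)) :=
  [set eta : {ptws idemS P -> bool} | forall f, f \in F -> eta f = xi f].
pose FF := filter_from [set: seq (idemS P)] B.
have fF : Filter FF.
  apply: filter_fromT_filter; first by exists [::].
  move=> F G; exists (F ++ G) => eta h; split=> f fF; apply: h;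
    by rewrite mem_cat fF ?orbT.
have : FF --> xi.
  apply/cvg_sup => e U [V [[W oW <-] Wxi] WU].
  exists [:: e] => // eta h; apply: WU; rewrite /= h ?inE //.
by move=> h /h[F _ hF]; exists F.
Qed.

Lemma closure_ultraP xi : closure (@eultra P) xi <->
  forall F : seq (idemS P), exists2 eta, eultra eta & forall f, f \in F -> eta f = xi f.
Proof.
split=> [h F|h A /nbhs_ptws[F hF]].
  by have [eta [? ?]] := h _ (nbhs_agree xi F); exists eta.
by have [eta ? /hF ?] := h F; exists eta.
Qed.

Lemma theta_pull s (xi : tspec P) : tspec_mem xi (isrc s) ->
  theta s xi = (fun e => tspec_mem xi (epull s e)).
Proof.
move=> xs; apply/funext => e; apply/asboolP/idP.
  move=> [f xf h]; have fx := tspec_filter xi.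
  apply: (filter_up fx (filter_mul fx xf xs)) => x /emem_emul[fx' /emem_isrc[y xy]].
  apply/emem_epull; exists y => //.
  have : acts (s * val f * istar s) y y.
    by apply/acts_mul; exists x; [exact/acts_star|apply/acts_mul; exists x].
  by rewrite -h => /acts_mul[z /emem_acts[]].
move=> h; exists (epull s e) => //; apply: acts_inj => x y; rewrite acts_mul.
split=> [[z /emem_acts[<- _]]|] //.
move=> /[dup] xy /acts_mul[z /acts_star zx _]; exists x => //; apply/emem_acts.
have /acts_mul[z' /acts_star z'x /acts_mul[z'' /emem_acts[_ ez'] _]] := xy.
by move/emem_epull: ez' => [y' /(acts_fun z'x) <-].
Qed.

Lemma tight_pull s (xi : tspec P) : tspec_mem xi (isrc s) ->
  tight (fun e => tspec_mem xi (epull s e)).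
Proof.
move=> xs; split; first exact: (filter_pull (tspec_filter xi)).
apply/closure_ultraP => F.
(* Agreement at [isrc s] puts the ultrafilter in the domain of [s]; agreement at the preimages
   becomes agreement on [F] after transport. *)
have [_ /closure_ultraP/(_ (isrc s :: map (epull s) F))[eta ue h]] := set_valP xi.
exists (fun e => eta (epull s e)).
  by apply: ultra_pull => //; rewrite h ?inE ?eqxx.
by move=> f fF; apply: h; rewrite inE map_f ?orbT.
Qed.

Definition tpull s (xi : tspec P) (h : tspec_mem xi (isrc s)) : tspec P :=
  SigSub (mem_set (tight_pull h)).

Lemma val_tpull s (xi : tspec P) (h : tspec_mem xi (isrc s)) : val (tpull h) = theta s xi.
Proof. by rewrite theta_pull. Qed.

Lemma ultra_tight xi : eultra xi -> tight xi.
Proof. by move=> u; split; [case: u|exact: subset_closure]. Qed.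

Definition tspec_ultra xi (h : eultra xi) : tspec P := SigSub (mem_set (ultra_tight h)).

(* Tightness constrains finitely many idempotents at a time, so it is a closed condition. *)
Lemma tight_agree xi :
  (forall F : seq (idemS P), exists2 eta, tight eta & forall f, f \in F -> eta f = xi f) ->
  tight xi.
Proof.
move=> h.
have h1 e : exists2 eta, tight eta & eta e = xi e.
  by have [eta te he] := h [:: e]; exists eta => //; apply: he; rewrite inE.
split; last first.
  apply/closure_ultraP => F; have [eta [_ /closure_ultraP/(_ F)[z uz hz]] he] := h F.
  by exists z => // f fF; rewrite hz ?he.
split.
- by have [eta [fe _] he] := h1 (ebr 1); exists (ebr 1); rewrite -he; exact: filter1.
- by move=> e; have [eta [[_ nz _ _] _] <-] := h1 e; exact: nz.
- move=> e f; have [eta [fe _] he] := h [:: e; f; emul e f].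
  rewrite -!he ?inE ?eqxx ?orbT //; exact: filter_mul.
- move=> e f; have [eta [[_ _ _ up] _] he] := h [:: e; f].
  rewrite -!he ?inE ?eqxx ?orbT //; exact: up.
Qed.

Lemma ptws_compact : compact [set: {ptws idemS P -> bool}].
Proof.
have -> : [set: {ptws idemS P -> bool}] = [set f | forall i, [set: bool] (f i)].
  by apply/seteqP; split.
apply: (@tychonoff (idemS P) (fun=> bool) (fun=> setT)) => _.
exact: bool_compact.
Qed.

Lemma tight_compact e : compact [set xi | tight xi /\ xi e].
Proof.
apply: (subclosed_compact _ ptws_compact) => //.
move=> xi hxi.
have h (F : seq (idemS P)) : exists2 eta, tight eta &
    [/\ eta e & forall f, f \in F -> eta f = xi f].
  by have [eta [[te ee] he]] := hxi _ (nbhs_agree xi F); exists eta.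
split; first by apply: tight_agree => F; have [eta ? []] := h F; exists eta.
by have [eta _ [ee <-]] := h [:: e]; rewrite ?inE.
Qed.

Lemma ultra_ex p : exists2 xi, eultra xi & xi (ebr p).
Proof.
pose base e := forall x, emem (ebr p) x -> emem e x.
(* [Zorn_bigcup] asks for unions of all chains, the empty one included. Adjoining the principal
   filter of [ebr p] makes the empty union give a filter, and keeps [ebr p] in the maximal one. *)
pose Fil (A : set (idemS P)) : {ptws idemS P -> bool} := fun e => `[< A e \/ base e >].
have pp : emem (ebr p) p by apply/emem_ebr; exists 1; rewrite mulg1.
have fbase : efilter (fun e => `[< base e >]).
  split.
  - by exists (ebr p); apply/asboolP.
  - by move=> e /asboolP/(_ _ pp) ? /emem_None /(_ p).
  - move=> e f /asboolP be /asboolP bf; apply/asboolP => x px.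
    by apply/emem_emul; split; [exact: be|exact: bf].
  - move=> e f /asboolP be /eleP ef; apply/asboolP => x px; exact/ef/be.
have [|A [fA maxA]] := @Zorn_bigcup (idemS P) [set A | efilter (Fil A)].
  move=> F FP tot.
  have cover e : Fil (\bigcup_(X in F) X) e -> base e \/ exists2 A, F A & A e.
    by move=> /asboolP[[A FA Ae]|be]; [right; exists A|left].
  have inF A e : F A -> Fil A e -> Fil (\bigcup_(X in F) X) e.
    by move=> FA /asboolP[Ae|be]; apply/asboolP; [left; exists A|right].
  have baseF A e : base e -> Fil A e by move=> be; apply/asboolP; right.
  have memF A e : A e -> Fil A e by move=> Ae; apply/asboolP; left.
  split.
  - by exists (ebr p); apply: baseF.
  - move=> e /cover[be|[A FA Ae]].
      by case: fbase => _ nz _ _; apply: nz; apply/asboolP.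
    by case: (FP _ FA) => _ nz _ _; apply: nz; exact: memF.
  - move=> e f /cover he /cover hf.
    have [|[A FA [Ae Af]]] : base (emul e f) \/ exists2 A, F A & Fil A e /\ Fil A f.
      case: he => [be|[A FA Ae]]; case: hf => [bf|[B FB Bf]].
      + left; case: fbase => _ _ m _; apply/asboolP/m; exact/asboolP.
      + by right; exists B => //; split; [exact: baseF|exact: memF].
      + by right; exists A => //; split; [exact: memF|exact: baseF].
      + have [AB|BA] := tot _ _ FA FB.
          by right; exists B => //; split; apply: memF => //; exact: AB.
        by right; exists A => //; split; apply: memF => //; exact: BA.
      by move=> h; exact: baseF.
    by apply: (inF A) => //; case: (FP _ FA) => _ _ m _; exact: m.
  - move=> e f /cover[be|[A FA Ae]] ef.
      by apply: baseF; case: fbase => _ _ _ up; apply/asboolP/(up e) => //; exact/asboolP.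
    by apply: (inF A) => //; case: (FP _ FA) => _ _ _ up; apply: up ef; exact: memF.
exists (Fil A); last by apply/asboolP; right.
split=> // eta feta sub; apply/funext => e; apply/idP/idP; last exact: sub.
move=> ee; apply: contrapT => nAe.
have [] := maxA [set e | eta e].
  split=> [f Af|/(_ e ee) Ae]; first by apply: sub; apply/asboolP; left.
  by apply: nAe; apply/asboolP; left.
suff E : Fil [set e | eta e] = eta by have : efilter (Fil [set e | eta e]) by rewrite E.
apply/funext => f; apply/asboolP/idP => [[//|bf]|]; last by left.
by apply: sub; apply/asboolP; right.
Qed.

End Spectrum.

(** * Condition (H) and the action on germs *)

Section Germs.
Local Open Scope group_scope.
Variable P : rightLCMType.
Implicit Types (p q x y z : P) (s t : isg P) (e f : idemS P).
Implicit Types (xi eta : tspec P) (g h k : germ P).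

Lemma fixsetP s e : Defs.fixset s e <-> forall x, emem e x -> acts s x x.
Proof.
split=> [E x ex|h].
  have : acts (val e) x x by [].
  by rewrite -E => /acts_mul[z /emem_acts[<-]].
apply: acts_inj => x y; rewrite acts_mul emem_acts; split.
  by move=> [z /emem_acts[<- ex]] sxy; split=> //; exact: acts_fun (h _ ex) sxy.
by move=> [<- ex]; exists x; [exact/emem_acts|exact: h].
Qed.

Lemma acts_agree s t e : s * val e = t * val e <->
  forall x y, emem e x -> (acts s x y <-> acts t x y).
Proof.
split=> [E x y ex|h].
  have H r : acts (r * val e) x y <-> acts r x y.
    by rewrite acts_mul; split=> [[z /emem_acts[<-]]|] //; exists x => //; exact/emem_acts.
  by rewrite -H E H.
apply: acts_inj => x y; rewrite !acts_mul.
by split=> -[z /emem_acts[<- ex] /(h _ _ ex)]; exists x => //; exact/emem_acts.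
Qed.

Section CondH.
Hypothesis hH : condH P.

Lemma condH_seq s : exists F : seq (idemS P), (forall f, f \in F -> Defs.fixset s f) /\
  forall e, Defs.fixset s e -> (exists x, emem e x) ->
    exists2 f, f \in F & exists x, emem e x /\ emem f x.
Proof.
have [F [/finite_seqP[r ->] Fs hF]] := hH s; exists r; split=> [f fr|e es [x ex]].
  exact: Fs.
have [|f fr ef] := hF e es; first by move/emem_None => /(_ x).
exists f => //; have /emem_notNone[z /emem_emul ez] : val (emul e f) <> None by [].
by exists z.
Qed.

(* If an ultrafilter contains e and avoids F, then intersecting e with members disjoint from
   each f in F gives a nonzero idempotent fixed by s that F does not meet. *)
Lemma condH_tight s : exists F : seq (idemS P), (forall f, f \in F -> Defs.fixset s f) /\
  (forall xi e, Defs.fixset s e -> tspec_mem xi e -> exists2 f, f \in F & tspec_mem xi f) /\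
  forall e, Defs.fixset s e -> (exists x, emem e x) ->
    exists2 f, f \in F & exists x, emem e x /\ emem f x.
Proof.
have [F [Fs hF]] := condH_seq s; exists F; do 2?split=> //.
move=> xi e es xe; apply: contrapT => /forall2NP h.
have [_ /closure_ultraP/(_ (e :: F))[eta ueta he]] := set_valP xi.
have feta : efilter eta by case: ueta.
have etae : eta e by rewrite he ?inE ?eqxx.
have etaF f : f \in F -> ~~ eta f.
  move=> fF; rewrite he ?inE ?fF ?orbT //; apply/negP => xf.
  by have [] := h f.
have [c hc] : exists c, forall f, f \in F ->
    eta (c f) /\ forall x, emem (c f) x -> ~ emem f x.
  suff /choice[c hc] : forall f, exists e', f \in F ->
    eta e' /\ forall x, emem e' x -> ~ emem f x by exists c.
  move=> f; have [fF|] := boolP (f \in F); last by exists e.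
  by have [e' ? ?] := ultra_notin ueta (etaF f fF); exists e'.
pose e1 := emul e (efold (map c F)).
have etae1 : eta e1.
  apply: filter_mul => //; apply: filter_efold => // _ /mapP[f fF ->].
  by have [] := hc f fF.
have e1s : Defs.fixset s e1.
  by apply/fixsetP => x /emem_emul[ex _]; move/fixsetP: es; apply.
have [f fF [x [/emem_emul[_ /emem_efold cx] fx]]] := hF e1 e1s (filter_mem feta etae1).
have [_ /(_ x)] := hc f fF; apply => //.
by apply: cx; exact: map_f.
Qed.

(** The germs of [s] and [t] at [xi] coincide exactly when [istar s * t] fixes some member of [xi];
    condition (H) replaces this by membership of one of finitely many idempotents. *)
Lemma condH_agree s t : exists F : seq (idemS P), forall xi,
  tspec_mem xi (isrc s) -> tspec_mem xi (isrc t) ->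
  ((exists2 e, tspec_mem xi e & s * val e = t * val e) <->
   exists2 f, f \in F & tspec_mem xi f).
Proof.
have [F [Fs [hF _]]] := condH_tight (istar s * t); exists F => xi xs xt; split.
  move=> [e xe /acts_agree E]; apply: (hF xi (emul e (isrc s))); last first.
    exact: (filter_mul (tspec_filter xi)).
  apply/fixsetP => x /emem_emul[ex /emem_isrc[y sxy]]; apply/acts_mul.
  by exists y; [exact/E|exact/acts_star].
move=> [f /Fs/fixsetP sf xf]; exists f => //; apply/acts_agree => x y fx.
have /acts_mul[z txz /acts_star sxz] := sf x fx.
by split=> [/(acts_fun sxz)|/(acts_fun txz)] <-.
Qed.

End CondH.

Lemma theta_germ s t xi eta (hs : tspec_mem xi (isrc s)) (ht : tspec_mem eta (isrc t)) :
  mk_germ hs = mk_germ ht -> theta s xi = theta t eta.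
Proof.
move=> /mk_germ_eq[E [e xe /acts_agree ste]]; subst eta.
rewrite !theta_pull //; apply/funext => f.
have fx := tspec_filter xi.
suff H r r' : tspec_mem xi (epull r f) ->
    (forall x y, emem e x -> (acts r x y <-> acts r' x y)) -> tspec_mem xi (epull r' f).
  by apply/idP/idP => /H; apply => // x y /ste ->.
move=> xr rr'; apply: (filter_up fx (filter_mul fx xe xr)) => x.
move=> /emem_emul[ex /emem_epull[y /(rr' _ _ ex) ? ?]].
by apply/emem_epull; exists y.
Qed.

(** Left translation [t, xi] |-> [s t, xi], a partial injection of the germs that preserves sources;
    [gact_Some] and [gact_None] make it independent of the representative. *)
Definition gact s g : option (germ P) :=
  let x := val (repr g) in
  if pselect (tspec_mem x.2 (isrc (s * x.1))) is left h then Some (mk_germ h) else None.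

Lemma repr_germ g : exists t xi (h : tspec_mem xi (isrc t)),
  [/\ val (repr g) = (t, xi) & g = mk_germ h].
Proof.
rewrite -{2}[g]reprK; case: (repr g) => -[t xi] h.
by exists t, xi, h.
Qed.

Lemma isrc_agree s t t' e x : t * val e = t' * val e -> emem e x ->
  emem (isrc (s * t)) x -> emem (isrc (s * t')) x.
Proof.
move=> /acts_agree E ex /emem_isrc[y /acts_mul[z /(E _ _ ex) tz sz]].
by apply/emem_isrc; exists y; apply/acts_mul; exists z.
Qed.

Lemma gact_Some s t xi (h : tspec_mem xi (isrc t)) (k : tspec_mem xi (isrc (s * t))) :
  gact s (mk_germ h) = Some (mk_germ k).
Proof.
rewrite /gact; have [t' [xi' [h' [-> E]]]] := repr_germ (mk_germ h).
have /mk_germ_eq[xx [e xe te]] := E; subst xi'.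
case: pselect => /= [k'|nk'].
  congr Some; apply/mk_germ_eq; split=> //; exists e => //.
  by rewrite -!mulgA te.
case: nk'; have fx := tspec_filter xi.
apply: (filter_up fx (filter_mul fx xe k)) => x /emem_emul[ex].
exact: (isrc_agree te ex).
Qed.

Lemma gact_None s t xi (h : tspec_mem xi (isrc t)) :
  ~~ tspec_mem xi (isrc (s * t)) -> gact s (mk_germ h) = None.
Proof.
move=> /negP nk; rewrite /gact; have [t' [xi' [h' [-> E]]]] := repr_germ (mk_germ h).
have /mk_germ_eq[xx [e xe te]] := E; subst xi'.
case: pselect => //= k'; case: nk; have fx := tspec_filter xi.
apply: (filter_up fx (filter_mul fx xe k')) => x /emem_emul[ex].
exact: (isrc_agree (esym te) ex).
Qed.

Lemma isrc_mul_sub s t x : emem (isrc (s * t)) x -> emem (isrc t) x.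
Proof. by move=> /emem_isrc[y /acts_mul[z tz _]]; apply/emem_isrc; exists z. Qed.

Lemma gactM s t g : gact (s * t) g = obind (gact s) (gact t g).
Proof.
have [r [xi [h ->]]] := germP g; have fx := tspec_filter xi.
have [k|nk] := boolP (tspec_mem xi (isrc (t * r))); last first.
  rewrite (gact_None h nk) /= gact_None //; apply: contra nk => k.
  by apply: (filter_up fx k) => x; rewrite -mulgA; exact: isrc_mul_sub.
rewrite (gact_Some h k) /=; have := boolP (tspec_mem xi (isrc (s * (t * r)))).
move=> [k'|nk']; last by rewrite (gact_None k nk') gact_None // -mulgA.
rewrite (gact_Some k k').
have k'' : tspec_mem xi (isrc (s * t * r)) by rewrite -mulgA.
rewrite (gact_Some h k''); congr Some; apply/mk_germ_eq; split=> //.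
by exists (ebr 1); [exact: filter1|rewrite mulgA].
Qed.

Lemma gactK s g h : gact s g = Some h -> gact (istar s) h = Some g.
Proof.
have [r [xi [hr ->]]] := germP g; have fx := tspec_filter xi.
have [k|nk] := boolP (tspec_mem xi (isrc (s * r))); last by rewrite (gact_None hr nk).
rewrite (gact_Some hr k) => -[<-].
have k' : tspec_mem xi (isrc (istar s * (s * r))).
  apply: (filter_up fx k) => x /emem_isrc[y /acts_mul[z rz sz]].
  apply/emem_isrc; exists z; apply/acts_mul; exists y; last exact/acts_star.
  by apply/acts_mul; exists z.
rewrite (gact_Some k k'); congr Some; apply/mk_germ_eq; split=> //.
exists (isrc (s * r)) => //; apply/acts_agree => x y /emem_isrc[y' /acts_mul[z rz sz]].
split=> [/acts_mul[u /acts_mul[v rv sv] /acts_star]|ry].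
  by rewrite -(acts_fun rz rv) in sv * => /(acts_cancel sv) <-.
have yz := acts_fun ry rz; subst z; apply/acts_mul; exists y'; last exact/acts_star.
by apply/acts_mul; exists y.
Qed.

Lemma gact_fix s t xi e (h : tspec_mem xi (isrc t)) : tspec_mem xi e ->
  s * t * val e = t * val e -> gact s (mk_germ h) = Some (mk_germ h).
Proof.
move=> xe E; have fx := tspec_filter xi.
have k : tspec_mem xi (isrc (s * t)).
  apply: (filter_up fx (filter_mul fx xe h)) => x /emem_emul[ex /emem_isrc[y xy]].
  by apply/emem_isrc; exists y; move/acts_agree: E => /(_ x y ex) ->.
by rewrite (gact_Some h k); congr Some; apply/mk_germ_eq; split=> //; exists e.
Qed.

Lemma gact_fixP s t xi (h : tspec_mem xi (isrc t)) :
  gact s (mk_germ h) = Some (mk_germ h) -> exists2 e, tspec_mem xi e & s * t * val e = t * val e.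
Proof.
have [k|nk] := boolP (tspec_mem xi (isrc (s * t))); last by rewrite (gact_None h nk).
by rewrite (gact_Some h k) => -[/mk_germ_eq[_]].
Qed.

Definition Th s : set (germ P) := Theta s (Dset (isrc s)).

Lemma ThP s g : Th s g <-> exists xi (h : tspec_mem xi (isrc s)), g = mk_germ h.
Proof. by split=> [[xi _ [h ->]]|[xi [h ->]]]; [exists xi, h|exists xi => //; exists h]. Qed.

(** Together with [gact_comp] and [comp_uniq]: [g] has at most one factorisation with left factor in
    the bisection [Th s], it exists exactly when [istar s] acts on [g], and the right factor is the
    translate. Convolution by a function supported on [Th s] thus has at most one term. *)
Lemma comp_gact s g h k : germ_comp k h g -> Th s k -> gact (istar s) g = Some h.
Proof.
move=> [s' [t [xi [eta [[ht hE] [hk kE] etaE [hg gE]]]]]] /ThP[eta' [hk' kE']].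
have fx := tspec_filter xi; rewrite gE hE.
move: kE'; rewrite kE => /mk_germ_eq[E [f ef /acts_agree sf]]; subst eta'.
have mem e : tspec_mem eta e = tspec_mem xi (epull t e).
  by rewrite {1}/tspec_mem etaE theta_pull.
rewrite mem in ef; rewrite mem in hk'.
have dom x : emem (emul (epull t f) (epull t (isrc s))) x ->
    exists y z, [/\ acts t x y, acts s y z & acts s' y z].
  move=> /emem_emul[/emem_epull[y ty fy] /emem_epull[y' ty' /emem_isrc[z sz]]].
  by exists y, z; rewrite -(acts_fun ty ty') in sz; split=> //; exact/sf.
have k1 : tspec_mem xi (isrc (istar s * (s' * t))).
  apply: (filter_up fx (filter_mul fx ef hk')) => x /dom[y [z [ty sz s'z]]].
  apply/emem_isrc; exists y; apply/acts_mul; exists z; last exact/acts_star.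
  by apply/acts_mul; exists y.
rewrite (gact_Some hg k1); congr Some; apply/mk_germ_eq; split=> //.
exists (emul (epull t f) (epull t (isrc s))); first exact: (filter_mul fx).
apply/acts_agree => x y' /dom[y [z [ty sz s'z]]].
have st : acts (istar s * (s' * t)) x y.
  by apply/acts_mul; exists z; [apply/acts_mul; exists y|exact/acts_star].
by split=> [/(acts_fun st)|/(acts_fun ty)] <-.
Qed.

Lemma gact_comp s g h : gact (istar s) g = Some h -> exists2 k, Th s k & germ_comp k h g.
Proof.
have [t [xi [hg ->]]] := germP g; have fx := tspec_filter xi.
have [k|nk] := boolP (tspec_mem xi (isrc (istar s * t))); last by rewrite (gact_None hg nk).
rewrite (gact_Some hg k) => -[<-].
have m : tspec_mem (tpull k) (isrc s).
  rewrite /tspec_mem val_tpull theta_pull //.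
  apply: (filter_up fx k) => x /emem_isrc[y sty].
  apply/emem_epull; exists y => //; move/acts_mul: sty => [z _ /acts_star sz].
  by apply/emem_isrc; exists z.
exists (mk_germ m); first by apply/ThP; exists (tpull k), m.
have k' : tspec_mem xi (isrc (s * (istar s * t))).
  apply: (filter_up fx k) => x /emem_isrc[y /[dup] sty /acts_mul[z _ /acts_star sz]].
  by apply/emem_isrc; exists z; apply/acts_mul; exists y.
exists s, (istar s * t), xi, (tpull k); split; first by exists k.
- by exists m.
- by rewrite val_tpull.
- exists k'; apply/mk_germ_eq; split=> //; exists (isrc (istar s * t)) => //.
  apply/acts_agree => x y /emem_isrc[u /acts_mul[z tz /acts_star sz]].
  have st : acts (s * (istar s * t)) x z.
    by apply/acts_mul; exists u => //; apply/acts_mul; exists z => //; exact/acts_star.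
  by split=> [/(acts_fun tz)|/(acts_fun st)] <-.
Qed.

Lemma comp_uniq s g h k k' : germ_comp k h g -> germ_comp k' h g -> Th s k -> Th s k' -> k = k'.
Proof.
move=> [s1 [t1 [xi1 [eta1 [[h1 E1] [m1 F1] G1 _]]]]].
move=> [s2 [t2 [xi2 [eta2 [[h2 E2] [m2 F2] G2 _]]]]].
move=> /ThP[eta [m kE]] /ThP[eta' [m' kE']].
have E : eta1 = eta2.
  by apply: val_inj; rewrite G1 G2; apply: (theta_germ (hs := h1) (ht := h2)); rewrite -E1.
move: kE; rewrite F1 => /[dup] kE /mk_germ_eq[e1 _].
move: kE'; rewrite F2 => /[dup] kE' /mk_germ_eq[e2 _].
subst eta eta' eta2; rewrite kE kE'; apply/mk_germ_eq; split=> //.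
by exists (ebr 1) => //; exact: (filter1 (tspec_filter eta1)).
Qed.

End Germs.

(** * Convolution by functions supported on bisections *)

Lemma fsbig_add_support (I : choiceType) (V : nmodType) (A Q : set I) (a : I -> V) :
  (forall i, A i -> a i != 0 -> Q i) -> \sum_(i \in A) a i = \sum_(i \in A `&` Q) a i.
Proof.
move=> h; apply/esym/fsbig_widen; first exact: subIsetl.
move=> i [Ai nAQ]; apply/eqP; apply: contraT => /(h _ Ai) Qi.
by case: nAQ.
Qed.

Section Conv.
Variables (R : realType) (P : rightLCMType).
Local Notation C := (cplx R).
Local Notation G := (germ P).
Local Notation ell2 := (ell2 R G).
Local Notation op := (ell2 -> ell2).
Local Notation conv := (@convolution R G (@germ_comp P)).
Local Notation lam := (@lambda R G (@germ_comp P)).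
Implicit Types (s t : isg P) (g h k : G) (f : G -> C) (phi psi : ell2).

Definition comps g := [set x : G * G | germ_comp x.1 x.2 g].

(** A sum over a set takes the default value 0 when infinitely many terms are nonzero, so linearity
    of the convolution rests on this finiteness. *)
Definition fsupp f := forall g, finite_set (comps g `&` [set x | f x.1 != 0]).

Lemma convE f (u : G -> C) g (Q : set (G * G)) :
  (forall x, comps g x -> f x.1 != 0 -> Q x) ->
  conv f u g = \sum_(x \in comps g `&` Q) (f x.1 * u x.2).
Proof.
move=> h; apply: fsbig_add_support => x cx n0; apply: h => //.
by apply: contra_neq n0 => ->; rewrite mul0r.
Qed.

Lemma conv_addl f f' (u : G -> C) g : fsupp f -> fsupp f' ->
  conv (fun x => f x + f' x) u g = conv f u g + conv f' u g.
Proof.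
move=> hf hf'; pose Q := [set x : G * G | f x.1 != 0] `|` [set x | f' x.1 != 0].
have fQ : finite_set (comps g `&` Q) by rewrite setIUr finite_setU; split.
rewrite (@convE f _ _ Q); last by left.
rewrite (@convE f' _ _ Q); last by right.
rewrite (@convE _ _ _ Q); last first.
  move=> x _ /= n0; rewrite /Q /=; apply: contrapT => /not_orP[/negP].
  rewrite negbK => /eqP a0 /negP; rewrite negbK => /eqP b0.
  by move: n0; rewrite a0 b0 addr0 eqxx.
by rewrite -fsbig_split //=; apply: eq_fsbigr => x _; rewrite mulrDl.
Qed.

Lemma conv_linr f (c : C) (u v : G -> C) g : fsupp f ->
  conv f (fun x => c * u x + v x) g = c * conv f u g + conv f v g.
Proof.
move=> hf; rewrite !(@convE f _ _ [set x | f x.1 != 0]) //.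
rewrite !fsbig_finite ?mulr_sumr -?big_split //=.
by apply: eq_bigr => x _; rewrite mulrDr mulrCA.
Qed.

Lemma conv_scalel f (c : C) (u : G -> C) g : fsupp f ->
  conv (fun x => c * f x) u g = c * conv f u g.
Proof.
move=> hf; rewrite !(@convE _ _ _ [set x | f x.1 != 0]) //; last first.
  by move=> x _ /=; apply: contra_neq => ->; rewrite mulr0.
by rewrite !fsbig_finite ?mulr_sumr //=; apply: eq_bigr => x _; rewrite mulrA.
Qed.

Definition shift s (u : G -> C) : G -> C := fun g =>
  if gact (istar s) g is Some h then u h else 0.

Lemma psum_le_uniq phi (l : seq G) : uniq l ->
  \sum_(x <- l) (cabs (phi x)) ^+ 2 <= (l2norm phi) ^+ 2.
Proof.
move=> ul; apply: le_trans (psum_le phi [fset x in l]%fset).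
rewrite le_eqVlt; apply/orP; left; apply/eqP/perm_big.
by apply: uniq_perm => [//||x]; rewrite ?fset_uniq ?inE.
Qed.

Lemma shift_psum s phi (F : {fset G}) :
  \sum_(g <- F) (cabs (shift s phi g)) ^+ 2 <= (l2norm phi) ^+ 2.
Proof.
have -> : \sum_(g <- F) (cabs (shift s phi g)) ^+ 2 =
    \sum_(h <- pmap (gact (istar s)) F) (cabs (phi h)) ^+ 2.
  elim: (enum_fset F) => [|g l IH]; first by rewrite !big_nil.
  rewrite big_cons /= /shift; case: gact => [h|] /=; rewrite ?big_cons IH //.
  by rewrite cabs0 expr0n add0r.
apply: psum_le_uniq; apply: (@pmap_uniq _ _ _ (fun h => odflt h (gact s h))).
  move=> g; case E : (gact (istar s) g) => [h|] //=.
  by have := gactK E; rewrite istarK => ->.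
exact: fset_uniq.
Qed.

Lemma shift_summable s phi : shift s phi \in @square_summable R G.
Proof.
rewrite square_summableE; apply: le_lt_trans (ltry _).
exact: l2sq_le (shift_psum s phi).
Qed.

Definition Tact s : op := fun phi => Ell2 (shift_summable s phi).

Lemma TactE s phi g :
  Tact s phi g = if gact (istar s) g is Some h then phi h else 0.
Proof. by []. Qed.

Lemma Tact_norm s phi : l2norm (Tact s phi) <= l2norm phi.
Proof. by apply: l2norm_le; [exact: l2norm_ge0|exact: shift_psum]. Qed.

Lemma ell2_ext phi psi : (forall g, phi g = psi g) -> phi = psi.
Proof. by move=> h; apply/val_inj/funext. Qed.

Lemma Tact_lin s : linear (Tact s).
Proof.
move=> c phi psi; apply: ell2_ext => g.
rewrite -[RHS]/(c * Tact s phi g + Tact s psi g) !TactE.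
by case: gact => [h|] //; rewrite mulr0 addr0.
Qed.

Lemma TactM s t : Tact (s * t)%g = Tact s \o Tact t.
Proof.
apply/funext => phi; apply: ell2_ext => g.
rewrite [LHS]TactE [RHS]TactE istarM gactM.
by case: (gact (istar s) g) => [h|] //=.
Qed.

Lemma Tact0 : Tact None = (fun=> 0).
Proof.
apply/funext => phi; apply: ell2_ext => g; rewrite TactE /=.
have [t [xi [hg ->]]] := germP g; rewrite gact_None //.
by apply/negP => /(filter_mem (tspec_filter xi))[x /emem_isrc[y]].
Qed.

Lemma istar_regular s : (s * istar s * s)%g = s.
Proof.
apply: acts_inj => x y; rewrite -mulgA acts_mul; split.
  by move=> [z /acts_mul[u xu /acts_star zu]]; rewrite (acts_cancel zu xu).
move=> xy; exists x => //; apply/acts_mul; exists y => //; exact/acts_star.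
Qed.

Lemma inner_polar phi psi : inner phi psi = polar phi psi.
Proof. by apply: inner_cvgE; exact: cvg_inner. Qed.

Lemma inner_pointwise phi psi phi' psi' :
  (forall g, phi g * (psi g)^* = phi' g * (psi' g)^*) -> inner phi psi = inner phi' psi'.
Proof. by move=> h; rewrite /inner; congr summability.sum; apply/funext. Qed.

(* T_s restricts to an isometry on its initial space, so polarisation moves T_s across. *)
Lemma Tact_adjoint s : adjoint_op (Tact s) (Tact (istar s)).
Proof.
have iso phi : l2norm (Tact s phi) = l2norm (Tact (istar s * s)%g phi).
  apply/eqP; rewrite eq_le; apply/andP; split.
    have := Tact_norm s (Tact (istar s * s)%g phi).
    by rewrite -[Tact s (Tact _ _)]/((Tact s \o Tact _) phi) -TactM mulgA istar_regular.
  by rewrite TactM; exact: (Tact_norm (istar s) (Tact s phi)).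
have isoi phi psi : inner (Tact s phi) (Tact s psi) =
    inner (Tact (istar s * s)%g phi) (Tact (istar s * s)%g psi).
  rewrite !inner_polar /polar.
  have lD t c a b : Tact t a + c *: Tact t b = Tact t (a + c *: b).
    by rewrite [LHS]addrC -Tact_lin [c *: b + a]addrC.
  have l1 t a b : Tact t a + Tact t b = Tact t (a + b).
    by have := lD t 1 a b; rewrite !scale1r.
  have lN t a b : Tact t a - Tact t b = Tact t (a - b).
    by have := lD t (-1) a b; rewrite !scaleN1r.
  have lNi t a b : Tact t a - 'i *: Tact t b = Tact t (a - 'i *: b).
    by have := lD t (-'i) a b; rewrite !scaleNr.
  by rewrite !lNi !lD !l1 !lN !iso.
move=> phi psi.
transitivity (inner (Tact s phi) (Tact s (Tact (istar s) psi))).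
  apply: inner_pointwise => g; rewrite !TactE.
  case E : (gact (istar s) g) => [h|]; rewrite ?mul0r //.
  by have := gactK E; rewrite TactE istarK => ->.
rewrite isoi; transitivity (inner (Tact (istar s * s)%g phi) (Tact (istar s) psi)).
  congr inner; rewrite -[LHS]/((Tact _ \o Tact _) psi) -TactM.
  by rewrite -{2}(istarK s) istar_regular.
apply: inner_pointwise => g; rewrite !TactE istarM istarK gactM.
case E : (gact s g) => [h|]; last by rewrite rmorph0 !mulr0.
by rewrite /= (gactK E).
Qed.

Definition ind s : G -> C := fun g => (g \in Th s)%:R.

Lemma ind1 s g : Th s g -> ind s g = 1.
Proof. by move=> h; rewrite /ind mem_set. Qed.

Lemma ind0 s g : ~ Th s g -> ind s g = 0.
Proof. by move=> h; rewrite /ind memNset. Qed.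

Definition sub_supp f s := forall g, f g != 0 -> Th s g.

Lemma ind_supp s : sub_supp (ind s) s.
Proof. by move=> g; apply: contra_neqP; exact: ind0. Qed.

Lemma comps_one f s g : sub_supp f s ->
  (gact (istar s) g = None /\ forall x, comps g x -> f x.1 = 0) \/
  exists k h, [/\ gact (istar s) g = Some h, Th s k, comps g (k, h) &
    forall x, comps g x -> f x.1 != 0 -> x = (k, h)].
Proof.
move=> fs; case E : (gact (istar s) g) => [h|]; last first.
  left; split=> // -[k h] /= c; apply/eqP/contraT => /fs ks.
  by have := comp_gact c ks; rewrite E.
right; have [k ks c] := gact_comp E; exists k, h; split=> // -[k' h'] c' /= /fs ks'.
have : Some h = Some h' by rewrite -E; exact: comp_gact c' ks'.
case=> hh; subst h'.
by have -> : k' = k := comp_uniq c' c ks' ks.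
Qed.

Lemma sub_supp_fsupp f s : sub_supp f s -> fsupp f.
Proof.
move=> fs g; have [[_ h]|[k [h [_ _ _ H]]]] := comps_one g fs.
  rewrite (_ : _ `&` _ = set0) //; apply/seteqP; split=> // x [cx /=].
  by rewrite h ?eqxx.
apply: (@sub_finite_set _ _ [set (k, h)]) => // x [cx fx].
exact: H.
Qed.

Lemma conv_shift f s (u : G -> C) g : sub_supp f s ->
  conv f u g = 0 /\ gact (istar s) g = None \/
  exists k, Th s k /\ conv f u g = f k * shift s u g.
Proof.
move=> fs; have [[E h]|[k [h [E ks c H]]]] := comps_one g fs.
  left; split=> //; rewrite /convolution fsbig1 // => x cx.
  by rewrite h ?mul0r.
right; exists k; split=> //; rewrite /shift E.
rewrite (@convE _ _ _ [set (k, h)]) //.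
by rewrite (_ : _ `&` _ = [set (k, h)]) ?fsbig_set1 //; apply/seteqP; split=> [x []|_ ->].
Qed.

Lemma conv_ind s (u : G -> C) g : conv (ind s) u g = shift s u g.
Proof.
have [[-> E]|[k [ks ->]]] := @conv_shift (ind s) s u g (@ind_supp s).
  by rewrite /shift E.
by rewrite ind1 // mul1r.
Qed.

(** Asking for a vector [psi] that equals the convolution rules out the default value 0 in [lambda];
    [K] then bounds the operator norm. *)
Definition cbound f (K : R) := [/\ fsupp f, 0 <= K & forall phi, exists psi : ell2,
  (forall g, psi g = conv f phi g) /\ l2norm psi <= K * l2norm phi].

Lemma cbound_lambda f K phi : cbound f K ->
  (forall g, lam f phi g = conv f phi g) /\ l2norm (lam f phi) <= K * l2norm phi.
Proof.
move=> [_ _ /(_ phi)[psi [E n]]].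
have cE : conv f phi = psi by apply/funext => g; rewrite E.
have -> : lam f phi = psi.
  by apply/val_inj; rewrite /lambda cE insubdK //; exact: (valP psi).
by split=> // g; rewrite cE.
Qed.

Lemma cboundD f f' K K' : cbound f K -> cbound f' K' -> cbound (fun g => f g + f' g) (K + K').
Proof.
move=> [h K0 hf] [h' K0' hf']; split.
- move=> g; apply: (@sub_finite_set _ _ ((comps g `&` [set x | f x.1 != 0]) `|`
    (comps g `&` [set x | f' x.1 != 0]))); last by rewrite finite_setU; split.
  move=> x [cx /= n0]; apply: contrapT => /not_orP[a b]; move: n0.
  have -> : f x.1 = 0 by apply/eqP/contraT => n; case: a.
  have -> : f' x.1 = 0 by apply/eqP/contraT => n; case: b.
  by rewrite addr0 eqxx.
- exact: addr_ge0.
- move=> phi; have [psi [E n]] := hf phi; have [psi' [E' n']] := hf' phi.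
  exists (psi + psi'); split.
    by move=> g; rewrite conv_addl // -E -E'.
  by apply: le_trans (l2normD _ _) _; rewrite mulrDl lerD.
Qed.

Lemma cboundZ f K (c : C) : cbound f K -> cbound (fun g => c * f g) (cabs c * K).
Proof.
move=> [h K0 hf]; split.
- move=> g; apply: sub_finite_set (h g) => x [cx /=]; split=> //=.
  by apply: contra_neq b => ->; rewrite mulr0.
- by rewrite mulr_ge0 ?cabs_ge0.
- move=> phi; have [psi [E n]] := hf phi; exists (c *: psi); split.
    by move=> g; rewrite conv_scalel // -E.
  by rewrite l2normZ -mulrA ler_wpM2l ?cabs_ge0.
Qed.

(** The convolution has at most one term, so it is dominated pointwise by [M] times the absolute
    value of [Tact s phi]. *)
Lemma cbound_sub_supp f s M : 0 <= M -> sub_supp f s -> (forall g, cabs (f g) <= M) ->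
  cbound f M.
Proof.
move=> M0 fs fM; split=> // [|phi]; first exact: sub_supp_fsupp fs.
have le g : cabs (conv f phi g) <= M * cabs (Tact s phi g).
  have [[-> _]|[k [_ ->]]] := conv_shift phi g fs.
    by rewrite cabs0 mulr_ge0 ?cabs_ge0.
  by rewrite cabsM ler_wpM2r ?cabs_ge0.
have h (F : {fset G}) : \sum_(g <- F) (cabs (conv f phi g)) ^+ 2 <= (M * l2norm phi) ^+ 2.
  apply: (@le_trans _ _ (M ^+ 2 * \sum_(g <- F) (cabs (Tact s phi g)) ^+ 2)).
    rewrite mulr_sumr; apply: ler_sum => g _; rewrite -exprMn.
    by rewrite ler_sqr ?nnegrE ?mulr_ge0 ?cabs_ge0.
  by rewrite exprMn ler_wpM2l ?sqr_ge0 // shift_psum.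
have cs : conv f phi \in @square_summable R G.
  rewrite square_summableE; apply: le_lt_trans (ltry _); exact: l2sq_le h.
exists (Ell2 cs); split=> //; apply: l2norm_le; last exact: h.
by rewrite mulr_ge0 ?l2norm_ge0.
Qed.

Lemma cbound0 : cbound (fun=> 0) 0.
Proof.
apply: (@cbound_sub_supp _ None) => // [g|g]; first by rewrite eqxx.
by rewrite cabs0.
Qed.

(** The indicator of one bisection at a time is split off from [f], and each piece costs [M]. This
    bound turns uniform approximation into norm approximation. *)
Lemma cbound_bisections (l : seq (isg P)) f M : 0 <= M ->
  (forall g, f g != 0 -> exists2 s, s \in l & Th s g) ->
  (forall g, cabs (f g) <= M) -> cbound f ((size l)%:R * M).
Proof.
move=> M0; elim: l f => [|s l IH] f fl fM.
  have -> : f = (fun=> 0) by apply/funext => g; apply/eqP/contraT => /fl[].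
  by rewrite mul0r; exact: cbound0.
have -> : f = (fun g => ind s g * f g + (1 - ind s g) * f g).
  by apply/funext => g; rewrite -mulrDl addrC subrK mul1r.
rewrite /= -natr1 mulrDl mul1r addrC; apply: cboundD.
  apply: (@cbound_sub_supp _ s) => // g.
    by apply: contra_neqP => /ind0 ->; rewrite mul0r.
  have [h|h] := pselect (Th s g); first by rewrite ind1 // mul1r.
  by rewrite ind0 // mul0r cabs0.
apply: IH => g.
  have [h|h] := pselect (Th s g); first by rewrite ind1 // subrr mul0r eqxx.
  rewrite ind0 // subr0 mul1r => /fl[t]; rewrite inE => /predU1P[->|tl] // tg.
  by exists t.
have [h|h] := pselect (Th s g); first by rewrite ind1 // subrr mul0r cabs0.
by rewrite ind0 // subr0 mul1r.
Qed.

Lemma lambdaD f f' K K' phi : cbound f K -> cbound f' K' ->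
  lam (fun g => f g + f' g) phi = lam f phi + lam f' phi.
Proof.
move=> hf hf'; apply: ell2_ext => g.
rewrite -[RHS]/(lam f phi g + lam f' phi g).
have [-> _] := cbound_lambda phi (cboundD hf hf').
have [-> _] := cbound_lambda phi hf; have [-> _] := cbound_lambda phi hf'.
by case: hf hf' => ? _ _ [? _ _]; exact: conv_addl.
Qed.

Lemma lambdaZ f K (c : C) phi : cbound f K -> lam (fun g => c * f g) phi = c *: lam f phi.
Proof.
move=> hf; apply: ell2_ext => g; rewrite -[RHS]/(c * lam f phi g).
have [-> _] := cbound_lambda phi (cboundZ c hf); have [-> _] := cbound_lambda phi hf.
by case: hf => ? _ _; exact: conv_scalel.
Qed.

Lemma lambda_bounded f K : cbound f K -> bounded_op (lam f).
Proof.
move=> hf; split=> [c phi psi|]; last by exists K => phi; case: (cbound_lambda phi hf).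
apply: ell2_ext => g; rewrite -[RHS]/(c * lam f phi g + lam f psi g).
have [-> _] := cbound_lambda (c *: phi + psi) hf.
have [-> _] := cbound_lambda phi hf; have [-> _] := cbound_lambda psi hf.
by case: hf => h _ _; rewrite -conv_linr.
Qed.

Lemma lambda_ind s : lam (ind s) = Tact s.
Proof.
have h : cbound (ind s) 1.
  apply: (@cbound_sub_supp _ s); rewrite ?ler01 //; first exact: ind_supp.
  by move=> g; rewrite /ind; case: (g \in _); rewrite ?cabs1 ?cabs0 ?ler01.
apply/funext => phi; apply: ell2_ext => g.
by have [-> _] := cbound_lambda phi h; rewrite conv_ind.
Qed.

End Conv.

(** * The topology of the tight groupoid *)

Section Topology.
Variable P : rightLCMType.
Implicit Types (s t : isg P) (e : idemS P) (xi eta : tspec P) (g h k : germ P).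

Definition Dbasic e (F : seq (idemS P)) : set (tspec P) :=
  [set eta | tspec_mem eta e /\ forall f, f \in F -> ~~ tspec_mem eta f].

(** The positive conditions merge into a single [e], because filters are closed under products and
    upwards; the negative ones remain a list. *)
Lemma nbhs_tspec xi (U : set (tspec P)) : nbhs xi U ->
  exists e F, Dbasic e F xi /\ Dbasic e F `<=` U.
Proof.
move=> [_ [[V oV <-] Vxi] VU].
have [F hF] := @nbhs_ptws P (val xi) V (open_nbhs_nbhs (conj oV Vxi)).
have fx := tspec_filter xi.
exists (efold [seq f <- F | tspec_mem xi f]), [seq f <- F | ~~ tspec_mem xi f].
split.
  split; last by move=> f; rewrite mem_filter => /andP[].
  by apply: (filter_efold fx) => f; rewrite mem_filter => /andP[].
move=> eta [ee eF]; apply: VU; apply: hF => f fF; apply/idP/idP => [ef|xf].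
  apply: contraT => nxf; have := eF f; rewrite mem_filter nxf fF => /(_ isT).
  by rewrite [tspec_mem _ _]ef.
apply: (filter_up (tspec_filter eta) ee) => x /emem_efold; apply.
by rewrite mem_filter fF andbT.
Qed.

Lemma open_DsetC e : open (~` Dset e).
Proof.
rewrite openE => xi nxe.
have cv : continuous (set_val : tspec P -> {ptws idemS P -> bool}).
  exact: initial_continuous.
apply: (@filterS _ (nbhs xi) _ _ _ _ (cv xi _ (nbhs_agree (val xi) [:: e]))) => eta.
move=> /(_ e); rewrite inE eqxx => /(_ isT) he; apply/negP.
by move/negP: nxe; rewrite /tspec_mem; rewrite -he.
Qed.

Lemma open_Dbasic e F : open (Dbasic e F).
Proof.
have -> : Dbasic e F = Dset e `&` \bigcap_(f in [set` F]) ~` Dset f.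
  apply/seteqP; split=> eta [ee eF]; split=> // f fF; last exact/negP/eF.
  by apply/negP; exact: eF.
apply: openI; first exact: open_Dset.
elim: F => [|f F IH].
  rewrite (_ : \bigcap_(_ in _) _ = setT); first exact: openT.
  by apply/seteqP; split=> // x _ f /=; rewrite in_nil.
rewrite (_ : \bigcap_(_ in _) _ = ~` Dset f `&` \bigcap_(f in [set` F]) ~` Dset f).
  by apply: openI => //; exact: open_DsetC.
apply/seteqP; split=> x.
  by move=> h; split=> [|k kF]; apply: h; rewrite /= inE ?eqxx // kF orbT.
by move=> [h1 h2] k /=; rewrite inE => /predU1P[->|/h2].
Qed.

Lemma open_germ_base (A : set (germ P)) : germ_base A -> open A.
Proof.
move=> hA; exists [set A] => [_ -> //|].
by rewrite bigcup_set1.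
Qed.

Lemma nbhs_germ g (A : set (germ P)) : nbhs g A ->
  exists s U, [/\ open U, U `<=` Dset (isrc s), Theta s U g & Theta s U `<=` A].
Proof.
rewrite nbhsE => -[B [[D hD <-] [X DX Xg]] BA].
have [s [U [oU sU XE]]] := hD X DX; exists s, U; split=> //.
  by rewrite -XE.
by move=> k kX; apply: BA; exists X => //; rewrite XE.
Qed.

Definition gsrc g : tspec P := (val (repr g)).2.

Lemma gsrc_mk s xi (h : tspec_mem xi (isrc s)) : gsrc (mk_germ h) = xi.
Proof.
rewrite /gsrc; have [t [eta [h' [-> E]]]] := repr_germ (mk_germ h).
by have /mk_germ_eq[-> _] := E.
Qed.

Lemma ThetaP s (U : set (tspec P)) g : Theta s U g <-> Th s g /\ U (gsrc g).
Proof.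
split=> [[xi Ux [h ->]]|[/ThP[xi [h ->]]]]; last first.
  by rewrite gsrc_mk => Ux; exists xi => //; exists h.
by rewrite gsrc_mk; split=> //; apply/ThP; exists xi, h.
Qed.

Lemma Th_src s g : Th s g -> tspec_mem (gsrc g) (isrc s).
Proof. by move=> /ThP[xi [h ->]]; rewrite gsrc_mk. Qed.

Lemma Th_mul s e g : Th (s * val e)%g g <-> Th s g /\ tspec_mem (gsrc g) e.
Proof.
split=> [/ThP[xi [h ->]]|[/ThP[xi [h ->]]]]; rewrite gsrc_mk.
  have fx := tspec_filter xi.
  have sub x : emem (isrc (s * val e)%g) x -> emem e x /\ emem (isrc s) x.
    move=> /emem_isrc[y /acts_mul[z /emem_acts[<- ex] sxy]]; split=> //.
    by apply/emem_isrc; exists y.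
  have xe : tspec_mem xi e by apply: (filter_up fx h) => x /sub[].
  split=> //; have xs : tspec_mem xi (isrc s) by apply: (filter_up fx h) => x /sub[].
  apply/ThP; exists xi, xs; apply/mk_germ_eq; split=> //; exists e => //.
  by rewrite -mulgA (idem_id (idemSP e)).
move=> xe; apply/ThP; exists xi, (isrc_mul_mem h xe).
apply/mk_germ_eq; split=> //; exists e => //.
by rewrite -mulgA (idem_id (idemSP e)).
Qed.

Lemma open_Theta s (U : set (tspec P)) : open U -> open (Theta s U).
Proof.
move=> oU; rewrite (_ : Theta s U = Theta s (U `&` Dset (isrc s))).
  apply: open_germ_base; exists s, (U `&` Dset (isrc s)); split=> //.
  by apply: openI => //; exact: open_Dset.
apply/seteqP; split=> g /ThetaP[gs Ug]; apply/ThetaP; split=> //; last by case: Ug.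
by split=> //; exact: Th_src.
Qed.

Lemma open_Th s : open (Th s).
Proof. by apply: open_Theta; exact: open_Dset. Qed.

Section Hausdorff.
Hypothesis hH : condH P.

Lemma ThI s t : exists F : seq (idemS P), forall g, Th s g ->
  (Th t g <-> tspec_mem (gsrc g) (isrc t) /\ exists2 f, f \in F & tspec_mem (gsrc g) f).
Proof.
have [F hF] := condH_agree hH s t; exists F => g /ThP[xi [h ->]]; rewrite gsrc_mk.
split=> [/ThP[eta [k E]]|[k /(hF _ h k)[e xe E]]].
  have /mk_germ_eq[? ex] := E; subst eta.
  by split=> //; apply/(hF _ h k).
by apply/ThP; exists xi, k; apply/mk_germ_eq; split=> //; exists e.
Qed.

(** On a bisection [Th t] whose sources lie in the domain of [s], belonging to [Th s] means that the
    source contains an element of the finite list of [ThI], and avoiding a finite list is an open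
    condition. *)
Lemma closed_Th s : closed (Th s).
Proof.
rewrite -openC openE => g nsg; have [t [xi [h gE]]] := germP g.
have tg : Th t g by apply/ThP; exists xi, h.
have [F hF] := ThI t s.
suff [U oU [Ug hU]] : exists2 U : set (tspec P), open U & U (gsrc g) /\
    forall k, Th t k -> U (gsrc k) -> ~ Th s k.
  apply: (@filterS _ _ _ (Theta t U)); first by move=> k /ThetaP[tk /(hU _ tk)].
  by apply: open_nbhs_nbhs; split; [exact: open_Theta|exact/ThetaP].
have [gs|gs] := boolP (tspec_mem (gsrc g) (isrc s)); last first.
  exists (~` Dset (isrc s)); first exact: open_DsetC.
  by split=> [|k _ nk /Th_src]; first exact/negP.
exists (Dbasic (isrc t) F); first exact: open_Dbasic.
split.
  split=> [|f fF]; first exact: (Th_src tg).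
  by apply/negP => gf; apply: nsg; apply/(hF _ tg); split=> //; exists f.
by move=> k tk [_ kF] /(hF _ tk)[_ [f /kF/negP]].
Qed.

End Hausdorff.

(** The source map identifies [Th s] with the compact set of tight filters containing [isrc s]. A
    filter on [Th s] is pushed forward to the product space, where Tychonoff gives a cluster point,
    and the germ of [s] there is a cluster point upstairs. *)
Lemma compact_Th s : compact (Th s).
Proof.
move=> F PF Fs; pose src g : {ptws idemS P -> bool} := val (gsrc g).
have [|xi [[txi xis] cxi]] := tight_compact (e := isrc s) (fmap_proper_filter src PF).
  apply: (@filterS _ F _ (Th s) _ _ Fs) => g gs; split; last exact: (Th_src gs).
  exact: set_valP.
pose eta : tspec P := SigSub (mem_set txi).
have h : tspec_mem eta (isrc s) by [].
exists (mk_germ h); split; first by apply/ThP; exists eta, h.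
move=> A B FA /nbhs_germ[t [U [oU sU /ThetaP[tg Ug] UB]]].
rewrite gsrc_mk in Ug.
have /ThP[eta' [h' E]] := tg; have /mk_germ_eq[? [e xe se]] := E; subst eta'.
have [c [D [[ec eD] DU]]] := nbhs_tspec (open_nbhs_nbhs (conj oU Ug)).
(* Agreement at [e], below which [s] and [t] coincide, moves [g] from [Th s] into [Th t]; agreement
   at [c] and [D] keeps its source in [U]. *)
have [_ [[g [Ag gs] <-] hg]] := cxi (src @` (A `&` Th s)) _
  (filterS (fun k hk => ex_intro2 _ _ k hk erefl) (filterI FA Fs))
  (nbhs_agree xi (e :: c :: D)).
have srcg f : f \in e :: c :: D -> tspec_mem (gsrc g) f = tspec_mem eta f by exact: hg.
exists g; split=> //; apply: UB; apply/ThetaP; split; last first.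
  apply: DU; split=> [|f fD]; first by rewrite srcg ?inE ?eqxx ?orbT.
  by rewrite srcg ?inE ?fD ?orbT //; exact: eD.
have ge : tspec_mem (gsrc g) e by rewrite srcg ?inE ?eqxx.
have : Th (t * val e)%g g by rewrite -se; exact/Th_mul.
by move=> /Th_mul[].
Qed.

End Topology.

(** * Density of the span of the generators *)

(* compact_cover asks for a pointed space, which germ P is not. *)
Lemma compact_finite_cover (T : topologicalType) (I : eqType) (K : set T) (U : I -> set T) :
  compact K -> (forall i, open (U i)) -> (forall x, K x -> exists i, U i x) ->
  exists D : seq I, forall x, K x -> exists2 i, i \in D & U i x.
Proof.
move=> cK oU KU; apply: contrapT => /forallNP noD.
pose B (D : seq I) := K `&` [set x | forall i, i \in D -> ~ U i x].
pose F := filter_from [set: seq I] B.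
have PF : ProperFilter F.
  apply: filter_from_proper; last first.
    move=> D _; apply: contrapT => nB; apply: (noD D) => x Kx.
    apply: contrapT => /forall2NP h; apply: nB; exists x; split=> // i iD Ui.
    by case: (h i).
  apply: filter_fromT_filter; first by exists [::].
  move=> D E; exists (D ++ E) => x [Kx h].
  by split; split=> // i iD; apply: h; rewrite mem_cat iD ?orbT.
have FK : F K by exists [::] => // x [].
have [x [Kx cx]] := cK F PF FK.
have [i Ui] := KU x Kx.
have Fi : F (B [:: i]) by exists [:: i].
have [y [[_ h] Uy]] := cx _ _ Fi (open_nbhs_nbhs (conj (oU i) Ui)).
by apply: (h i); rewrite ?inE.
Qed.

Section Density.
Variables (R : realType) (P : rightLCMType).
Hypothesis hH : condH P.
Local Notation C := (cplx R).
Local Notation G := (germ P).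
Local Notation ell2 := (ell2 R G).
Local Notation op := (ell2 -> ell2).
Local Notation lam := (@lambda R G (@germ_comp P)).
Local Notation ind := (@ind R P).
Local Notation Tact := (@Tact R P).
Implicit Types (s t : isg P) (g h k : G) (f : G -> C) (phi psi : ell2).

Definition lincomb (l : seq (C * isg P)) : G -> C := fun g => \sum_(c <- l) c.1 * ind c.2 g.

Definition opcomb (l : seq (C * isg P)) : op := fun phi => \sum_(c <- l) c.1 *: Tact c.2 phi.

Definition Lspan : set (G -> C) := range lincomb.

Definition Lop : set op := range opcomb.

Lemma Lspan0 : Lspan (fun=> 0).
Proof. by exists [::] => //; apply/funext => g; rewrite /lincomb big_nil. Qed.

Lemma Lspan_ind s : Lspan (ind s).
Proof.
by exists [:: (1, s)] => //; apply/funext => g; rewrite /lincomb big_seq1 mul1r.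
Qed.

Lemma LspanP (c : C) f f' : Lspan f -> Lspan f' -> Lspan (fun g => c * f g + f' g).
Proof.
move=> [l _ <-] [l' _ <-]; exists (map (fun x => (c * x.1, x.2)) l ++ l') => //.
apply/funext => g; rewrite /lincomb big_cat big_map mulr_sumr; congr (_ + _).
by apply: eq_bigr => x _; rewrite mulrA.
Qed.

Lemma LspanB f f' : Lspan f -> Lspan f' -> Lspan (fun g => f g - f' g).
Proof.
move=> hf hf'; have := LspanP (-1) hf' hf.
by congr Lspan; apply/funext => g; rewrite mulN1r addrC.
Qed.

Lemma LspanZ (c : C) f : Lspan f -> Lspan (fun g => c * f g).
Proof.
move=> hf; have := LspanP c hf Lspan0.
by congr Lspan; apply/funext => g; rewrite addr0.
Qed.

(** The constant 1 and the functions [src_in U] need not lie in the span, but they multiply it into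
    itself; working with multipliers makes complements available. *)
Definition span_mult (m : G -> C) := forall f, Lspan f -> Lspan (fun g => m g * f g).

Lemma span_mult_of_ind (m : G -> C) : (forall s, Lspan (fun g => m g * ind s g)) -> span_mult m.
Proof.
move=> h _ [l _ <-]; elim: l => [|c l IH].
  have := Lspan0; congr Lspan; apply/funext => g.
  by rewrite /lincomb big_nil mulr0.
have := LspanP c.1 (h c.2) IH; congr Lspan; apply/funext => g.
by rewrite /lincomb big_cons mulrDr mulrCA.
Qed.

Lemma span_multB m m' : span_mult m -> span_mult m' -> span_mult (fun g => m g - m' g).
Proof.
move=> h h' f hf; have := LspanB (h f hf) (h' f hf).
by congr Lspan; apply/funext => g; rewrite mulrBl.
Qed.

Lemma span_multM m m' : span_mult m -> span_mult m' -> span_mult (fun g => m g * m' g).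
Proof.
move=> h h' f hf; have := h _ (h' f hf).
by congr Lspan; apply/funext => g; rewrite mulrA.
Qed.

Lemma span_mult1 : span_mult (fun=> 1).
Proof. by move=> f hf; have := LspanZ 1 hf. Qed.

Lemma span_mult0 : span_mult (fun=> 0).
Proof.
move=> f hf; have := Lspan0.
by congr Lspan; apply/funext => g; rewrite mul0r.
Qed.

Definition src_in (U : set (tspec P)) : G -> C := fun g => (gsrc g \in U)%:R.

Lemma span_mult_Dset e : span_mult (src_in (Dset e)).
Proof.
apply: span_mult_of_ind => s; have := Lspan_ind (s * val e)%g; congr Lspan; apply/funext => g.
rewrite /ind /src_in -natrM mulnb; congr (_ %:R); congr nat_of_bool.
apply/idP/andP; first by move=> /set_mem/Th_mul[? ?]; split; exact/mem_set.
by move=> [/set_mem ? /set_mem ?]; apply/mem_set/Th_mul.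
Qed.

(* For indicators a x this is the indicator of a finite union, built from operations that
   preserve span_mult. *)
Fixpoint cupf (T : Type) (a : T -> G -> C) (l : seq T) : G -> C :=
  if l is x :: l' then fun g => 1 - (1 - a x g) * (1 - cupf a l' g) else fun=> 0.

Lemma span_mult_cupf (T : Type) (a : T -> G -> C) l :
  (forall x, span_mult (a x)) -> span_mult (cupf a l).
Proof.
move=> h; elim: l => [|x l IH] /=; first exact: span_mult0.
apply: span_multB; first exact: span_mult1.
by apply: span_multM; apply: span_multB => //; exact: span_mult1.
Qed.

Lemma cupfE (T : eqType) (A : T -> set G) (l : seq T) g :
  cupf (fun x g => (g \in A x)%:R) l g = (has (fun x => g \in A x) l)%:R.
Proof.
elim: l => [|x l IH] //=; rewrite IH.
by case: (g \in A x); case: (has _ _); rewrite /= ?subrr ?subr0 ?mul0r ?mulr0 ?mulr1 ?subrr ?subr0.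
Qed.

(** Inside [Th s], [ThI] describes [Th t] by finitely many conditions on the source, each of which
    is a multiplier. Condition (H) thus makes the span closed under pointwise products. *)
Lemma span_mult_ind t : span_mult (ind t).
Proof.
apply: span_mult_of_ind => s; have [F hF] := ThI hH s t.
have := span_multM (span_mult_Dset (isrc t))
  (@span_mult_cupf _ (fun e => src_in (Dset e)) F (fun e => @span_mult_Dset e)) (Lspan_ind s).
congr Lspan; apply/funext => g; rewrite /src_in.
rewrite (@cupfE _ (fun e => [set g | Dset e (gsrc g)])).
have [gs|gs] := pselect (Th s g); last by rewrite ind0 // !mulr0.
rewrite ind1 // !mulr1 /ind -natrM mulnb; congr (_ %:R); congr nat_of_bool.
apply/andP/idP => [[/set_mem gt /hasP[f fF /set_mem gf]]|/set_mem/(hF _ gs)[gt [f fF gf]]].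
  by apply/mem_set/(hF _ gs); split=> //; exists f.
by split; [exact/mem_set|apply/hasP; exists f => //; exact/mem_set].
Qed.

Lemma span_mult_Dbasic e F : span_mult (src_in (Dbasic e F)).
Proof.
have := span_multM (span_mult_Dset e) (span_multB span_mult1
  (@span_mult_cupf _ (fun e => src_in (Dset e)) F (fun e => @span_mult_Dset e))).
congr span_mult; apply/funext => g; rewrite /src_in.
rewrite (@cupfE _ (fun e => [set g | Dset e (gsrc g)])).
have -> : (gsrc g \in Dbasic e F) =
    (gsrc g \in Dset e) && ~~ has (fun e' : idemS P => g \in [set g | Dset e' (gsrc g)]) F.
  apply/idP/andP => [/set_mem[ge gF]|[/set_mem ge /hasPn gF]].
    split; first exact/mem_set.
    by apply/hasPn => f /gF nf; apply/negP => /set_mem; exact/negP.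
  apply/mem_set; split=> // f /gF; apply: contra => gf; exact/mem_set.
by case: (_ \in Dset e); case: has; rewrite /= ?subrr ?subr0 ?mulr1 ?mulr0.
Qed.

Lemma ind_continuous s : continuous (ind s).
Proof.
move=> g A /nbhs_singleton Ag.
have [gs|gs] := pselect (Th s g).
  apply: (@filterS _ (nbhs g) _ (Th s)); last exact: open_nbhs_nbhs (conj (@open_Th P s) gs).
  by move=> k ks; rewrite /= ind1 // -(ind1 R gs).
have oc : open (~` Th s) by rewrite openC; exact: closed_Th.
apply: (@filterS _ (nbhs g) _ (~` Th s)); last exact: open_nbhs_nbhs (conj oc gs).
by move=> k ks; rewrite /= ind0 // -(ind0 R gs).
Qed.

Lemma Cc_ind s : @Cc R G (ind s).
Proof.
split; first exact: ind_continuous.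
apply: (subclosed_compact _ (@compact_Th P s)); first exact: closed_closure.
rewrite (closure_id (Th s)).1; last exact: closed_Th.
by apply: closure_subset => g; exact: ind_supp.
Qed.

Lemma Cc0 : @Cc R G (fun=> 0).
Proof.
split; first exact: cst_continuous.
rewrite (_ : [set g | _] = set0) ?closure0; first exact: compact0.
by apply/seteqP; split=> // g /=; rewrite eqxx.
Qed.

Lemma CcP (c : C) f f' : @Cc R G f -> @Cc R G f' -> @Cc R G (fun g => c * f g + f' g).
Proof.
move=> [cf kf] [cf' kf']; split.
  move=> g; exact: (continuousD (continuousM (cvg_cst c) (cf g)) (cf' g)).
apply: (subclosed_compact _ (compactU kf kf')); first exact: closed_closure.
rewrite -closureU; apply: closure_subset => g /= n0.
apply: contrapT => /not_orP[/negP a /negP b]; move: n0.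
by rewrite (eqP (negPn a)) (eqP (negPn b)) mulr0 addr0 eqxx.
Qed.

Lemma Lspan_Cc : Lspan `<=` @Cc R G.
Proof.
move=> _ [l _ <-]; elim: l => [|c l IH].
  have := Cc0; congr Cc; apply/funext => g; by rewrite /lincomb big_nil.
have := CcP c.1 (@Cc_ind c.2) IH; congr Cc; apply/funext => g.
by rewrite /lincomb big_cons.
Qed.

Lemma ind_cbound s : cbound (ind s) 1.
Proof.
apply: (@cbound_sub_supp _ _ _ s); rewrite ?ler01 //; first exact: ind_supp.
by move=> g; rewrite /ind; case: (g \in _); rewrite ?cabs1 ?cabs0 ?ler01.
Qed.

Lemma lincomb_lambda l : exists2 K, cbound (lincomb l) K & lam (lincomb l) = opcomb l.
Proof.
elim: l => [|c l [K hK E]].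
  exists 0.
    have := @cbound0 R P; congr cbound; by apply/funext => g; rewrite /lincomb big_nil.
  apply/funext => phi; apply: ell2_ext => g; rewrite /opcomb big_nil.
  have -> : lincomb [::] = (fun=> 0) by apply/funext => h; rewrite /lincomb big_nil.
  have [-> _] := cbound_lambda phi (@cbound0 R P).
  by rewrite /convolution fsbig1 // => x _; rewrite mul0r.
have e : lincomb (c :: l) = (fun g => (c.1 * ind c.2 g) + lincomb l g).
  by apply/funext => g; rewrite /lincomb big_cons.
have hc := cboundZ c.1 (ind_cbound c.2).
exists (cabs c.1 * 1 + K); first by rewrite e; exact: cboundD.
rewrite e; apply/funext => phi; rewrite (lambdaD _ hc hK) E.
by rewrite (lambdaZ _ _ (ind_cbound c.2)) lambda_ind /opcomb big_cons.
Qed.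

Lemma local_approx f x (d : R) : continuous f -> 0 < d -> exists N : set G,
  [/\ open N, N x, span_mult (fun g => (g \in N)%:R), Lspan (fun g => (g \in N)%:R) &
    forall y, N y -> cabs (f y - f x) <= d].
Proof.
move=> cf d0; have dC : 0 < (d%:C%C : C) by rewrite ltcR.
have /nbhs_germ[s [U [oU sU /ThetaP[xs Ux] UN]]] :
    nbhs x [set y | `|f x - f y| <= (d%:C%C : C)].
  by have /cvgrPdist_le/(_ _ dC) := cf x.
have [e [F [xeF eFU]]] := nbhs_tspec (open_nbhs_nbhs (conj oU Ux)).
exists (Theta s (Dbasic e F)).
have E : (fun g => (g \in Theta s (Dbasic e F))%:R : C) =
    (fun g => src_in (Dbasic e F) g * ind s g).
  apply/funext => g; rewrite /src_in /ind -natrM mulnb; congr (_ %:R); congr nat_of_bool.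
  apply/idP/andP => [/set_mem/ThetaP[gs gD]|[/set_mem gD /set_mem gs]].
    by split; apply/mem_set.
  by apply/mem_set/ThetaP.
split.
- exact/open_Theta/open_Dbasic.
- exact/ThetaP.
- by rewrite E; apply: span_multM; [exact: span_mult_Dbasic|exact: span_mult_ind].
- by rewrite E; apply: span_mult_Dbasic; exact: Lspan_ind.
- move=> y /ThetaP[ys yD]; have : Theta s U y by apply/ThetaP; split=> //; exact: eFU.
  by move=> /UN /=; rewrite cabsE lecR -opprB cabsN.
Qed.

(** A new point overrides the earlier approximant on its neighbourhood, so only one constant counts
    at each germ and the errors do not accumulate. *)
Lemma patch_approx f (d : R) (N : G -> set G) (xs : seq G) :
  (forall x, [/\ span_mult (fun g => (g \in N x)%:R), Lspan (fun g => (g \in N x)%:R) &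
    forall y, N x y -> cabs (f y - f x) <= d]) ->
  exists2 g1 : G -> C, Lspan g1 & forall y,
    ((exists2 x, x \in xs & N x y) -> cabs (f y - g1 y) <= d) /\
    (~ (exists2 x, x \in xs & N x y) -> g1 y = 0).
Proof.
move=> hN; elim: xs => [|x xs [g1 Lg1 hg1]].
  by exists (fun=> 0); [exact: Lspan0|move=> y; split=> // -[]].
have [mN LN Nd] := hN x.
exists (fun g => f x * (g \in N x)%:R + (1 - (g \in N x)%:R) * g1 g).
  by apply: LspanP => //; apply: (span_multB span_mult1 mN).
move=> y; have [Ny|Ny] := boolP (y \in N x).
  rewrite mulr1 subrr mul0r addr0; split=> [_|[]]; first exact/Nd/set_mem.
  by exists x; rewrite ?inE ?eqxx //; exact: set_mem.
rewrite mulr0 subr0 mul1r add0r; have [h1 h2] := hg1 y; split.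
  move=> [z]; rewrite inE => /predU1P[-> yN|zxs zy]; first by move: Ny; rewrite mem_set.
  by apply: h1; exists z.
move=> h; apply: h2 => -[z zxs zy]; apply: h; exists z => //.
by rewrite inE zxs orbT.
Qed.

(** The list [l] is fixed before [d], because the norm estimate multiplies the uniform error by the
    length of [l]. *)
Lemma uniform_approx f : @Cc R G f -> exists l : seq (isg P), forall d : R, 0 < d ->
  exists g1 : G -> C, [/\ Lspan g1, forall y, cabs (f y - g1 y) <= d &
    forall y, f y - g1 y != 0 -> exists2 s, s \in l & Th s y].
Proof.
move=> [cf kf].
have [D hD] : exists D : seq (isg P), forall x,
    closure [set g | f g != 0] x -> exists2 s, s \in D & Th s x.
  apply: (compact_finite_cover kf) => [s|g _]; first exact: open_Th.
  by have [s [xi [h ->]]] := germP g; exists s => //; apply/ThP; exists xi, h.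
exists D => d d0.
have fc y : f y != 0 -> closure [set g | f g != 0] y.
  by move=> fy; apply: (@subset_closure G [set g | f g != 0] y).
have /choice[N hN] : forall x, exists N : set G,
  [/\ open N, N x, span_mult (fun g => (g \in N)%:R), Lspan (fun g => (g \in N)%:R) &
    forall y, N y -> cabs (f y - f x) <= d] by move=> x; exact: local_approx.
have [X hX] : exists X : seq G, forall x,
    closure [set g | f g != 0] x -> exists2 y, y \in X & N y x.
  apply: (compact_finite_cover kf) => [x|x _]; first by case: (hN x).
  by exists x => //; case: (hN x).
have [|g1 Lg1 hg1] := @patch_approx f d N X; first by move=> x; case: (hN x).
(* The indicator of the union of the chosen bisections: it confines the approximant to them without
   changing it where [f] is nonzero. *)
pose K := cupf (fun s g => (g \in Th s)%:R) D.
have mK : span_mult K by apply: span_mult_cupf => s; exact: span_mult_ind.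
exists (fun g => K g * g1 g); split; first exact: mK.
  move=> y; rewrite /K cupfE; have [/hasP[s sD /set_mem ys]|nD] := boolP (has _ _).
    rewrite mul1r; have [h1 h2] := hg1 y.
    have [hy|hy] := pselect (exists2 x, x \in X & N x y); first exact: h1.
    rewrite h2 // subr0; suff -> : f y = 0 by rewrite cabs0 ltW.
    apply/eqP; apply: contraT => fy; case: hy.
    by have [x xX xy] := hX y (fc y fy); exists x.
  rewrite mul0r subr0; suff -> : f y = 0 by rewrite cabs0 ltW.
  apply/eqP; apply: contraNT nD => fy; apply/hasP.
  by have [s sD ys] := hD y (fc y fy); exists s => //; exact: mem_set.
move=> y; rewrite /K cupfE.
have [/hasP[s sD /set_mem ys] _|nD] := boolP (has _ _); first by exists s.
rewrite mul0r subr0 => fy.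
by have [s sD ys] := hD y (fc y fy); exists s.
Qed.

Lemma lambda_approx f (e : R) : @Cc R G f -> 0 < e -> exists2 T, Lop T &
  forall phi, l2norm (lam f phi - T phi) <= e * l2norm phi.
Proof.
move=> /uniform_approx[l hl] e0.
(* The successor keeps the denominator positive when [l] is empty. *)
have m0 : 0 < (size l).+1%:R :> R by rewrite ltr0n.
have [g1 [[c _ cE] h1 h2]] := hl _ (divr_gt0 e0 m0).
have [K hK lK] := lincomb_lambda c.
exists (opcomb c); first by exists c.
have hh := cbound_bisections (ltW (divr_gt0 e0 m0)) h2 h1.
move=> phi; rewrite -lK cE.
have -> : lam f = lam (fun g => (f g - g1 g) + g1 g).
  by congr lambda; apply/funext => g; rewrite subrK.
rewrite cE in hK; rewrite (lambdaD _ hh hK) addrK.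
have [_ h] := cbound_lambda phi hh; apply: le_trans h _.
rewrite ler_wpM2r ?l2norm_ge0 // mulrA ler_pdivrMr // mulrC.
by rewrite ler_wpM2l ?ltW // ltr_nat.
Qed.

Lemma Qr_Lop : @Qr R P = op_closure Lop.
Proof.
apply/seteqP; split=> T [bT hT]; split=> // e e0.
  have e2 : 0 < e / 2 by rewrite divr_gt0.
  have [_ [f fC <-] h] := hT _ e2; have [T' LT' h'] := lambda_approx fC e2.
  exists T' => // phi; have := l2normD (T phi - lam f phi) (lam f phi - T' phi).
  rewrite addrA subrK => /le_trans; apply.
  by apply: le_trans (lerD (h phi) (h' phi)) _; rewrite -mulrDl -splitr.
have [_ [c _ <-] h] := hT e e0; exists (opcomb c) => //.
have [K hK <-] := lincomb_lambda c; exists (lincomb c) => //.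
by apply: Lspan_Cc; exists c.
Qed.

Lemma Lop_bounded : Lop `<=` @bounded_op R G.
Proof. by move=> _ [c _ <-]; have [K hK <-] := lincomb_lambda c; exact: lambda_bounded hK. Qed.

Lemma Lop0 : Lop (fun=> 0).
Proof. by exists [::] => //; apply/funext => phi; rewrite /opcomb big_nil. Qed.

Lemma LopP (a : C) S T : Lop S -> Lop T -> Lop (fun phi => a *: S phi + T phi).
Proof.
move=> [l _ <-] [l' _ <-]; exists (map (fun x => (a * x.1, x.2)) l ++ l') => //.
apply/funext => phi; rewrite /opcomb big_cat big_map scaler_sumr; congr (_ + _).
by apply: eq_bigr => x _; rewrite scalerA.
Qed.

Lemma Lop_Tact s : Lop (Tact s).
Proof.
by exists [:: (1, s)] => //; apply/funext => phi; rewrite /opcomb big_seq1 scale1r.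
Qed.

Lemma opcomb_cons c l : opcomb (c :: l) = (fun phi => c.1 *: Tact c.2 phi + opcomb l phi).
Proof. by apply/funext => phi; rewrite /opcomb big_cons. Qed.

Lemma opcomb_nil : opcomb [::] = (fun=> 0).
Proof. by apply/funext => phi; rewrite /opcomb big_nil. Qed.

Lemma Tact_opcomb s l : Tact s \o opcomb l = opcomb (map (fun c => (c.1, (s * c.2)%g)) l).
Proof.
elim: l => [|c l IH].
  by rewrite /= !opcomb_nil; apply/funext => phi; exact: linop0 (Tact_lin s).
rewrite [map _ _]/= !opcomb_cons -IH; apply/funext => phi.
by rewrite /= Tact_lin TactM.
Qed.

Lemma LopM S T : Lop S -> Lop T -> Lop (S \o T).
Proof.
move=> [l _ <-] [l' _ <-]; elim: l => [|c l IH].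
  by rewrite opcomb_nil; exact: Lop0.
have h : Lop (Tact c.2 \o opcomb l') by rewrite Tact_opcomb; eexists.
by have := LopP c.1 h IH; rewrite opcomb_cons.
Qed.

Lemma Lop_adjoint T : Lop T -> exists2 S, Lop S & adjoint_op T S.
Proof.
move=> [l _ <-]; elim: l => [|c l [S LS hS]].
  exists (fun=> 0); first exact: Lop0.
  by move=> phi psi; rewrite opcomb_nil inner0l innerC inner0l rmorph0.
exists (fun phi => c.1^* *: Tact (istar c.2) phi + S phi).
  by apply: LopP => //; exact: Lop_Tact.
rewrite opcomb_cons; exact: (adjoint_lin c.1 (@Tact_adjoint R P c.2) hS).
Qed.

Lemma Qr_subalgebra : cstar_subalgebra (@Qr R P).
Proof.
rewrite Qr_Lop; apply: op_closure_cstar.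
- exact: Lop_bounded.
- exact: Lop0.
- exact: LopP.
- exact: LopM.
- exact: Lop_adjoint.
Qed.

Lemma Qr_Tact s : @Qr R P (Tact s).
Proof. by rewrite Qr_Lop; apply: sub_op_closure Lop_bounded _ (Lop_Tact s). Qed.

Lemma Tgen_Tact p q : @Tgen R P p q = Tact (br p q).
Proof. by rewrite -lambda_ind /Tgen /ind /Th isrc_br. Qed.

Lemma Qrc_Qr : @Qrc R P `<=` @Qr R P.
Proof.
apply: smallest_sub; first exact: Qr_subalgebra.
by move=> _ [p [q [_ _ ->]]]; rewrite Tgen_Tact; exact: Qr_Tact.
Qed.

End Density.

(** * Compression to the core *)

Section Compression.
Local Open Scope group_scope.
Variable P : rightLCMType.
Implicit Types (s t : isg P) (e f : idemS P) (w x y a : P) (g : germ P).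

(** The part of [s] that maps [wP] into [wP], carried over to [P] by cancelling [w]; see
    [acts_compress]. *)
Definition compress s w : isg P := br 1 w * (s * br w 1).

Lemma acts_to1 w x y : acts (br 1 w) x y <-> x = w * y.
Proof.
rewrite acts_br; split=> [[v [-> ->]]|->]; first by rewrite mul1g.
by exists y; rewrite mul1g.
Qed.

Lemma acts_from1 w x y : acts (br w 1) x y <-> y = w * x.
Proof.
rewrite acts_br; split=> [[v [-> ->]]|->]; first by rewrite mul1g.
by exists x; rewrite mul1g.
Qed.

Lemma acts_compress s w x y : acts (compress s w) x y <-> acts s (w * x) (w * y).
Proof.
rewrite acts_mul; split=> [[z sz /acts_to1 zE]|h].
  by move: sz; rewrite zE acts_mul => -[u /acts_from1 ->].
exists (w * y); last exact/acts_to1.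
by apply/acts_mul; exists (w * x) => //; exact/acts_from1.
Qed.

(** If the compression is [p, q], the hypothesis gives for each [a] a pair in its graph with both
    entries in [aP]; the first lies in [qP] and the second in [pP]. *)
Lemma compress_core s w : (forall a, exists x y, acts s (w * a * x) (w * a * y)) ->
  exists p q, [/\ core p, core q & compress s w = br p q].
Proof.
move=> h; have h' a : exists x y, acts (compress s w) (a * x) (a * y).
  by have [x [y H]] := h a; exists x, y; apply/acts_compress; rewrite !mulgA.
have [E|[p [q E]]] := brP (compress s w).
  by have [x [y]] := h' 1; rewrite E.
exists p, q; split=> // a; have [x [y]] := h' a; rewrite E => /acts_br[v [e1 e2]].
  by exists (a * y); split; [exists v|exists y].
by exists (a * x); split; [exists v|exists x].
Qed.

Lemma compress_None s w : (forall x y, ~ acts s (w * x) (w * y)) -> compress s w = None.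
Proof.
move=> h; have [//|[p [q E]]] := brP (compress s w).
have : acts (compress s w) q p by rewrite E; apply/acts_br; exists 1; rewrite !mulg1.
by move/acts_compress/h.
Qed.

(** Both alternatives persist when [w] is multiplied on the right, so the elements of [l] can be
    treated one at a time. *)
Lemma shrink_core (l : seq (isg P)) w : exists a, forall s, s \in l ->
  compress s (w * a) = None \/
  exists p q, [/\ core p, core q & compress s (w * a) = br p q].
Proof.
suff [a ha] : exists a, forall s, s \in l ->
    (forall x y, ~ acts s (w * a * x) (w * a * y)) \/
    (forall b, exists x y, acts s (w * a * b * x) (w * a * b * y)).
  exists a => s /ha[h|h]; first by left; exact: compress_None.
  by right; exact: compress_core.
elim: l w => [|s l IH] w; first by exists 1.
have [a ha] := IH w.
have [[b hb]|nb] := pselect (exists b, forall x y, ~ acts s (w * a * b * x) (w * a * b * y)).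
  exists (a * b) => t; rewrite inE => /predU1P[->|/ha[h|h]].
  - by left=> x y; rewrite mulgA; exact: hb.
  - by left=> x y; rewrite !mulgA -(mulgA _ b x) -(mulgA _ b y); exact: h.
  - right=> c; have [x [y H]] := h (b * c); exists x, y.
    by move: H; rewrite !mulgA.
exists a => t; rewrite inE => /predU1P[->|/ha //]; right=> b.
apply: contrapT => h; apply: nb; exists b => x y H; apply: h.
by exists x, y.
Qed.

Lemma rideal_emem e x y : emem e x -> emem e (x * y).
Proof.
have [E|[p E]] := idemSP e; rewrite /emem E // => /acts_br[v [-> _]].
by apply/acts_br; exists (v * y); rewrite !mulgA.
Qed.

Lemma emem_ebr_sub e w : emem e w -> forall x, emem (ebr w) x -> emem e x.
Proof. by move=> ew x /emem_ebr[v ->]; exact: rideal_emem. Qed.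

(** The form of not being fixed that passes to smaller idempotents; the plain negation of [fixset]
    does not. *)
Definition moved s e :=
  forall e', (forall x, emem e' x -> emem e x) -> (exists x, emem e' x) -> ~ Defs.fixset s e'.

(** Whether [s] fixes a germ depends only on its range, here [tpull h], so the question moves from
    germs to filters. *)
Lemma germ_fixP s t (xi : tspec P) (h : tspec_mem xi (isrc t)) :
  gact s (mk_germ h) = Some (mk_germ h) <->
  exists2 e, tspec_mem (tpull h) e & Defs.fixset s e.
Proof.
have pE e : tspec_mem (tpull h) e = tspec_mem xi (epull t e).
  by rewrite {1}/tspec_mem val_tpull theta_pull.
have fx := tspec_filter xi.
split=> [/gact_fixP[e xe /acts_agree E]|[e]].
  exists (epull (istar t) e).
    by rewrite pE -{1}(istarK t) epullK istarK; exact: (filter_mul fx).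
  apply/fixsetP => y /emem_epull[x /acts_star txy ex].
  have /(E x y ex)/acts_mul[z tz] := txy.
  by rewrite (acts_fun tz txy).
rewrite pE => xe /fixsetP se; apply: (gact_fix h xe).
apply/acts_agree => x y /emem_epull[z tz ez].
have st : acts (s * t) x z by apply/acts_mul; exists z => //; exact: se.
by split=> [/(acts_fun st)|/(acts_fun tz)] <-.
Qed.

Section CondH.
Hypothesis hH : condH P.

(* Any tight filter looks, on the finite data given by condition (H), like an ultrafilter, and
   an ultrafilter decides each s: some member is fixed by s or meets no idempotent fixed by s. *)
Lemma decide_fixed (l : seq (isg P)) (xi : tspec P) : exists w, forall s, s \in l ->
  ((exists2 e, tspec_mem xi e & Defs.fixset s e) -> Defs.fixset s (ebr w)) /\
  (~ (exists2 e, tspec_mem xi e & Defs.fixset s e) -> moved s (ebr w)).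
Proof.
have /choice[F hF] := fun s => condH_tight hH s.
have [_ /closure_ultraP/(_ (flatten (map F l)))[eta ueta he]] := set_valP xi.
have feta : efilter eta by case: ueta.
have agree s f : s \in l -> f \in F s -> eta f = tspec_mem xi f.
  by move=> sl fF; apply: he; apply/flatten_mapP; exists s.
have dec s : exists e, s \in l -> eta e /\
    ((exists2 e, tspec_mem xi e & Defs.fixset s e) -> Defs.fixset s e) /\
    (~ (exists2 e, tspec_mem xi e & Defs.fixset s e) -> moved s e).
  have [sl|] := boolP (s \in l); last by exists (ebr 1).
  have [Fs [Fx Fe]] := hF s.
  have [[e xe se]|nfix] := pselect (exists2 e, tspec_mem xi e & Defs.fixset s e).
    have [f fF xf] := Fx xi e se xe.
    exists f => _; split; first by rewrite (agree s).
    by split=> [_|[]]; [exact: Fs|exists e].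
  have /choice[c hc] : forall f, exists e, f \in F s ->
      eta e /\ forall x, emem e x -> ~ emem f x.
    move=> f; have [fF|] := boolP (f \in F s); last by exists (ebr 1).
    have [|e ? ?] := ultra_notin (f := f) ueta; last by exists e.
    by rewrite (agree s) //; apply/negP => xf; apply: nfix; exists f => //; exact: Fs.
  exists (efold (map c (F s))) => _; split; last first.
    split=> // _ e' sub ne' se'; have [f fF [x [ex fx]]] := Fe e' se' ne'.
    have [_ /(_ x)] := hc f fF; apply => //.
    by have /emem_efold := sub x ex; apply; exact: map_f.
  by apply: filter_efold => // _ /mapP[f fF ->]; have [] := hc f fF.
have [c hc] := choice dec.
have [|w we] := @filter_mem _ _ feta (efold (map c l)).
  by apply: filter_efold => // _ /mapP[s sl ->]; have [] := hc s sl.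
exists w => s sl; have [_ [h1 h2]] := hc s sl.
have ws : forall x, emem (ebr w) x -> emem (c s) x.
  apply: emem_ebr_sub; have /emem_efold := we; apply; exact: map_f.
split=> [/h1/fixsetP h|/h2 h e' sub]; first by apply/fixsetP => x /ws; exact: h.
by apply: h => x /sub; exact: ws.
Qed.

End CondH.

(** Cancelling [w] turns [s] into its compression, so the compression fixes this germ exactly when
    [s] fixes an ideal inside [wP] that belongs to [xi]. *)
Lemma compress_fix s w (xi : tspec P) (h : tspec_mem xi (isrc (br 1 w))) :
  (Defs.fixset s (ebr w) -> gact (compress s w) (mk_germ h) = Some (mk_germ h)) /\
  (moved s (ebr w) -> gact (compress s w) (mk_germ h) <> Some (mk_germ h)).
Proof.
have xw : tspec_mem xi (ebr w) by move: (h); rewrite isrc_br.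
split=> [/fixsetP se|ms /gact_fixP[e xe /acts_agree E]].
  apply: (gact_fix h xw); apply/acts_agree => x y xw'.
  have [v xE] : exists v, x = w * v by apply/emem_ebr.
  have wv : acts (br 1 w) x v by exact/acts_to1.
  have sv : acts (compress s w * br 1 w) x v.
    by apply/acts_mul; exists v => //; apply/acts_compress; rewrite -xE; exact: se.
  by split=> [/(acts_fun sv)|/(acts_fun wv)] <-.
have fx := tspec_filter xi.
apply: (ms (emul e (ebr w))); first by move=> x /emem_emul[].
  exact: (filter_mem fx (filter_mul fx xe xw)).
apply/fixsetP => x /emem_emul[ex /emem_ebr[v xE]].
have wv : acts (br 1 w) x v by exact/acts_to1.
have /(E x v ex)/acts_mul[z /(acts_fun wv) <-] := wv.
by rewrite acts_compress -xE.
Qed.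

End Compression.

(** * Triviality of the kernel *)

Section Injectivity.
Variables (R : realType) (P : rightLCMType).
Hypothesis hH : condH P.
Local Notation C := (cplx R).
Local Notation G := (germ P).
Local Notation Tact := (@Tact R P).
Local Notation opcomb := (@opcomb R P).
Local Notation delta := (@delta R G).
Local Notation bop := (bop R G).

(** An intersection of subalgebras inherits the closure properties directly; boundedness of its
    elements comes from one member of the family, [Qr]. *)
Lemma Qrc_subalgebra : cstar_subalgebra (@Qrc R P).
Proof.
have bQr := Qrc_Qr (R := R) hH; split.
- by move=> T /bQr; case: (Qr_subalgebra R hH) => h _ _ _ _; exact: h.
- by move=> A [[]].
- by move=> c S T hS hT A hA; have [_ _ h _ _] := hA.1; apply: h; [exact: hS|exact: hT].
- by move=> S T hS hT A hA; have [_ _ _ h _] := hA.1; apply: h; [exact: hS|exact: hT].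
split=> [S T hS bT ST A hA|T [bT hT] A hA]; have [_ _ _ _ [h1 h2]] := hA.1.
  by apply: h1 ST => //; exact: hS.
apply: h2; split=> // e /hT[T' hT' TT']; exists T' => //; exact: hT'.
Qed.

Lemma Qrc_Tact p q : core p -> core q -> @Qrc R P (Tact (br p q)).
Proof. by move=> cp cq A [_]; apply; exists p, q; rewrite Tgen_Tact. Qed.

Lemma Tact_id : Tact (br 1%g 1%g) = id.
Proof.
apply/funext => phi; apply: ell2_ext => g; rewrite TactE istar_br.
have [t [xi [h ->]]] := germP g; rewrite (gact_fix (e := ebr 1%g) h) //.
  exact: (filter1 (tspec_filter xi)).
congr (_ * _)%g; apply: acts_inj => x y; rewrite acts_mul.
by split=> [[z tz /acts_to1]|txy]; last exists y => //;
  rewrite ?mul1g ?acts_to1 ?mul1g // => <-.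
Qed.

Lemma core1 : core (1%g : P).
Proof.
move=> q; exists q; split; first by exists q; rewrite ?mul1g.
by exists 1%g; rewrite ?mulg1.
Qed.

Lemma Qrc_id : @Qrc R P id.
Proof. by rewrite -Tact_id; apply: Qrc_Tact; exact: core1. Qed.

Lemma Qrc_opcomb l : (forall c, c \in l -> c.2 = None \/
    exists p q, [/\ core p, core q & c.2 = br p q]) -> @Qrc R P (opcomb l).
Proof.
have [_ Q0 QP _ _] := Qrc_subalgebra.
elim: l => [|c l IH] hl; first by rewrite opcomb_nil.
rewrite opcomb_cons; apply: QP; last by apply: IH => d dl; apply: hl; rewrite inE dl orbT.
have [->|[p [q [cp cq ->]]]] := hl c (mem_head _ _); first by rewrite Tact0.
exact: Qrc_Tact.
Qed.

(** If [x] kills all basis vectors, then so does its adjoint, whose matrix coefficients are the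
    conjugates; moving [x] across the inner product then shows that every coordinate of [x phi] is
    0, without a density argument. *)
Lemma bop_delta_neq0 (x : bop) : x != 0 -> exists g, x (delta g) != 0.
Proof.
move=> x0; apply: contrapT => /forallNP h; move/eqP: x0; apply; apply: bop_ext => phi.
have xd g : x (delta g) = 0 by apply/eqP/contraT => n; case: (h g).
have ad k : badj x (delta k) = 0.
  apply: ell2_ext => g; rewrite -inner_delta innerC -badjP xd inner0l.
  by rewrite rmorph0.
by apply: ell2_ext => k; rewrite -inner_delta badjP ad innerC inner0l rmorph0.
Qed.

Lemma Tact_delta s g : Tact s (delta g) g = (gact s g == Some g)%:R.
Proof.
rewrite TactE; have [E|nE] := eqVneq (gact s g) (Some g).
  by rewrite (gactK E) deltaE eqxx.
case E : (gact (istar s) g) => [h|] //; rewrite deltaE.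
by case: eqP => // hg; subst h; move/eqP: nE; have := gactK E; rewrite istarK.
Qed.

Lemma opcomb_delta l g :
  opcomb l (delta g) g = \sum_(c <- l) c.1 * (gact c.2 g == Some g)%:R.
Proof.
elim: l => [|c l IH]; first by rewrite opcomb_nil big_nil.
by rewrite opcomb_cons big_cons -IH -Tact_delta.
Qed.

Lemma tact_bop s : exists x : bop, bop_fun x = Tact s.
Proof. exact: (alg_bop (@Lop_bounded R P) (@Lop_adjoint R P) (Lop_Tact R s)). Qed.

Definition compress_comb (l : seq (C * isg P)) w :=
  [seq (c.1, compress c.2 w) | c <- l].

Lemma opcomb_compress l w : opcomb (compress_comb l w) =
  Tact (br 1%g w) \o (opcomb l \o Tact (br w 1%g)).
Proof.
elim: l => [|c l IH].
  by rewrite /= !opcomb_nil; apply/funext => phi; rewrite /= linop0 //; exact: Tact_lin.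
rewrite [compress_comb _ _]/= !opcomb_cons IH; apply/funext => phi.
by rewrite /= Tact_lin /compress !TactM.
Qed.

Lemma compress_delta (l : seq (C * isg P)) g : exists w g',
  (forall c, c \in compress_comb l w -> c.2 = None \/
     exists p q, [/\ core p, core q & c.2 = br p q]) /\
  opcomb (compress_comb l w) (delta g') g' = opcomb l (delta g) g.
Proof.
have [t [xi [h gE]]] := germP g.
have [w0 hw0] := decide_fixed hH [seq c.2 | c <- l] (tpull h).
have [a ha] := shrink_core [seq c.2 | c <- l] w0.
have [eta ueta etaw] := ultra_ex (w0 * a)%g.
have h' : tspec_mem (tspec_ultra ueta) (isrc (br 1%g (w0 * a)%g)) by rewrite isrc_br.
exists (w0 * a)%g, (mk_germ h'); split.
  by move=> _ /mapP[c cl ->] /=; apply: ha; exact: map_f.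
apply: (etrans (opcomb_delta _ _)); apply/esym; apply: (etrans (opcomb_delta _ _)).
rewrite /compress_comb big_map; apply/esym.
apply: eq_big_seq => c cl /=.
have cl' : c.2 \in [seq c.2 | c <- l] by exact: map_f.
have [h1 h2] := hw0 _ cl'.
have sub x : emem (ebr (w0 * a)%g) x -> emem (ebr w0) x.
  by move=> /emem_ebr[v ->]; apply/emem_ebr; exists (a * v)%g; rewrite mulgA.
have [f1 f2] := compress_fix c.2 h'.
suff -> : (gact (compress c.2 (w0 * a)%g) (mk_germ h') == Some (mk_germ h')) =
    (gact c.2 g == Some g) by [].
rewrite gE.
have [fx|nfx] := pselect (exists2 e, tspec_mem (tpull h) e & Defs.fixset c.2 e).
  rewrite f1; first by have -> := (germ_fixP c.2 h).2 fx; rewrite !eqxx.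
  by apply/fixsetP => x /sub; apply/fixsetP: x; exact: h1.
apply/eqP/eqP => [E|/germ_fixP //]; exfalso; apply: f2 E.
by move=> e' es; apply: (h2 nfx) => x /es /sub.
Qed.

Variables (B : cstarAlgebra R) (pi : (ell2 R G -> ell2 R G) -> B).
Hypothesis hpi : star_hom (@Qr R P) pi.
Hypothesis pi_inj : set_inj (@Qrc R P) pi.

Lemma ker_pi_trivial (a : bop) : @Qr R P a -> pi a = 0 -> a = 0.
Proof.
have QA := Qr_subalgebra R hH; have Qid : @Qr R P id by apply: Qrc_Qr => //; exact: Qrc_id.
move=> Qa a0; apply/eqP/contraT => /bop_delta_neq0[g ag].
pose b := bmul (badj a) a.
have Qaa := subalgebra_adj QA Qa; have Qb := subalgebraM QA Qaa Qa : @Qr R P b.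
pose n := (l2norm (a (delta g))) ^+ 2.
have n0 : 0 < n.
  rewrite exprn_gt0 // lt_neqAle l2norm_ge0 andbT eq_sym.
  by apply: contra_neq ag; exact: l2norm0_eq0.
have bg : b (delta g) g = n%:C%C.
  by rewrite -inner_delta [X in inner X _]/(badj a (a (delta g))) innerC -badjP
     inner_ff; exact: conjc_real.
have n3 : 0 < n / 3%:R by rewrite divr_gt0.
have [_ [l _ <-] bl] : exists2 T, @Lop R P T &
    forall f, l2norm (b f - T f) <= n / 3%:R * l2norm f.
  by move: Qb; rewrite Qr_Lop // => -[_]; exact.
have [w [g' [lcore lg]]] := compress_delta l g.
have [xc xcE] : exists x : bop, bop_fun x = opcomb (compress_comb l w).
  apply: (alg_bop (@Lop_bounded R P) (@Lop_adjoint R P)).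
  by exists (compress_comb l w).
have Qc : @Qrc R P xc by rewrite xcE; exact: Qrc_opcomb.
have [x1 x1E] := tact_bop (br 1%g w); have [x2 x2E] := tact_bop (br w 1%g).
have Q1 : @Qr R P x1 by rewrite x1E; exact: Qr_Tact.
have Q2 : @Qr R P x2 by rewrite x2E; exact: Qr_Tact.
pose d := bmul x1 (bmul b x2).
have Qd := subalgebraM QA Q1 (subalgebraM QA Qb Q2) : @Qr R P d.
have pid : pi d = 0.
  rewrite (star_homM hpi Q1 (subalgebraM QA Qb Q2)) (star_homM hpi Qb Q2).
  rewrite (star_homM hpi Qaa Qa) a0.
  have mul00 (y : cstarAlgebra_cstarSpace B) : cmul y 0 = 0 by exact: (mulx0 y).
  have mul01 (y : cstarAlgebra_cstarSpace B) : cmul 0 y = 0 by exact: (mul0x y).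
  by rewrite mul00 mul01 mul00.
have Qxc : @Qr R P xc by exact: Qrc_Qr.
have dist : bnorm (xc - d) <= n / 3%:R.
  apply: opnorm_le => [|f]; first exact: ltW.
  rewrite -[(_ : bop) f]/(xc f - d f) xcE opcomb_compress /= x1E x2E.
  rewrite -linopB; last exact: Tact_lin.
  apply: le_trans (Tact_norm _ _) _; rewrite l2normBC; apply: le_trans (bl _) _.
  by apply: ler_wpM2l; [exact: ltW|exact: Tact_norm].
have cn : bnorm xc <= n / 3%:R.
  have <- := star_hom_isometry QA hpi Qrc_subalgebra Qrc_id (Qrc_Qr (R := R) hH) pi_inj Qc.
  have -> : pi xc = pi (xc - d : bop).
    have := star_homP hpi (-1) Qd Qxc; rewrite pid scaler0 add0r => <-.
    by congr (pi _); rewrite scaleN1r addrC.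
  by apply: le_trans dist; exact: (star_hom_contr QA Qid hpi (subalgebraB QA Qxc Qd)).
have v1 : cabs (opcomb l (delta g) g) <= n / 3%:R.
  rewrite -lg -xcE; apply: le_trans (le_cabs_l2norm _ _) _.
  by apply: le_trans (bop_nrmP _ _) _; rewrite l2norm_delta mulr1.
have v2 : cabs (n%:C%C - opcomb l (delta g) g) <= n / 3%:R.
  rewrite -bg; apply: le_trans (le_cabs_l2norm (b (delta g) - opcomb l (delta g)) g) _.
  by apply: le_trans (bl _) _; rewrite l2norm_delta mulr1.
have := cabsD (n%:C%C - opcomb l (delta g) g) (opcomb l (delta g) g).
by rewrite subrK cabsr ger0_norm ?(ltW n0) //; lra.
Qed.

End Injectivity.

Theorem theorem2p1 (R : realType) (P : rightLCMType) (hH : condH P)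
    (B : cstarAlgebra R)
    (pi : (ell2 R (germ P) -> ell2 R (germ P)) -> B)
    (hpi : star_hom (@Qr R P) pi) :
  set_inj (@Qr R P) pi <-> set_inj (@Qrc R P) pi.
Proof.
split=> [inj S T /set_mem QS /set_mem QT|inj S T /set_mem QS /set_mem QT ST].
  by apply: inj; apply/mem_set/Qrc_Qr.
have opcl := op_closure_bop (@Lop_bounded R P) (@Lop_adjoint R P).
have [x xE] : exists x : bop R (germ P), bop_fun x = S by apply: opcl; rewrite -Qr_Lop.
have [y yE] : exists x : bop R (germ P), bop_fun x = T by apply: opcl; rewrite -Qr_Lop.
rewrite -xE -yE in QS QT ST *.
suff : x - y = 0 by move/eqP; rewrite subr_eq0 => /eqP ->.
have QA := Qr_subalgebra R hH.
apply: (ker_pi_trivial hH hpi inj); first exact: (subalgebraB QA QS QT).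
have := star_homP hpi (-1) QT QS; rewrite ST [X in _ = X + _]scaleN1r addNr => <-.
by congr (pi _); rewrite scaleN1r addrC.
Qed.
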